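(* Let $\mathbf W=\{\mathbf W_{i,j}\}$ be the universal model associated with the noncommutative polydomain $\mathbf D^{\mathbf m}_{\mathbf f}$, and let $\mathcal Q_c$ be the left ideal generated by all polynomials of the form $Z_{i,j_1}Z_{i,j_2}-Z_{i,j_2}Z_{i,j_1}$, $i\in\{1,\dots,k\}$, $j_1,j_2\in\{1,\dots,n_i\}$. Then the following statements hold. (i) $F_s^2(\mathbf D^{\mathbf m}_{\mathbf f})=\overline{\mathrm{span}}\{\Gamma_\lambda:\lambda\in\mathbf D^{\mathbf m}_{\mathbf f,>}(\mathbb C)\}=\mathcal N_{\mathcal Q_c}:=(\otimes_{i=1}^kF^2(H_{n_i}))\ominus\mathcal M_{\mathcal Q_c}$. (ii) The space $F^2_s(\mathbf D^{\mathbf m}_{\mathbf f})$ can be identified with the Hilbert space $H^2(\mathbf D^{\mathbf m}_{\mathbf f,>}(\mathbb C))$ of all functions $\varphi:\mathbf D^{\mathbf m}_{\mathbf f,>}(\mathbb C)\to\mathbb C$ which admit a power series representation $$\varphi(\lambda)=\sum_{\mathbf k_1\in\mathbb N_0^{n_1},\dots,\mathbf k_k\in\mathbb N_0^{n_k}}c_{\mathbf k_1,\dots,\mathbf k_k}\lambda_1^{\mathbf k_1}\cdots\lambda_k^{\mathbf k_k}\quad\text{with}\quad\|\varphi\|_2^2=\sum_{\mathbf k_1,\dots,\mathbf k_k}|c_{\mathbf k_1,\dots,\mathbf k_k}|^2\frac1{\gamma^{(m_1)}_{\mathbf k_1}}\cdots\frac1{\gamma^{(m_k)}_{\mathbf k_k}}<\infty.$$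 More precisely, every element $\varphi=\sum c_{\mathbf k_1,\dots,\mathbf k_k}w_1^{\mathbf k_1}\otimes\cdots\otimes w_k^{\mathbf k_k}$ in $F_s^2(\mathbf D^{\mathbf m}_{\mathbf f})$ has a functional representation on $\mathbf D^{\mathbf m}_{\mathbf f,>}(\mathbb C)$ given by $$\varphi(\lambda):=\langle\varphi,u_\lambda\rangle=\sum_{\mathbf k_1,\dots,\mathbf k_k}c_{\mathbf k_1,\dots,\mathbf k_k}\lambda_1^{\mathbf k_1}\cdots\lambda_k^{\mathbf k_k},\qquad\lambda=(\lambda_1,\dots,\lambda_k)\in\mathbf D^{\mathbf m}_{\mathbf f,>}(\mathbb C),$$ and $$|\varphi(\lambda)|\le\frac{\|\varphi\|_2}{\sqrt{\Delta^{\mathbf m}_{\mathbf f,\lambda}(1)}},\qquad\lambda\in\mathbf D^{\mathbf m}_{\mathbf f,>}(\mathbb C).$$ (iii) The mapping $\kappa^c_{\mathbf f}:\mathbf D^{\mathbf m}_{\mathbf f,>}(\mathbb C)\times\mathbf D^{\mathbf m}_{\mathbf f,>}(\mathbb C)\to\mathbb C$ defined by $$\kappa^c_{\mathbf f}(\mu,\lambda):=\frac1{\prod_{i=1}^k\left(1-f_i(\mu_i\overline{\lambda}_i)\right)^{m_i}},$$ where $\lambda=(\lambda_1,\dots,\lambda_k)$ and $\mu=(\mu_1,\dots,\mu_k)$ are in $\mathbf D^{\mathbf m}_{\mathbf f,>}(\mathbb C)$, is positive definite and $\kappa^c_{\mathbf f}(\mu,\lambda)=\langle u_\lambda,u_\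mu\rangle$.
   Context: Fix $k\ge 1$ and $(n_1,\dots,n_k)$, $\mathbf m=(m_1,\dots,m_k)$ in $\mathbb N^k$, $\mathbb N=\{1,2,\dots\}$, $\mathbb N_0=\{0,1,\dots\}$. $\mathbb F^+_{n_i}$ is the free unital semigroup on generators $g^i_1,\dots,g^i_{n_i}$ with identity $g^i_0$; $|\alpha|$ is word length. For a tuple $X_i=(X_{i,1},\dots,X_{i,n_i})$ (operators or scalars) and $\alpha=g^i_{j_1}\cdots g^i_{j_p}$ put $X_{i,\alpha}=X_{i,j_1}\cdots X_{i,j_p}$, $X_{i,g^i_0}=I$. $\mathbb C[Z_{i,j}]$ is the algebra of polynomials in indeterminates $Z_{i,j}$, where $Z_{i,1},\dots,Z_{i,n_i}$ are noncommuting and $Z_{s,j},Z_{t,l}$ commute for $s\ne t$. $\mathbf f=(f_1,\dots,f_k)$, where each $f_i=\sum_{\alpha\in\mathbb F^+_{n_i}}a_{i,\alpha}Z_{i,\alpha}$ is a positive regular free holomorphic function: $a_{i,\alpha}\ge0$, $a_{i,g^i_0}=0$, $a_{i,g^i_j}>0$ for $1\le j\le n_i$, and $\limsup_{p\to\infty}(\sum_{|\alpha|=p}|a_{i,\alpha}|^2)^{1/2p}<\infty$. For scalar $z_i,w_i\in\mathbb C^{n_i}$, $z_i\overline w_i=(z_{i,1}\overline w_{i,1},\dots,z_{i,n_i}\overline w_{i,n_i})$ and $f_i(z_i\overline w_i)=\sum_\alpha a_{i,\alpha}z_{i,\alpha}\overline{w_{i,\alpha}}$. $F^2(H_{n_i})=\mathbb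 C1\oplus\bigoplus_{p\ge1}H_{n_i}^{\otimes p}$ is the full Fock space over an $n_i$-dimensional Hilbert space, with orthonormal basis $\{e^i_\alpha\}_{\alpha\in\mathbb F^+_{n_i}}$, $e^i_{g^i_0}=1$. Set $b^{(m_i)}_{i,g^i_0}=1$ and $b^{(m_i)}_{i,\alpha}=\sum_{p=1}^{|\alpha|}\sum_{\gamma_1\cdots\gamma_p=\alpha,\,|\gamma_s|\ge1}a_{i,\gamma_1}\cdots a_{i,\gamma_p}\binom{p+m_i-1}{m_i-1}$ for $|\alpha|\ge1$; $W_{i,j}e^i_\alpha=\sqrt{b^{(m_i)}_{i,\alpha}/b^{(m_i)}_{i,g^i_j\alpha}}\;e^i_{g^i_j\alpha}$; $\mathbf W_{i,j}=I\otimes\cdots\otimes W_{i,j}\otimes\cdots\otimes I$ ($i$-th factor) on $\otimes_{i=1}^kF^2(H_{n_i})$. $\mathcal M_{\mathcal Q_c}$ is the closed linear span of the ranges of $g(\mathbf W)$, $g\in\mathcal Q_c$. $\mathbf D^{\mathbf m}_{\mathbf f,>}(\mathbb C)=\{\lambda=(\lambda_1,\dots,\lambda_k)\in\mathbb C^{n_1}\times\cdots\times\mathbb C^{n_k}:\sum_{|\alpha|\ge1}a_{i,\alpha}|\lambda_{i,\alpha}|^2<1\text{ for each }i\}$. For such $\lambda$: $\Delta^{\mathbf m}_{\mathbf f,\lambda}(1)=\prod_{i=1}^k(1-\sum_{|\alpha|\ge1}a_{i,\alpha}|\lambda_{i,\alpha}|^2)^{m_i}$, $u_\lambda=\sum_{\beta_1,\dots,\beta_k}\overline{\lambda}_{1,\beta_1}\cdots\overline{\lambda}_{k,\beta_k}\sqrt{b^{(m_1)}_{1,\beta_1}}\cdots\sqrt{b^{(m_k)}_{k,\beta_k}}\,e^1_{\beta_1}\otimes\cdots\otimes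 e^k_{\beta_k}$ and $\Gamma_\lambda=\Delta^{\mathbf m}_{\mathbf f,\lambda}(1)^{1/2}u_\lambda$. For $\mathbf k_i=(k_{i,1},\dots,k_{i,n_i})\in\mathbb N_0^{n_i}$: $\lambda_i^{\mathbf k_i}=\lambda_{i,1}^{k_{i,1}}\cdots\lambda_{i,n_i}^{k_{i,n_i}}$, $\Lambda_{\mathbf k_i}=\{\alpha\in\mathbb F^+_{n_i}:\lambda_{i,\alpha}=\lambda_i^{\mathbf k_i}\text{ for all }\lambda_i\in\mathbb C^{n_i}\}$, $\gamma^{(m_i)}_{\mathbf k_i}=\sum_{\alpha\in\Lambda_{\mathbf k_i}}b^{(m_i)}_{i,\alpha}$, $w_i^{\mathbf k_i}=\frac1{\gamma^{(m_i)}_{\mathbf k_i}}\sum_{\alpha\in\Lambda_{\mathbf k_i}}\sqrt{b^{(m_i)}_{i,\alpha}}\,e^i_\alpha$. The vectors $w_1^{\mathbf k_1}\otimes\cdots\otimes w_k^{\mathbf k_k}$ are mutually orthogonal; $F_s^2(\mathbf D^{\mathbf m}_{\mathbf f})\subset\otimes_iF^2(H_{n_i})$ is their closed span. *)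

(* Defs.v *)
From HB Require Import structures.
From mathcomp Require Import all_boot all_order all_algebra finmap complex.
From mathcomp Require Import all_classical all_reals all_analysis.
From mathcomp Require Import summability.
From mathcomp Require Import -(notations) monalg.

Set Implicit Arguments.
Unset Strict Implicit.
Unset Printing Implicit Defensive.

Import Order.TTheory GRing.Theory Num.Theory numFieldNormedType.Exports.

Local Open Scope classical_set_scope.
Local Open Scope ring_scope.
Local Open Scope complex_scope.

#[export] Existing Instance totally_filter.

Notation normc := Normc.normc.

Section Hilbert.
Context {R : realType}.
Local Notation C := R[i].

(* Unordered sums of complex families, as limits along the finite subsets of I.
   R[i] carries its usual topology through the regular module (R[i])^o. *)
Definition has_csum (I : choiceType) (x : I -> C) (s : C) : Prop :=
  partial_sum (x : I -> C^o) @ totally --> (s : C^o).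

Definition csum (I : choiceType) (x : I -> C) : C :=
  summability.sum (x : I -> C^o).

(* The Hilbert space l^2(I), as the set [ell2] of functions I -> C. *)
Section l2.
Context {I : choiceType}.
Implicit Types (x y : I -> C) (S : set (I -> C)).

Definition sqnorm2 x : \bar R := \esum_(b in [set: I]) (normc (x b) ^+ 2)%:E.

Definition ell2 : set (I -> C) := [set x | (sqnorm2 x < +oo)%E].

Definition norm2 x : R := Num.sqrt (fine (sqnorm2 x)).

Definition inner x y : C := csum (fun b => x b * (y b)^*).

Definition delta (b : I) : I -> C := fun b' => (b' == b)%:R.

Definition span S : set (I -> C) :=
  [set x | exists (N : nat) (c : 'I_N -> C) (v : 'I_N -> I -> C),
     (forall l, S (v l)) /\ x = \sum_(l < N) c l *: v l].

Definition clspan S : set (I -> C) :=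
  [set x | ell2 x /\
     forall e : R, 0 < e -> exists2 y, span S y & norm2 (x - y) < e].

Definition orthocompl S : set (I -> C) :=
  [set x | ell2 x /\ forall y, S y -> inner x y = 0].

Definition has_l2sum (J : choiceType) (v : J -> I -> C) x : Prop :=
  (fun A : {fset J} => norm2 (x - partial_sum v A)) @ totally --> (0 : R).

End l2.

Record is_hilbert (V : lmodType C) (S : set V) (ip : V -> V -> C)
    (nrm : V -> R) : Prop := IsHilbert {
  hilbert0 : S 0;
  hilbertP : forall (c : C) x y, S x -> S y -> S (c *: x + y);
  ip_linear : forall (c : C) x y z, S x -> S y -> S z ->
    ip (c *: x + y) z = c * ip x z + ip y z;
  ip_conj : forall x y, S x -> S y -> ip y x = (ip x y)^*;
  ip_norm : forall x, S x -> ip x x = ((nrm x) ^+ 2)%:C;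
  nrm_ge0 : forall x, S x -> 0 <= nrm x;
  nrm_eq0 : forall x, S x -> nrm x = 0 -> x = 0;
  hilbert_complete : forall u : nat -> V, (forall N, S (u N)) ->
    (forall e : R, 0 < e -> exists N0 : nat, forall p q : nat,
       (N0 <= p)%N -> (N0 <= q)%N -> nrm (u p - u q) < e) ->
    exists2 x, S x & (fun N => nrm (u N - x)) @ \oo --> (0 : R) }.

Definition positive_definite (X : Type) (K : X -> X -> C) : Prop :=
  forall (N : nat) (p : 'I_N -> X) (c : 'I_N -> C),
    0 <= \sum_(s < N) \sum_(t < N) K (p s) (p t) * c t * (c s)^*.

End Hilbert.

Definition left_ideal (A : pzRingType) (S : set A) : set A :=
  [set g | exists (N : nat) (p s : 'I_N -> A),
     (forall l, S (s l)) /\ g = \sum_(l < N) p l * s l].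

Section OneFock.
Context {R : realType} (n : nat).
Local Notation C := R[i].
Implicit Types (a : seq 'I_n -> R) (w : seq 'I_n) (z : 'I_n -> C).

Definition positive_regular a : Prop :=
  [/\ forall w, 0 <= a w,
      a [::] = 0,
      forall j, 0 < a [:: j] &
      (limn_esup (fun p : nat =>
         ((\sum_(w : p.-tuple 'I_n) `|a w| ^+ 2) `^ ((2 * p)%:R)^-1)%:E)
       < +oo)%E].

Definition wval z w : C := \prod_(j <- w) z j.

(* Each factor of a factorization of w has length at most |w|, so the
   factorizations into p words are p-tuples of words of length <= |w|. *)
Definition bcoef (m : nat) a w : R :=
  if w is [::] then 1 else
  \sum_(1 <= p < (size w).+1)
    \sum_(g : p.-tuple ((size w).-bseq 'I_n) |
          (flatten [seq bseqval x | x <- g] == w) &&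
          all (fun x : (size w).-bseq 'I_n => (0 < size x)%N) g)
      (\prod_(x <- g) a (bseqval x)) * 'C(p + m - 1, m - 1)%:R.

(* Coordinates of the bounded operator given by
   e_w |-> sqrt (b w / b (g_j w)) e_(g_j w); see [wshift_delta]. *)
Definition wshift (m : nat) a (j : 'I_n) (x : seq 'I_n -> C) :
    seq 'I_n -> C :=
  fun w => if w is j' :: w' then
             if j' == j then
               (Num.sqrt (bcoef m a w' / bcoef m a w))%:C * x w'
             else 0
           else 0.

Lemma wshift_delta m a j w :
  wshift m a j (delta w) =
  (Num.sqrt (bcoef m a w / bcoef m a (j :: w)))%:C *: delta (j :: w).
Proof.
apply/funext => -[|j' w'] /=.
  by rewrite fctE /delta /= scaler0.
rewrite fctE /delta eqseq_cons; case: eqP => [->|_] /=; last by rewrite scaler0.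
by case: eqP => [->|_] //; rewrite mulr0 scaler0.
Qed.

Definition Lambda (K : {ffun 'I_n -> nat}) : set (seq 'I_n) :=
  [set w | forall z : 'I_n -> C, wval z w = \prod_j z j ^+ K j].

Definition gam (m : nat) a (K : {ffun 'I_n -> nat}) : R :=
  \sum_(w \in Lambda K) bcoef m a w.

Definition wvec (m : nat) a (K : {ffun 'I_n -> nat}) : seq 'I_n -> C :=
  ((gam m a K)^-1)%:C *:
    \sum_(w \in Lambda K) (Num.sqrt (bcoef m a w))%:C *: delta w.

Definition fterm a (z u : 'I_n -> C) w : C :=
  (a w)%:C * wval z w * (wval u w)^*.

Definition feval a z u : C := csum (fterm a z u).

Definition fsqval a z : \bar R :=
  \esum_(w in [set w | (1 <= size w)%N]) (a w * normc (wval z w) ^+ 2)%:E.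

End OneFock.

Section Polydomain.
Context {R : realType} {k : nat} (n : 'I_k -> nat).
Local Notation C := R[i].

(* Multi-words (w_1, ..., w_k): the index set of the orthonormal basis
   e_(w_1) (x) ... (x) e_(w_k) of the tensor product of the Fock spaces, which
   is thus modelled as l^2(mword). *)
Definition mword : Type := {dffun forall i : 'I_k, seq 'I_(n i)}.

HB.instance Definition _ := Choice.on mword.

Definition mindex : Type := {dffun forall i : 'I_k, {ffun 'I_(n i) -> nat}}.

HB.instance Definition _ := Choice.on mindex.

Definition point : Type := forall i : 'I_k, 'I_(n i) -> C.

Definition mword1 : mword := [ffun i : 'I_k => [::] : seq 'I_(n i)].

Definition mwordM (v w : mword) : mword := [ffun i : 'I_k => v i ++ w i].

Definition mupd (b : mword) (i : 'I_k) (w : seq 'I_(n i)) : mword :=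
  [ffun j : 'I_k => dfwith b i w j].

Fact mwordMA : associative mwordM.
Proof. by move=> u v w; apply/ffunP => i; rewrite !ffunE catA. Qed.

Fact mword1M : left_id mword1 mwordM.
Proof. by move=> u; apply/ffunP => i; rewrite !ffunE. Qed.

Fact mwordM1 : right_id mword1 mwordM.
Proof. by move=> u; apply/ffunP => i; rewrite !ffunE cats0. Qed.

Fact mword_unit (u v : mword) : mwordM u v = mword1 -> u = mword1 /\ v = mword1.
Proof.
move=> /ffunP uv; split; apply/ffunP => i; move: (uv i); rewrite !ffunE;
by case: (u i) => //=; case: (v i).
Qed.

HB.instance Definition _ := Choice_isMonomialDef.Build mword
  mwordMA mword1M mwordM1 mword_unit.

(* Z_(i,1), ..., Z_(i,n_i) are free and Z_(s,j), Z_(t,l) commute for s <> t: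
   the monomials form the product of the free monoids. *)
Definition ncpoly : pzRingType := malg mword C.

Definition Zvar (i : 'I_k) (j : 'I_(n i)) : ncpoly :=
  mkmalgU (mupd mword1 [:: j]) (1 : C).

Definition Qc : set ncpoly :=
  left_ideal [set g | exists (i : 'I_k) (j1 j2 : 'I_(n i)),
    g = Zvar j1 * Zvar j2 - Zvar j2 * Zvar j1].

Definition tensor (x : forall i : 'I_k, seq 'I_(n i) -> C) : mword -> C :=
  fun b => \prod_(i < k) x i (b i).

(* I (x) ... (x) T (x) ... (x) I, with T in the i-th factor. *)
Definition ampliation (i : 'I_k)
    (T : (seq 'I_(n i) -> C) -> (seq 'I_(n i) -> C)) (x : mword -> C) :
    mword -> C :=
  fun b => T (fun w => x (mupd b w)) (b i).

Section Model.
Variables (m : 'I_k -> nat) (a : forall i : 'I_k, seq 'I_(n i) -> R).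
Arguments a : clear implicits.
Implicit Types (z u : point) (b : mword) (K : mindex).

Definition Wshift (i : 'I_k) (j : 'I_(n i)) : (mword -> C) -> (mword -> C) :=
  ampliation (wshift (m i) (a i) j).

Lemma Wshift_delta i j b :
  @Wshift i j (delta b) =
  (Num.sqrt (bcoef (m i) (a i) (b i) / bcoef (m i) (a i) (j :: b i)))%:C *:
    delta (mupd b (j :: b i)).
Proof.
apply/funext => b'; rewrite fctE /Wshift /ampliation /wshift.
have -> : delta (mupd b (j :: b i)) b' =
    (if b' i is j' :: w' then ((j' == j) && (mupd b' w' == b))%:R else 0) :> C.
  rewrite /delta; have [->|b'N] := eqVneq b' (mupd b (j :: b i)).
    rewrite {1}/mupd ffunE dfwithin eqxx /=.
    suff -> : mupd (mupd b (j :: b i)) (b i) = b by rewrite eqxx.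
    apply/ffunP => l; rewrite !ffunE.
    by case: dfwithP => // l' il'; rewrite ffunE dfwithout.
  case E : (b' i) => [//|j' w'].
  case: eqVneq => [jE|//]; case: eqP => [bE|//]; case/eqP: b'N.
  apply/ffunP => l; rewrite -bE !ffunE dfwithin.
  case: dfwithP; first by rewrite E jE.
  by move=> l' il'; rewrite ffunE dfwithout.
case E : (b' i) => [|j' w']; first by rewrite scaler0.
case: eqP => [->|_] /=; last by rewrite scaler0.
rewrite /delta; case: eqP => [bE|_]; last by rewrite mulr0 scaler0.
by rewrite -bE /mupd ffunE dfwithin.
Qed.

Definition Wmono b (x : mword -> C) : mword -> C :=
  foldr (fun (i : 'I_k) y => foldr (@Wshift i) y (b i)) x (enum 'I_k).

Definition polyW (g : ncpoly) (x : mword -> C) : mword -> C :=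
  \sum_(b <- msupp g) mcoeff b g *: Wmono b x.

Definition MQc : set (mword -> C) :=
  clspan [set y | exists (g : ncpoly) (x : mword -> C),
    [/\ Qc g, ell2 x & y = polyW g x]].

Definition NQc : set (mword -> C) := orthocompl MQc.

Definition polydomain : set point :=
  [set z | forall i, (fsqval (a i) (z i) < 1)%E].

Definition Delta z : R := \prod_(i < k) (1 - fine (fsqval (a i) (z i))) ^+ m i.

Definition uvec z : mword -> C :=
  fun b => \prod_(i < k)
    ((wval (z i) (b i))^* * (Num.sqrt (bcoef (m i) (a i) (b i)))%:C).

Definition Gamma z : mword -> C := (Num.sqrt (Delta z))%:C *: uvec z.

Definition wbasis K : mword -> C := tensor (fun i => wvec (m i) (a i) (K i)).

Definition Fs2 : set (mword -> C) := clspan (range wbasis).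

Definition monomial z K : C := \prod_(i < k) \prod_(j < n i) z i j ^+ K i j.

Definition weight K : R := \prod_(i < k) (gam (m i) (a i) (K i))^-1.

Definition wsqnorm (c : mindex -> C) : \bar R :=
  \esum_(K in [set: mindex]) (normc (c K) ^+ 2 * weight K)%:E.

Definition power_series (phi : polydomain -> C) (c : mindex -> C) : Prop :=
  forall z : polydomain, has_csum (fun K => c K * monomial (set_val z) K) (phi z).

Definition H2 : set (polydomain -> C) :=
  [set phi | exists2 c, power_series phi c & (wsqnorm c < +oo)%E].

(* For phi in H2 the coefficients are unique; this is part of the theorem. *)
Definition H2coef (phi : polydomain -> C) : mindex -> C :=
  xget 0 [set c | power_series phi c].

Definition H2norm (phi : polydomain -> C) : R :=
  Num.sqrt (fine (wsqnorm (H2coef phi))).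

Definition H2inner (phi psi : polydomain -> C) : C :=
  csum (fun K => H2coef phi K * (H2coef psi K)^* * (weight K)%:C).

Definition frep (x : mword -> C) : polydomain -> C :=
  fun z : polydomain => inner x (uvec (set_val z)).

Definition kappa (z u : polydomain) : C :=
  (\prod_(i < k) (1 - feval (a i) (set_val z i) (set_val u i)) ^+ m i)^-1.

End Model.
End Polydomain.

Arguments polydomain {R k n} a.
Arguments Delta {R k n} m a z.
Arguments uvec {R k n} m a z.
Arguments Gamma {R k n} m a z.
Arguments wbasis {R k n} m a K.
Arguments Fs2 {R k n} m a.
Arguments MQc {R k n} m a.
Arguments NQc {R k n} m a.
Arguments power_series {R k n a} phi c.
Arguments wsqnorm {R k n} m a c.
Arguments H2 {R k n} m a.
Arguments H2norm {R k n} m a phi.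
Arguments H2inner {R k n} m a phi psi.
Arguments frep {R k n} m a x z.
Arguments kappa {R k n} m a z u.

(* Main.v *)
Require Import Defs.
From mathcomp Require Import all_boot all_order all_algebra finmap complex.
From mathcomp Require Import all_classical all_reals all_analysis.
From mathcomp Require Import summability.
From mathcomp Require Import -(notations) monalg.
From mathcomp Require Import cyclic separable cyclotomic.
From mathcomp Require Import ring lra.

(** Write beta_b for the product over i of the coefficients b^(m_i) of the components
of a multiword b, and K(b) for its letter counts. All the spaces of the theorem
consist of the symmetric vectors: the square summable x whose normalized coordinates
x_b / sqrt (beta_b) depend on K(b) only ([symvecP]).

- The fibres of b |-> K(b) are finite, w^K is a multiple of the symmetric vector with
  support on the fibre of K, and these vectors span ([Fs2P]).
- A monomial in the shifts maps e_b to sqrt (beta_b / beta_(vb)) e_(vb). Hence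
  orthogonality to the image of the commutators says that the normalized coordinates
  do not change when two adjacent letters are exchanged, that is, that they depend on
  K(b) only ([NQcP]). Square summability of these images rests on the inequality
  a_j beta_b <= beta_(jb), which makes the shifts bounded.
- The normalized coordinates of u_z are the conjugates of z^K(b), so u_z is
  symmetric. Conversely, averaging u_z over the points of a small torus whose
  coordinates are N-th roots of unity, against a character, keeps the exponents
  congruent to K modulo N; letting N grow yields w^K ([clspan_Gamma_Fs2]). Applied to
  a power series instead, the same averages show that its coefficients are determined
  by its values ([power_series_eq0]). The growth condition on the coefficients of f
  enters through the existence of the small torus ([small_torus]).

The kernel comes from the identity: the sum of b^(m)_w z_w conj(u_w) over all words w
is (1 - f(z,u))^-m. Coefficientwise, (1 - f)^-(m+1) = (1 - f)^-m + f (1 - f)^-(m+1)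
is Pascal's rule ([bco_rec]); summing it gives the identity by induction on m, once
absolute convergence is known, and the same recursion bounds the sums over words of
bounded length by those of order m ([bco_esum_lt], [bco_csum]). The product over the
groups of variables is [has_csum_mword]. It follows that u_z is square summable with
squared norm 1 / Delta(z), and that kappa is a Gram kernel.

For the function space, sums over multiwords of functions of K(b) collapse to sums
over multi-indices K, weighted by the total mass of the fibre ([mcnt_csum],
[mcnt_esum]). So x |-> <x, u_z> maps the symmetric vector with coefficients c to the
power series with coefficients c, and its norm and inner product are those of H^2.
Completeness of H^2 is inherited from the closed subspace of symmetric vectors
([H2_hilbert]).

Unordered sums are handled through absolute summability, to which convergence is
equivalent ([has_csum_abs_summable]), and through Fubini's theorem along an arbitrary
map of the index sets ([has_csum_fibers]). *)

Set Implicit Arguments.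
Unset Strict Implicit.
Unset Printing Implicit Defensive.

Import Order.TTheory GRing.Theory Num.Theory numFieldNormedType.Exports.

Local Open Scope classical_set_scope.
Local Open Scope ring_scope.
Local Open Scope complex_scope.

Local Notation Re := complex.Re.
Local Notation Im := complex.Im.
Local Notation span := Defs.span.
Local Notation point := Defs.point.
Local Notation "x ^*" := (conjc x) : ring_scope.

(** * The modulus on complex numbers over a real field *)

Section ComplexNumbers.
Context {R : realType}.
Local Notation C := R[i].
Implicit Types (z w : C) (r : R).

Lemma normc_normr z : `|z| = (normc z)%:C.
Proof. by []. Qed.

Lemma normc_ge0 z : 0 <= normc z.
Proof. by case: z => x y; exact: sqrtr_ge0. Qed.

Lemma normc_eq0 z : (normc z == 0) = (z == 0).
Proof.
by apply/eqP/eqP => [/Normc.eq0_normc|->] //; rewrite Normc.normc0.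
Qed.

Lemma normc_realE r : normc r%:C = `|r|.
Proof. by rewrite /= expr0n addr0 sqrtr_sqr. Qed.

Lemma normc_conj z : normc z^* = normc z.
Proof. by case: z => x y; rewrite /= sqrrN. Qed.

Lemma Re_le_normc z : `|Re z| <= normc z.
Proof.
case: z => x y /=; rewrite -sqrtr_sqr ler_sqrt ?lerDl ?sqr_ge0 //.
by rewrite addr_ge0 ?sqr_ge0.
Qed.

Lemma Im_le_normc z : `|Im z| <= normc z.
Proof.
case: z => x y /=; rewrite -sqrtr_sqr ler_sqrt ?lerDr ?sqr_ge0 //.
by rewrite addr_ge0 ?sqr_ge0.
Qed.

Lemma normc_le_Re_Im z : normc z <= `|Re z| + `|Im z|.
Proof.
case: z => x y /=; rewrite -[leRHS]ger0_norm ?addr_ge0 // -sqrtr_sqr.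
rewrite ler_sqrt ?sqr_ge0 // sqrrD !real_normK ?num_real //.
by rewrite -subr_ge0 (_ : _ - _ = `|x| * `|y| *+ 2) ?mulrn_wge0 ?mulr_ge0 //; ring.
Qed.

Lemma mulc_conj z : z * z^* = (normc z ^+ 2)%:C.
Proof. by rewrite -sqr_normc normc_normr rmorphXn. Qed.

Lemma normc_sum (J : Type) (s : seq J) (P : pred J) (F : J -> C) :
  normc (\sum_(j <- s | P j) F j) <= \sum_(j <- s | P j) normc (F j).
Proof.
elim/big_ind2: _ => [|x u y v xu yv|//]; first by rewrite Normc.normc0.
by rewrite (le_trans (le_normcD _ _)) // lerD.
Qed.

Lemma normc_prod (J : Type) (s : seq J) (P : pred J) (F : J -> C) :
  normc (\prod_(j <- s | P j) F j) = \prod_(j <- s | P j) normc (F j).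
Proof.
by apply: (big_morph (@Normc.normc R)); [exact: Normc.normcM | exact: Normc.normc1].
Qed.

Lemma Re_sum (J : Type) (s : seq J) (P : pred J) (F : J -> C) :
  Re (\sum_(j <- s | P j) F j) = \sum_(j <- s | P j) Re (F j).
Proof. by apply: (big_morph (@Re R)) => // -[? ?] [? ?]. Qed.

Lemma Im_sum (J : Type) (s : seq J) (P : pred J) (F : J -> C) :
  Im (\sum_(j <- s | P j) F j) = \sum_(j <- s | P j) Im (F j).
Proof. by apply: (big_morph (@Im R)) => // -[? ?] [? ?]. Qed.

Lemma real_complexD r r' : (r + r')%:C = r%:C + r'%:C :> C.
Proof. exact: rmorphD. Qed.

Lemma real_complexM r r' : (r * r')%:C = r%:C * r'%:C :> C.
Proof. exact: rmorphM. Qed.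

Lemma real_complexB r r' : (r - r')%:C = r%:C - r'%:C :> C.
Proof. exact: rmorphB. Qed.

Lemma real_complexN r : (- r)%:C = - r%:C :> C.
Proof. exact: rmorphN. Qed.

Lemma real_complexMn r N : (r *+ N)%:C = r%:C *+ N :> C.
Proof. exact: rmorphMn. Qed.

Lemma real_complexX r N : (r ^+ N)%:C = r%:C ^+ N :> C.
Proof. exact: rmorphXn. Qed.

Lemma real_complexV r : (r^-1)%:C = (r%:C)^-1 :> C.
Proof. exact: fmorphV. Qed.

Lemma real_complex_eq0 r : (r%:C == 0 :> C) = (r == 0).
Proof. by rewrite eq_complex /= eqxx andbT. Qed.

Lemma conjcM z w : (z * w)^* = z^* * w^*.
Proof. exact: rmorphM. Qed.

Lemma conjc_prod (J : Type) (s : seq J) (P : pred J) (F : J -> C) :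
  (\prod_(j <- s | P j) F j)^* = \prod_(j <- s | P j) (F j)^*.
Proof. exact: (rmorph_prod (@conjc R)). Qed.

Lemma conjc_sum (J : Type) (s : seq J) (P : pred J) (F : J -> C) :
  (\sum_(j <- s | P j) F j)^* = \sum_(j <- s | P j) (F j)^*.
Proof. exact: (rmorph_sum (@conjc R)). Qed.

Lemma real_complex_sum (J : Type) (s : seq J) (P : pred J) (F : J -> R) :
  (\sum_(j <- s | P j) F j)%:C = \sum_(j <- s | P j) (F j)%:C.
Proof. exact: (rmorph_sum (@real_complex_def R (Phant R))). Qed.

Lemma real_complex_prod (J : Type) (s : seq J) (P : pred J) (F : J -> R) :
  (\prod_(j <- s | P j) F j)%:C = \prod_(j <- s | P j) (F j)%:C.
Proof. exact: (rmorph_prod (@real_complex_def R (Phant R))). Qed.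

End ComplexNumbers.

Lemma fset_bounded (I : choiceType) (h : I -> nat) (B : {fset I}) :
  exists N, forall i, i \in B -> (h i < N)%N.
Proof.
by exists (\max_(i <- B) h i).+1 => i iB; rewrite ltnS; exact: leq_bigmax_seq.
Qed.

(** * Unordered sums of complex families *)

Section Summation.
Context {R : realType}.
Local Notation C := R[i].

Section OneIndexSet.
Context {I : choiceType}.
Implicit Types (x y : I -> C) (f g : I -> R) (s t : C) (A B : {fset I}).

Local Notation esumT f := (\esum_(i in [set: I]) (f i)%:E).

Lemma partial_sumE (V : zmodType) (v : I -> V) A :
  partial_sum v A = \sum_(i <- A) v i.
Proof. by rewrite /partial_sum big_seq_fsetE. Qed.

Lemma has_csumP x s : has_csum x s <->
  forall e : R, 0 < e -> exists A : {fset I}, forall B : {fset I},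
    (A `<=` B)%fset -> normc (\sum_(i <- B) x i - s) < e.
Proof.
have psE B : partial_sum (x : I -> C^o) B = \sum_(i <- B) x i by exact: partial_sumE.
rewrite /has_csum cvgrPdist_lt; split=> [xs e e0|xs e].
  have /xs [A _ AP] : 0 < (e%:C : C) by rewrite ltcR.
  exists A => B AB; have /= := AP B AB.
  by rewrite psE distrC normc_normr ltcR.
case: e => e e'; rewrite ltcE /= => /andP[/eqP -> /xs [A AP]].
exists A => // B AB /=; rewrite psE distrC normc_normr.
by rewrite ltcE /= eqxx; exact: AP.
Qed.

Lemma eq_has_csum x y s t : (forall i, x i = y i) -> s = t ->
  has_csum x s -> has_csum y t.
Proof. by move=> /funext -> ->. Qed.

Lemma has_csum_unique x s t : has_csum x s -> has_csum x t -> s = t.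
Proof. by move=> xs xt; exact: (cvg_unique _ xs xt). Qed.

Lemma csumE x s : has_csum x s -> csum x = s.
Proof. by move=> xs; apply: (cvg_lim _ xs). Qed.

#[local] Opaque has_csum.

Lemma has_csumL (c : C) x y s t : has_csum x s -> has_csum y t ->
  has_csum (fun i => c * x i + y i) (c * s + t).
Proof.
move=> /has_csumP xs /has_csumP yt; apply/has_csumP => e e0.
have e2 : 0 < e / 2 by rewrite divr_gt0.
have c1 : 0 < normc c + 1 by rewrite ltr_wpDl ?normc_ge0.
have [A1 A1P] := xs (e / 2 / (normc c + 1)) (divr_gt0 e2 c1).
have [A2 A2P] := yt (e / 2) e2.
exists (A1 `|` A2)%fset => B; rewrite fsubUset => /andP[/A1P xB /A2P yB].
rewrite big_split -mulr_sumr /=.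
set u := \sum_(i <- B) x i in xB *; set v := \sum_(i <- B) y i in yB *.
rewrite (_ : _ - _ = c * (u - s) + (v - t)); last by ring.
rewrite (le_lt_trans (le_normcD _ _)) // Normc.normcM [ltRHS]splitr ler_ltD //.
rewrite (le_trans (ler_wpM2r (normc_ge0 _) (_ : normc c <= normc c + 1))) ?lerDl //.
by rewrite mulrC -ler_pdivlMr // ltW.
Qed.

Lemma has_csum0 : has_csum ((fun=> 0) : I -> C) 0.
Proof.
apply/has_csumP => e e0; exists fset0 => B _.
by rewrite big1 // subr0 Normc.normc0.
Qed.

Lemma has_csumZ (c : C) x s : has_csum x s -> has_csum (fun i => c * x i) (c * s).
Proof.
move=> xs; have := has_csumL (c := c) xs has_csum0; rewrite addr0.
by under eq_fun do rewrite addr0.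
Qed.

Lemma has_csumD x y s t : has_csum x s -> has_csum y t ->
  has_csum (fun i => x i + y i) (s + t).
Proof.
move=> xs yt; have := has_csumL (c := 1) xs yt; rewrite mul1r.
by under eq_fun do rewrite mul1r.
Qed.

Lemma has_csum_sum (J : Type) (r : seq J) (x : J -> I -> C) (s : J -> C) :
  (forall j, has_csum (x j) (s j)) ->
  has_csum (fun i => \sum_(j <- r) x j i) (\sum_(j <- r) s j).
Proof.
move=> xs; elim: r => [|j r IH].
  by apply: eq_has_csum has_csum0 => [i|]; rewrite big_nil.
by apply: eq_has_csum (has_csumD (xs j) IH) => [i|]; rewrite big_cons.
Qed.

Lemma has_csum_conj x s : has_csum x s -> has_csum (fun i => (x i)^*) s^*.
Proof.
move=> /has_csumP xs; apply/has_csumP => e /xs [A AP]; exists A => B /AP.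
by rewrite -rmorph_sum -rmorphB normc_conj.
Qed.

Lemma has_csum_finite x (B : {fset I}) : (forall i, i \notin B -> x i = 0) ->
  has_csum x (\sum_(i <- B) x i).
Proof.
move=> xB; apply/has_csumP => e e0; exists B => D BD.
rewrite (big_fset_incl _ BD) ?subrr ?Normc.normc0 // => i _; exact: xB.
Qed.

Lemma has_csum_single x i0 : (forall i, i != i0 -> x i = 0) ->
  has_csum x (x i0).
Proof.
move=> xi; rewrite -[x i0](big_seq_fset1 +%R i0 x).
by apply: has_csum_finite => i; rewrite inE; exact: xi.
Qed.

Lemma fsum_le_esum f (B : {fset I}) : (forall i, 0 <= f i) ->
  ((\sum_(i <- B) f i)%:E <= esumT f)%E.
Proof.
move=> f0; apply: esum_ge; exists [set` B]; first by split.
by rewrite -fsbig_seq ?fset_uniq // sumEFin.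
Qed.

Lemma esum_le_fsum f (M : \bar R) :
  (forall B : {fset I}, ((\sum_(i <- B) f i)%:E <= M)%E) -> (esumT f <= M)%E.
Proof.
move=> fM; apply: ge_ereal_sup => _ [X [finX _] <-].
by rewrite fsbig_finite //= sumEFin.
Qed.

Lemma esumT_ge0 f : (forall i, 0 <= f i) -> (0 <= esumT f)%E.
Proof. by move=> f0; apply: esum_ge0 => i _; rewrite lee_fin. Qed.

Lemma esumT_fin f : (forall i, 0 <= f i) -> (esumT f < +oo)%E ->
  esumT f = (fine (esumT f))%:E.
Proof. by move=> f0 foo; rewrite fineK // ge0_fin_numE // esumT_ge0. Qed.

Lemma fsum_le_fine f (B : {fset I}) : (forall i, 0 <= f i) -> (esumT f < +oo)%E ->
  \sum_(i <- B) f i <= fine (esumT f).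
Proof. by move=> f0 foo; rewrite -lee_fin -esumT_fin // fsum_le_esum. Qed.

Lemma fsum_subset f A B : (forall i, 0 <= f i) -> (A `<=` B)%fset ->
  \sum_(i <- A) f i <= \sum_(i <- B) f i.
Proof.
move=> f0 AB; rewrite [leRHS](big_fsetID _ (mem A)) /=.
suff -> : \sum_(i <- [fset i in B | i \in A]%fset) f i = \sum_(i <- A) f i.
  by rewrite lerDl sumr_ge0.
by apply: eq_fbigl => i; rewrite !inE andb_idl // => /(fsubsetP AB).
Qed.

Lemma fsumU_disjoint x A B : [disjoint A & B]%fset ->
  \sum_(i <- (A `|` B)%fset) x i = \sum_(i <- A) x i + \sum_(i <- B) x i.
Proof.
move=> /fdisjointP AB; rewrite (big_fsetID _ (mem A)) /=; congr (_ + _).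
  by apply: eq_fbigl => i; rewrite !inE; case: (i \in A); rewrite ?andbF.
apply: eq_fbigl => i; rewrite !inE; have := AB i.
by case: (i \in A) => /= [/(_ isT)/negbTE->|_] //; rewrite andbT.
Qed.

Lemma has_csum_esum f : (forall i, 0 <= f i) -> (esumT f < +oo)%E ->
  has_csum (fun i => (f i)%:C) (fine (esumT f))%:C.
Proof.
move=> f0 foo; apply/has_csumP => e e0; have fE := esumT_fin f0 foo.
have : ((fine (esumT f) - e)%:E < esumT f)%E by rewrite fE lte_fin ltrBlDr ltrDl.
move=> /ereal_sup_gt [_ [X [finX _] <-]].
rewrite fsbig_finite //= sumEFin lte_fin => Xe; exists (fset_set X) => B XB.
rewrite -real_complex_sum -rmorphB normc_realE ler0_norm ?subr_le0 ?fsum_le_fine //.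
by rewrite opprB ltrBlDl -ltrBlDr (lt_le_trans Xe) // fsum_subset.
Qed.

(** Every convergent unordered sum turns out to be of this kind, see
[has_csum_abs_summable]. *)
Definition abs_summable x := (esumT (fun i => normc (x i)) < +oo)%E.

Lemma le_esumT f g : (forall i, f i <= g i) -> (esumT f <= esumT g)%E.
Proof. by move=> fg; apply: le_esum => i _; rewrite lee_fin. Qed.

Lemma esumTD f g : (forall i, 0 <= f i) -> (forall i, 0 <= g i) ->
  esumT (fun i => f i + g i) = (esumT f + esumT g)%E.
Proof.
by move=> f0 g0; rewrite -esumD // => i _; rewrite lee_fin.
Qed.

Lemma esumTZ (c : R) f : 0 <= c -> (forall i, 0 <= f i) ->
  (esumT f < +oo)%E -> esumT (fun i => c * f i) = (c%:E * esumT f)%E.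
Proof.
move=> c0 f0 foo; have fE := esumT_fin f0 foo.
have cf_ge0 i : 0 <= c * f i by rewrite mulr_ge0.
have cfoo : (esumT (fun i => (c * f i)) < +oo)%E.
  apply: (@le_lt_trans _ _ (c * fine (esumT f))%:E); last exact: ltry.
  apply: esum_le_fsum => B; rewrite lee_fin -mulr_sumr.
  by rewrite ler_wpM2l // fsum_le_fine.
rewrite fE -EFinM [LHS]esumT_fin //; apply/congr1/complexI.
apply: has_csum_unique (has_csum_esum cf_ge0 cfoo) _.
rewrite rmorphM; under eq_fun do rewrite rmorphM.
exact/has_csumZ/has_csum_esum.
Qed.

Lemma abs_summable_le x f : (forall i, normc (x i) <= f i) -> (esumT f < +oo)%E ->
  abs_summable x.
Proof. by move=> xf; apply: le_lt_trans; apply: le_esumT. Qed.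

(** A property of families which is stable under linear combinations holds for
all absolutely summable families once it holds for the nonnegative ones: split
into the positive and negative parts of the real and the imaginary part. *)
Lemma abs_summable_ind (P : (I -> C) -> Prop) :
  (forall f, (forall i, 0 <= f i) -> (esumT f < +oo)%E -> P (fun i => (f i)%:C)) ->
  (forall (c : C) x y, P x -> P y -> P (fun i => c * x i + y i)) ->
  forall x, abs_summable x -> P x.
Proof.
move=> Ppos Plin x xoo.
have half (g : C -> R) : (forall z, `|g z| <= normc z) ->
    P (fun i => (g (x i))%:C).
  move=> gle.
  have Pmax (h : R -> R) : (forall r, 0 <= h r <= `|r|) ->
      P (fun i => (h (g (x i)))%:C).
    move=> hle; apply: Ppos => [i|]; first by case/andP: (hle (g (x i))).
    apply: le_lt_trans xoo; apply: le_esumT => i.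
    by rewrite (le_trans _ (gle _)) //; case/andP: (hle (g (x i))).
  rewrite (_ : (fun i => _) =
      fun i => (-1) * (Num.max 0 (- g (x i)))%:C + (Num.max 0 (g (x i)))%:C).
    apply: Plin.
      apply: (Pmax (fun r => Num.max 0 (- r))) => r.
      by rewrite le_max lexx /= ge_max normr_ge0 -normrN ler_norm.
    apply: (Pmax (Num.max 0)) => r.
    by rewrite le_max lexx /= ge_max normr_ge0 ler_norm.
  apply/funext => i; rewrite mulN1r -rmorphN -rmorphD; congr (_%:C).
  by case: (leP 0 (- g (x i))); case: (leP 0 (g (x i))); lra.
rewrite (_ : x = fun i => 'i%C * (Im (x i))%:C + (Re (x i))%:C).
  by apply: Plin; apply: half; [exact: Im_le_normc | exact: Re_le_normc].
by apply/funext => i; rewrite addrC -complexE.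
Qed.

Lemma abs_summable_has_csum x : abs_summable x -> exists s, has_csum x s.
Proof.
move: x; apply: abs_summable_ind => [f f0 foo|c x y [s xs] [t yt]].
  by exists (fine (esumT f))%:C; exact: has_csum_esum.
by exists (c * s + t); exact: has_csumL.
Qed.

(** Convergence forces absolute convergence: finite sums over sets disjoint from
a large enough one are small; applied to the sets where the real or the imaginary
part keeps its sign, this bounds the finite sums of the moduli. *)
Lemma has_csum_abs_summable x s : has_csum x s -> abs_summable x.
Proof.
move=> /has_csumP/(_ 1 ltr01)[A AP].
have smallD (D : {fset I}) : [disjoint A & D]%fset -> normc (\sum_(i <- D) x i) <= 2.
  move=> AD; have := AP (A `|` D)%fset (fsubsetUl _ _).
  have := AP A (fsubset_refl _); rewrite fsumU_disjoint //.
  set u := \sum_(i <- A) _; set v := \sum_(i <- D) _ => us uvs.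
  rewrite (_ : v = (u + v - s) - (u - s)); last by ring.
  rewrite (le_trans (le_normcD _ _)) // normcN; lra.
(* g stands for the real or the imaginary part *)
have part (g : C -> R) (D : {fset I}) :
    (forall r (F : I -> C), g (\sum_(i <- r) F i) = \sum_(i <- r) g (F i)) ->
    (forall z, `|g z| <= normc z) -> [disjoint A & D]%fset ->
    \sum_(i <- D) `|g (x i)| <= 4.
  move=> gsum gle AD; rewrite (bigID (fun i => 0 <= g (x i))) /=.
  have sub (Q : pred I) : normc (\sum_(i <- D | Q i) x i) <= 2.
    rewrite -big_filter (_ : \sum_(i <- _) _ = \sum_(i <- [fset i in D | Q i]%fset) x i).
      apply: smallD; apply/fdisjointP => i /(fdisjointP AD).
      by rewrite !inE negb_and => ->.
    apply: perm_big; apply: uniq_perm; rewrite ?filter_uniq ?fset_uniq //.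
    by move=> i; rewrite mem_filter !inE andbC.
  rewrite (_ : \sum_(i <- D | 0 <= g (x i)) _ = g (\sum_(i <- D | 0 <= g (x i)) x i)); last first.
    by rewrite -big_filter -[in RHS]big_filter gsum big_filter big_filter; apply: eq_bigr => i /ger0_norm.
  rewrite (_ : \sum_(i <- D | _) `| _ | = - g (\sum_(i <- D | ~~ (0 <= g (x i))) x i)); last first.
    rewrite -big_filter -[in RHS]big_filter gsum big_filter big_filter -sumrN.
    by apply: eq_bigr => i; rewrite -ltNge => /ltr0_norm.
  rewrite (_ : 4 = 2 + 2) ?lerD //; last by ring.
    by rewrite (le_trans (ler_norm _)) // (le_trans (gle _)).
  by rewrite (le_trans (ler_norm _)) // normrN (le_trans (gle _)).
apply: (@le_lt_trans _ _ (\sum_(i <- A) normc (x i) + 8)%:E); last exact: ltry.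
apply: esum_le_fsum => B; rewrite lee_fin (big_fsetID _ [in A]) /= lerD //.
  apply: fsum_subset => [i|]; first exact: normc_ge0.
  by apply/fsubsetP => i; rewrite !inE => /andP[].
set D := [fset i in B | i \notin A]%fset.
have AD : [disjoint A & D]%fset by apply/fdisjointP => i iA; rewrite !inE iA andbF.
apply: (@le_trans _ _ (\sum_(i <- D) (`|Re (x i)| + `|Im (x i)|))).
  by apply: ler_sum => i _; exact: normc_le_Re_Im.
rewrite big_split /= (_ : 8 = 4 + 4) ?lerD //; last by ring.
- by apply: part => // [r F|z]; [exact: Re_sum | exact: Re_le_normc].
- by apply: part => // [r F|z]; [exact: Im_sum | exact: Im_le_normc].
Qed.

Lemma abs_summable_posE f : (forall i, 0 <= f i) ->
  abs_summable (fun i => (f i)%:C) = (esumT f < +oo)%E.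
Proof.
move=> f0; rewrite /abs_summable; congr (_ < _)%E; apply: eq_esum => i _.
by rewrite normc_realE ger0_norm.
Qed.

Lemma esum_has_csum f s : (forall i, 0 <= f i) -> has_csum (fun i => (f i)%:C) s ->
  esumT f = (Re s)%:E.
Proof.
move=> f0 fs; have foo := has_csum_abs_summable fs.
rewrite abs_summable_posE // in foo.
by rewrite (has_csum_unique fs (has_csum_esum f0 foo)) -esumT_fin.
Qed.

Lemma csum_le x s f (M : R) : has_csum x s -> (forall i, normc (x i) <= f i) ->
  (esumT f <= M%:E)%E -> normc s <= M.
Proof.
move=> /has_csumP xs xf fM; apply/ler_addgt0Pr => e /xs [A /(_ A (fsubset_refl _))].
have f0 i : 0 <= f i by exact: le_trans (normc_ge0 _) (xf i).
move=> sA; rewrite (_ : s = \sum_(i <- A) x i - (\sum_(i <- A) x i - s)); last by ring.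
rewrite (le_trans (le_normcD _ _)) // normcN lerD //; last exact: ltW.
rewrite (le_trans (normc_sum _ xpredT _)) // -lee_fin.
by apply: le_trans fM; apply: le_trans (fsum_le_esum A f0); rewrite lee_fin ler_sum.
Qed.

End OneIndexSet.

Section Fubini.
Context {I J : choiceType}.
Implicit Types (x : I -> C) (t : J -> C) (p : I -> J).

Lemma esum_fibers (f : I -> R) p : (forall i, 0 <= f i) ->
  \esum_(i in [set: I]) (f i)%:E =
  \esum_(j in [set: J]) \esum_(i in p @^-1` [set j]) (f i)%:E.
Proof.
move=> f0; rewrite esum_esum => [|j i _ _]; last by rewrite lee_fin.
rewrite (@reindex_esum _ _ _ ([set: J] `*`` (fun j => p @^-1` [set j])) _ snd) //.
split=> [[j i]//|[j i] [j' i']|i _]; last by exists (p i, i).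
by rewrite !inE => -[_ /= <-] [_ /= <-] /= ->.
Qed.

(** Fubini's theorem. Both sides are linear in the family, so that nonnegative
families suffice ([abs_summable_ind]); for these it is the partition of a sum of
nonnegative terms ([esum_fibers]). *)
Lemma has_csum_fibers p x s t : has_csum x s ->
  (forall j, has_csum (fun i => if p i == j then x i else 0) (t j)) ->
  has_csum t s.
Proof.
move=> xs xt; suff [s' [t' [xs' xt' tt']]] : exists s' t', [/\ has_csum x s',
    forall j, has_csum (fun i => if p i == j then x i else 0) (t' j)
    & has_csum t' s'].
  rewrite (has_csum_unique xs xs') (_ : t = t') //.
  by apply/funext => j; exact: has_csum_unique (xt j) (xt' j).
move: xs => {xt} /has_csum_abs_summable.
move: x {s t}; apply: abs_summable_ind => [f f0 foo|].
  pose u j : R := fine (\esum_(i in p @^-1` [set j]) (f i)%:E).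
  pose fj j i := if p i == j then f i else 0.
  have fj0 j i : 0 <= fj j i by rewrite /fj; case: ifP.
  have fjE j : \esum_(i in [set: I]) (fj j i)%:E = \esum_(i in p @^-1` [set j]) (f i)%:E.
    rewrite [RHS]esum_mkcond; apply: eq_esum => i _; rewrite /fj.
    by case: eqP => [pj|pj]; [rewrite mem_set | rewrite memNset].
  have fjoo j : (\esum_(i in [set: I]) (fj j i)%:E < +oo)%E.
    by apply: le_lt_trans foo; apply: le_esumT => i; rewrite /fj; case: ifP.
  have u0 j : 0 <= u j by apply: fine_ge0; apply: esum_ge0 => i _; rewrite lee_fin.
  have uE j : (u j)%:E = \esum_(i in p @^-1` [set j]) (f i)%:E.
    by rewrite /u -fjE -esumT_fin.
  have ufE : \esum_(j in [set: J]) (u j)%:E = \esum_(i in [set: I]) (f i)%:E.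
    by rewrite (esum_fibers p) //; apply: eq_esum => j _; exact: uE.
  exists (fine (\esum_(i in [set: I]) (f i)%:E))%:C, (fun j => (u j)%:C); split.
  - exact: has_csum_esum.
  - move=> j; rewrite /u -fjE.
    rewrite (_ : (fun i => _) = fun i => (fj j i)%:C); first exact: has_csum_esum.
    by apply/funext => i; rewrite /fj; case: ifP.
  - by rewrite -ufE; apply: has_csum_esum => //; rewrite ufE.
move=> c x y [s [t [xs xt ts]]] [s' [t' [ys yt ts']]].
exists (c * s + s'), (fun j => c * t j + t' j); split; [exact: has_csumL| |exact: has_csumL].
move=> j; have := has_csumL (c := c) (xt j) (yt j); congr has_csum.
by apply/funext => i; case: ifP; rewrite // mulr0 addr0.
Qed.

End Fubini.

(** Fubini along an injection, whose fibres have at most one point. *)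
Lemma has_csum_inj (I J : choiceType) (p : I -> J) (x : J -> C) s :
  injective p -> (forall j, (forall i, p i != j) -> x j = 0) ->
  has_csum (x \o p) s -> has_csum x s.
Proof.
move=> pI x0 xs; apply: (has_csum_fibers (p := p) xs) => j.
have [[i pij]|noi] := pselect (exists i, p i = j); last first.
  have nopi i : p i != j by apply/eqP => pij; apply: noi; exists i.
  by apply: eq_has_csum has_csum0 => [i|]; rewrite ?(negbTE (nopi _)) // x0.
have := @has_csum_single _ (fun i => if p i == j then (x \o p) i else 0) i.
rewrite /= pij eqxx => single; apply: single => i'; case: (p i' =P j) => // pi'j.
by rewrite (pI i' i) ?eqxx // pij.
Qed.

Lemma has_csum_inj_inv (I J : choiceType) (p : I -> J) (x : J -> C) s :
  injective p -> (forall j, (forall i, p i != j) -> x j = 0) ->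
  has_csum x s -> has_csum (x \o p) s.
Proof.
move=> pI x0 xs; suff /abs_summable_has_csum[t xt] : abs_summable (x \o p).
  by rewrite (has_csum_unique xs (has_csum_inj pI x0 xt)).
apply: le_lt_trans (has_csum_abs_summable xs).
apply: esum_le_fsum => B /=.
have -> : \sum_(i <- B) normc (x (p i)) = \sum_(j <- [fset p i | i in B]%fset) normc (x j).
  by rewrite big_imfset //= => ? ? _ _; exact: pI.
by apply: fsum_le_esum => j; exact: normc_ge0.
Qed.

Lemma abs_summable_prod (I J : choiceType) (x : I -> C) (y : J -> C) :
  abs_summable x -> abs_summable y ->
  abs_summable (fun ij : I * J => x ij.1 * y ij.2).
Proof.
move=> xoo yoo; have n0 (K : choiceType) (z : K -> C) i : 0 <= normc (z i).
  exact: normc_ge0.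
rewrite /abs_summable (_ : [set: _] = [set: I] `*`` (fun=> [set: J])); last first.
  by apply/seteqP; split.
under eq_esum do rewrite Normc.normcM.
rewrite -(@esum_esum _ _ _ _ _ (fun i j => (normc (x i) * normc (y j))%:E)) => [|i j _ _]; last by rewrite lee_fin mulr_ge0.
pose Y := fine (\esum_(j in [set: J]) (normc (y j))%:E).
have YE : \esum_(j in [set: J]) (normc (y j))%:E = Y%:E := esumT_fin (n0 _ y) yoo.
have Y0 : 0 <= Y by rewrite fine_ge0 // esumT_ge0.
rewrite (eq_esum (b := fun i => (Y * normc (x i))%:E)) => [|i _].
  rewrite (esumTZ Y0 (n0 _ x) xoo) (esumT_fin (n0 _ x) xoo) -EFinM; exact: ltry.
by rewrite (esumTZ (n0 _ x i) (n0 _ y) yoo) YE -EFinM mulrC.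
Qed.

Lemma has_csum_prod (I J : choiceType) (x : I -> C) (y : J -> C) s t :
  has_csum x s -> has_csum y t ->
  has_csum (fun ij : I * J => x ij.1 * y ij.2) (s * t).
Proof.
move=> xs yt.
have [u xyu] := abs_summable_has_csum (abs_summable_prod
  (has_csum_abs_summable xs) (has_csum_abs_summable yt)).
suff xu : has_csum (fun i => t * x i) u.
  by rewrite mulrC (has_csum_unique (has_csumZ (c := t) xs) xu).
apply: (has_csum_fibers (p := fst) xyu) => i /=; rewrite mulrC.
apply: (has_csum_inj (p := pair i)) => [j j' []//|[i' j] /= ij|].
  by case: eqP => // ii'; have := ij j; rewrite ii' eqxx.
by apply: eq_has_csum (has_csumZ (c := x i) yt) => //= j; rewrite eqxx.
Qed.

End Summation.

(** * The Hilbert space of square summable families *)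

Section SquareSummable.
Context {R : realType}.
Local Notation C := R[i].

Section OneIndexSet.
Context {I : choiceType}.
Implicit Types (x y z : I -> C) (c : C) (S T : set (I -> C)).

Local Notation esumT f := (\esum_(i in [set: I]) (f i)%:E).

#[local] Opaque has_csum.

Let sq_ge0 x i : 0 <= normc (x i) ^+ 2.
Proof. exact: sqr_ge0. Qed.

Lemma sqnorm2E x : ell2 x -> sqnorm2 x = (norm2 x ^+ 2)%:E.
Proof.
move=> xoo; rewrite sqr_sqrtr; last by rewrite fine_ge0 // esumT_ge0.
exact: esumT_fin.
Qed.

Lemma norm2_ge0 x : 0 <= norm2 x.
Proof. exact: sqrtr_ge0. Qed.

Lemma ell2_has_csum x : ell2 x ->
  has_csum (fun i => (normc (x i) ^+ 2)%:C) ((norm2 x ^+ 2)%:C).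
Proof.
move=> xoo; rewrite (_ : norm2 x ^+ 2 = fine (sqnorm2 x)).
  exact: has_csum_esum.
by rewrite sqnorm2E.
Qed.

Lemma has_csum_ell2 x s : has_csum (fun i => (normc (x i) ^+ 2)%:C) s ->
  ell2 x /\ norm2 x = Num.sqrt (Re s).
Proof.
by move=> /(esum_has_csum (sq_ge0 x)) xs; rewrite /ell2 /norm2 /= /sqnorm2 xs ltry.
Qed.

Lemma ell2L c x y : ell2 x -> ell2 y -> ell2 (c *: x + y).
Proof.
move=> xoo yoo; apply: (@le_lt_trans _ _
    (esumT (fun i => 2 * normc c ^+ 2 * normc (x i) ^+ 2 + 2 * normc (y i) ^+ 2))).
  apply: le_esumT => i; apply: (@le_trans _ _ ((normc c * normc (x i) + normc (y i)) ^+ 2)).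
    rewrite -Normc.normcM ler_sqr ?nnegrE ?addr_ge0 ?normc_ge0 //.
    exact: le_normcD.
  have := sqr_ge0 (normc c * normc (x i) - normc (y i)); lra.
rewrite esumTD => [|i|i]; last 2 first.
- by rewrite mulr_ge0 ?sq_ge0 // mulr_ge0 ?sqr_ge0.
- by rewrite mulr_ge0 ?sq_ge0.
have cc : 0 <= 2 * normc c ^+ 2 by rewrite mulr_ge0 ?sqr_ge0.
have h2 : 0 <= (2 : R) by [].
rewrite (esumTZ cc (sq_ge0 x) xoo) (esumTZ h2 (sq_ge0 y) yoo).
by rewrite -/(sqnorm2 x) -/(sqnorm2 y) !sqnorm2E // -!EFinM -EFinD ltry.
Qed.

Lemma ell2_finite x (B : {fset I}) : (forall i, i \notin B -> x i = 0) -> ell2 x.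
Proof.
move=> xB; have := @has_csum_finite R I (fun i => (normc (x i) ^+ 2)%:C) B.
by case/(_ _)/has_csum_ell2 => // i /xB ->; rewrite Normc.normc0 expr0n.
Qed.

Lemma ell2_0 : ell2 (0 : I -> C).
Proof. exact: (@ell2_finite _ fset0). Qed.

Lemma ell2_delta i : ell2 (delta i : I -> C).
Proof. by apply: (@ell2_finite _ [fset i]%fset) => j; rewrite inE /delta => /negbTE ->. Qed.

Lemma ell2Z c x : ell2 x -> ell2 (c *: x).
Proof. by move=> xoo; rewrite -[_ *: _]addr0; apply: ell2L => //; exact: ell2_0. Qed.

Lemma ell2D x y : ell2 x -> ell2 y -> ell2 (x + y).
Proof. by move=> xoo yoo; rewrite -[x]scale1r; exact: ell2L. Qed.

Lemma ell2B x y : ell2 x -> ell2 y -> ell2 (x - y).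
Proof. by move=> xoo yoo; rewrite addrC -scaleN1r; exact: ell2L. Qed.

Lemma ell2_sum (J : Type) (r : seq J) (F : J -> I -> C) :
  (forall j, ell2 (F j)) -> ell2 (\sum_(j <- r) F j).
Proof.
move=> Foo; elim/big_ind: _ => // [|x y]; [exact: ell2_0 | exact: ell2D].
Qed.

Lemma inner_has_csum x y : ell2 x -> ell2 y ->
  has_csum (fun i => x i * (y i)^*) (inner x y).
Proof.
move=> xoo yoo; suff : abs_summable (fun i => x i * (y i)^*).
  by move=> /abs_summable_has_csum[s xs]; rewrite /inner (csumE xs).
apply: (@abs_summable_le _ _ _ (fun i => normc (x i) ^+ 2 + normc (y i) ^+ 2)).
  move=> i; rewrite Normc.normcM normc_conj.
  have := sqr_ge0 (normc (x i) - normc (y i)).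
  by have := sq_ge0 x i; have := sq_ge0 y i; lra.
by rewrite esumTD // -/(sqnorm2 x) -/(sqnorm2 y) !sqnorm2E // -EFinD ltry.
Qed.

Lemma innerE x y s : has_csum (fun i => x i * (y i)^*) s -> inner x y = s.
Proof. exact: csumE. Qed.

Lemma innerL c x y z : ell2 x -> ell2 y -> ell2 z ->
  inner (c *: x + y) z = c * inner x z + inner y z.
Proof.
move=> xoo yoo zoo; apply: innerE.
apply: eq_has_csum (has_csumL (c := c) (inner_has_csum xoo zoo) (inner_has_csum yoo zoo)) => //.
by move=> i; rewrite mulrDl -mulrA.
Qed.

Lemma inner_conj x y : ell2 x -> ell2 y -> inner y x = (inner x y)^*.
Proof.
move=> xoo yoo; apply: innerE.
apply: eq_has_csum (has_csum_conj (inner_has_csum xoo yoo)) => // i.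
by rewrite rmorphM /= conjcK mulrC.
Qed.

Lemma innerD x y z : ell2 x -> ell2 y -> ell2 z ->
  inner (x + y) z = inner x z + inner y z.
Proof. by move=> xoo yoo zoo; rewrite -[x in LHS]scale1r innerL // mul1r. Qed.

Lemma innerDr x y z : ell2 x -> ell2 y -> ell2 z ->
  inner z (x + y) = inner z x + inner z y.
Proof.
move=> xoo yoo zoo; rewrite (inner_conj (ell2D xoo yoo)) // innerD // rmorphD /=.
by rewrite -!inner_conj.
Qed.

Lemma inner0l z : inner 0 z = 0.
Proof.
by apply: innerE; apply: eq_has_csum has_csum0 => // i; rewrite mul0r.
Qed.

Lemma innerZ c x z : ell2 x -> ell2 z -> inner (c *: x) z = c * inner x z.
Proof.
move=> xoo zoo; rewrite -[_ *: _]addr0 innerL // ?inner0l ?addr0 //; exact: ell2_0.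
Qed.

Lemma inner_sum (J : Type) (r : seq J) (F : J -> I -> C) z : (forall j, ell2 (F j)) ->
  ell2 z -> inner (\sum_(j <- r) F j) z = \sum_(j <- r) inner (F j) z.
Proof.
move=> Foo zoo; elim: r => [|j r IH]; first by rewrite !big_nil inner0l.
by rewrite !big_cons innerD ?IH //; exact: ell2_sum.
Qed.

Lemma inner_sumr (J : Type) (r : seq J) (F : J -> I -> C) z : (forall j, ell2 (F j)) ->
  ell2 z -> inner z (\sum_(j <- r) F j) = \sum_(j <- r) inner z (F j).
Proof.
move=> Foo zoo; rewrite (inner_conj (ell2_sum r Foo)) // inner_sum // rmorph_sum.
by apply: eq_bigr => j _; rewrite /= -inner_conj.
Qed.

Lemma inner_norm x : ell2 x -> inner x x = (norm2 x ^+ 2)%:C.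
Proof.
move=> xoo; apply: innerE; apply: eq_has_csum (ell2_has_csum xoo) => // i.
by rewrite mulc_conj.
Qed.

Lemma coord_le_norm2 x i : ell2 x -> normc (x i) <= norm2 x.
Proof.
move=> xoo; rewrite -ler_sqr ?nnegrE ?normc_ge0 ?norm2_ge0 //.
rewrite -lee_fin -sqnorm2E //.
have := @fsum_le_esum _ _ (fun i => normc (x i) ^+ 2) [fset i]%fset (sq_ge0 x).
by rewrite big_seq_fset1.
Qed.

Lemma norm2_eq0 x : ell2 x -> norm2 x = 0 -> x = 0.
Proof.
move=> xoo x0; apply/funext => i; apply/eqP; rewrite -normc_eq0 eq_le normc_ge0.
by rewrite -x0 coord_le_norm2.
Qed.

Lemma norm2_0 : norm2 (0 : I -> C) = 0.
Proof.
have := inner_norm ell2_0; rewrite inner0l => /(congr1 (@complex.Re R)) /= /esym/eqP.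
by rewrite sqrf_eq0 => /eqP.
Qed.

Lemma norm2Z c x : ell2 x -> norm2 (c *: x) = normc c * norm2 x.
Proof.
move=> xoo; have cxoo := ell2Z c xoo.
apply/eqP; rewrite -(@eqrXn2 _ 2) ?mulr_ge0 ?norm2_ge0 ?normc_ge0 // exprMn.
apply/eqP/complexI; rewrite -inner_norm // innerZ // (inner_conj cxoo) //.
by rewrite innerZ // rmorphM /= -inner_conj // mulrA mulc_conj inner_norm // -rmorphM.
Qed.

Lemma norm2N x : ell2 x -> norm2 (- x) = norm2 x.
Proof.
by move=> xoo; rewrite -scaleN1r norm2Z // normcN Normc.normc1 mul1r.
Qed.

Lemma norm2_distC x y : ell2 x -> ell2 y -> norm2 (x - y) = norm2 (y - x).
Proof. by move=> xoo yoo; rewrite -opprB norm2N //; exact: ell2B. Qed.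

(** Termwise, |x y| <= (t |x|^2 + |y|^2 / t) / 2 for every t > 0; the best t is the
quotient of the norms. *)
Lemma Cauchy_Schwarz x y : ell2 x -> ell2 y ->
  normc (inner x y) <= norm2 x * norm2 y.
Proof.
move=> xoo yoo.
have [x0|x_neq0] := eqVneq (norm2 x) 0.
  by rewrite (norm2_eq0 xoo x0) inner0l Normc.normc0 mulr_ge0 ?norm2_ge0.
have [y0|y_neq0] := eqVneq (norm2 y) 0.
  rewrite (inner_conj yoo xoo) normc_conj (norm2_eq0 yoo y0) inner0l Normc.normc0.
  by rewrite mulr_ge0 ?norm2_ge0.
have nx : 0 < norm2 x by rewrite lt_def x_neq0 norm2_ge0.
have ny : 0 < norm2 y by rewrite lt_def y_neq0 norm2_ge0.
pose t := norm2 y / norm2 x.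
have t0 : 0 < t by rewrite divr_gt0.
apply: (csum_le (inner_has_csum xoo yoo)
  (f := fun i => t / 2 * normc (x i) ^+ 2 + t^-1 / 2 * normc (y i) ^+ 2)).
  move=> i; rewrite Normc.normcM normc_conj -subr_ge0.
  rewrite (_ : _ - _ = t^-1 / 2 * (t * normc (x i) - normc (y i)) ^+ 2).
    by rewrite mulr_ge0 ?sqr_ge0 // divr_ge0 // invr_ge0 ltW.
  by field; rewrite gt_eqF.
have ht : 0 <= t / 2 by rewrite divr_ge0 // ltW.
have hu : 0 <= t^-1 / 2 by rewrite divr_ge0 // invr_ge0 ltW.
rewrite esumTD => [|i|i]; [|by rewrite mulr_ge0..].
rewrite (esumTZ ht (sq_ge0 x) xoo) (esumTZ hu (sq_ge0 y) yoo).
rewrite -/(sqnorm2 x) -/(sqnorm2 y) !sqnorm2E // -!EFinM -EFinD lee_fin.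
rewrite le_eqVlt; apply/orP; left; apply/eqP.
by rewrite /t; field; rewrite x_neq0.
Qed.

Lemma norm2_triangle x y : ell2 x -> ell2 y -> norm2 (x + y) <= norm2 x + norm2 y.
Proof.
move=> xoo yoo; have xyoo := ell2D xoo yoo.
rewrite -ler_sqr ?nnegrE ?addr_ge0 ?norm2_ge0 //.
rewrite (_ : norm2 (x + y) ^+ 2 = norm2 x ^+ 2 + norm2 y ^+ 2 + 2 * Re (inner x y)).
  have := Cauchy_Schwarz xoo yoo; have := Re_le_normc (inner x y).
  have := ler_norm (Re (inner x y)); lra.
have := inner_norm xyoo; rewrite innerD // !innerDr // !inner_norm //.
rewrite (inner_conj xoo yoo) => /(congr1 (@complex.Re R)) /= <-.
by case: (inner x y) => r s /=; lra.
Qed.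

(** * Linear spans and their closures *)

Lemma spanL S c x y : span S x -> span S y -> span S (c *: x + y).
Proof.
move=> [N [a [u [uS ->]]]] [M [b [v [vS ->]]]].
exists (N + M)%N, (fun l => match fintype.split l with inl i => c * a i | inr j => b j end),
  (fun l => match fintype.split l with inl i => u i | inr j => v j end); split.
  by move=> l; case: fintype.split.
rewrite big_split_ord /= scaler_sumr; congr (_ + _); apply: eq_bigr => l _.
  by rewrite (unsplitK (inl l)) scalerA.
by rewrite (unsplitK (inr l)).
Qed.

Lemma span_base S x : S x -> span S x.
Proof.
by move=> Sx; exists 1%N, (fun=> 1), (fun=> x); split=> //; rewrite big_ord1 scale1r.
Qed.

Lemma span_ell2 S x : S `<=` ell2 -> span S x -> ell2 x.
Proof.
by move=> Soo [N [a [u [uS ->]]]]; apply: ell2_sum => l; apply/ell2Z/Soo.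
Qed.

Lemma clspan_base S x : S `<=` ell2 -> S x -> clspan S x.
Proof.
move=> Soo Sx; split=> [|e e0]; first exact: Soo.
by exists x; [exact: span_base | rewrite subrr norm2_0].
Qed.

Lemma clspan0 S : clspan S 0.
Proof.
split=> [|e e0]; first exact: ell2_0.
exists 0; last by rewrite subrr norm2_0.
by exists 0%N, (fun=> 0), (fun=> 0); split=> [[]//|]; rewrite big_ord0.
Qed.

Lemma clspanL S c x y : S `<=` ell2 -> clspan S x -> clspan S y ->
  clspan S (c *: x + y).
Proof.
move=> Soo [xoo xS] [yoo yS]; split=> [|e e0]; first exact: ell2L.
have e2 : 0 < e / 2 by rewrite divr_gt0.
have c1 : 0 < normc c + 1 by rewrite ltr_wpDl ?normc_ge0.
have [x' x'S xx'] := xS _ (divr_gt0 e2 c1).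
have [y' y'S yy'] := yS _ e2.
exists (c *: x' + y'); first exact: spanL.
have x'oo := span_ell2 Soo x'S; have y'oo := span_ell2 Soo y'S.
rewrite (_ : _ - _ = c *: (x - x') + (y - y')); last first.
  by rewrite scalerBr opprD addrACA.
rewrite (le_lt_trans (norm2_triangle _ _)) //; [by apply/ell2Z/ell2B|exact: ell2B|].
rewrite norm2Z; last exact: ell2B.
rewrite [ltRHS]splitr ler_ltD //.
rewrite (le_trans (ler_wpM2r (norm2_ge0 _) (_ : normc c <= normc c + 1))) ?lerDl //.
by rewrite mulrC -ler_pdivlMr // ltW.
Qed.

Lemma clspan_closed S x : S `<=` ell2 -> ell2 x ->
  (forall e : R, 0 < e -> exists2 y, clspan S y & norm2 (x - y) < e) -> clspan S x.
Proof.
move=> Soo xoo xS; split=> // e e0; have e2 : 0 < e / 2 by rewrite divr_gt0.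
have [y [yoo yS] xy] := xS _ e2; have [z zS yz] := yS _ e2.
exists z => //; have zoo := span_ell2 Soo zS.
rewrite (_ : x - z = (x - y) + (y - z)); last by rewrite addrA subrK.
by rewrite (le_lt_trans (norm2_triangle (ell2B xoo yoo) (ell2B yoo zoo))) // [ltRHS]splitr ltrD.
Qed.

Lemma clspan_sum S (J : Type) (r : seq J) (F : J -> I -> C) : S `<=` ell2 ->
  (forall j, clspan S (F j)) -> clspan S (\sum_(j <- r) F j).
Proof.
move=> Soo FS; elim: r => [|j r IH]; first by rewrite big_nil; exact: clspan0.
by rewrite big_cons -[F j]scale1r; exact: clspanL.
Qed.

Lemma clspan_min S T : S `<=` ell2 -> T `<=` ell2 -> S `<=` clspan T ->
  clspan S `<=` clspan T.
Proof.
move=> Soo Too ST x [xoo xS]; apply: clspan_closed => // e /xS [y yS xy].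
exists y => //; case: yS => [N [a [v [vS ->]]]].
apply: clspan_sum => // l; rewrite -[_ *: _]addr0.
by apply: clspanL => //; [exact: ST | exact: clspan0].
Qed.

(** All uses of closedness go through this statement: coordinates and inner products
are bounded functionals. *)
Lemma clspan_eq0 S (phi : (I -> C) -> C) (M : R) : S `<=` ell2 ->
  (forall c x y, ell2 x -> ell2 y -> phi (c *: x + y) = c * phi x + phi y) ->
  (forall x, ell2 x -> normc (phi x) <= M * norm2 x) ->
  (forall x, S x -> phi x = 0) -> forall x, clspan S x -> phi x = 0.
Proof.
move=> Soo phiL phiM phi0 x [xoo xS].
have phi_0 : phi 0 = 0.
  have := phiL 1 0 0 ell2_0 ell2_0; rewrite scaler0 addr0 mul1r.
  by rewrite -{1}[phi 0]addr0 => /addrI.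
have span0 y : span S y -> phi y = 0.
  move=> [N [a [v [vS ->]]]].
  suff [] : ell2 (\sum_(l < N) a l *: v l) /\ phi (\sum_(l < N) a l *: v l) = 0 by [].
  elim/big_rec: _ => [|l y' _ [y'oo y'0]]; first by split=> //; exact: ell2_0.
  split; first by apply: ell2L => //; exact/Soo/vS.
  by rewrite phiL // ?y'0 ?phi0 ?mulr0 ?addr0 //; exact/Soo/vS.
have M1 : 0 < `|M| + 1 by rewrite ltr_wpDl.
apply/eqP; rewrite -normc_eq0 eq_le normc_ge0 andbT; apply/ler_addgt0Pr => e e0.
rewrite add0r; have [y yS xy] := xS _ (divr_gt0 e0 M1).
have yoo := span_ell2 Soo yS.
have -> : phi x = phi (x - y).
  by rewrite addrC -scaleN1r [RHS]phiL // (span0 y) // mulr0 add0r.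
rewrite (le_trans (phiM _ (ell2B xoo yoo))) //.
apply: (@le_trans _ _ ((`|M| + 1) * norm2 (x - y))).
  by rewrite ler_wpM2r ?norm2_ge0 // (le_trans (ler_norm _)) // lerDl.
by rewrite mulrC -ler_pdivlMr // ltW.
Qed.

End OneIndexSet.

(** * Completeness *)

Lemma cvg0P (v : nat -> R) : v @ \oo --> (0 : R) <->
  forall e : R, 0 < e -> exists N, forall p, (N <= p)%N -> `|v p| < e.
Proof.
split=> [/cvgrPdist_lt v0 e e0|v0].
  have [N _ NP] := v0 _ e0; exists N => p Np; have := NP p Np.
  by rewrite /= sub0r normrN.
apply/cvgrPdist_lt => e /v0 [N NP]; exists N => // p /= Np.
by rewrite sub0r normrN NP.
Qed.

Lemma real_Cauchy_cvg (v : nat -> R) :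
  (forall e : R, 0 < e -> exists N, forall p q, (N <= p)%N -> (N <= q)%N -> `|v p - v q| < e) ->
  exists l, forall e : R, 0 < e -> exists N, forall p, (N <= p)%N -> `|v p - l| < e.
Proof.
move=> vC; have /cvg_ex[l /cvgrPdist_lt vl] : cvgn v.
  apply: cauchy_cvg; apply: cauchy_exP => e /vC [N NP]; exists (v N).
  by exists N => // p /= Np; apply: NP.
exists l => e /vl [N _ NP]; exists N => p Np; rewrite distrC; exact: NP.
Qed.

Lemma complex_Cauchy_cvg (v : nat -> C) :
  (forall e : R, 0 < e -> exists N, forall p q, (N <= p)%N -> (N <= q)%N -> normc (v p - v q) < e) ->
  exists l, forall e : R, 0 < e -> exists N, forall p, (N <= p)%N -> normc (v p - l) < e.
Proof.
move=> vC.
have [a va] : exists a, forall e : R, 0 < e ->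
    exists N, forall p, (N <= p)%N -> `|Re (v p) - a| < e.
  apply: real_Cauchy_cvg => e /vC [N NP]; exists N => p q Np Nq.
  apply: le_lt_trans (NP p q Np Nq); apply: le_trans (Re_le_normc _).
  by case: (v p) (v q) => ? ? [].
have [b vb] : exists b, forall e : R, 0 < e ->
    exists N, forall p, (N <= p)%N -> `|Im (v p) - b| < e.
  apply: real_Cauchy_cvg => e /vC [N NP]; exists N => p q Np Nq.
  apply: le_lt_trans (NP p q Np Nq); apply: le_trans (Im_le_normc _).
  by case: (v p) (v q) => ? ? [].
exists (a +i* b) => e e0; have e2 : 0 < e / 2 by rewrite divr_gt0.
have [N1 N1P] := va _ e2; have [N2 N2P] := vb _ e2.
exists (maxn N1 N2) => p; rewrite geq_max => /andP[/N1P h1 /N2P h2].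
apply: (le_lt_trans (normc_le_Re_Im _)); rewrite [ltRHS]splitr.
by case: (v p) h1 h2 => r s /= h1 h2; rewrite ltrD.
Qed.

(** The limit is taken coordinatewise; it is a limit in norm because the Cauchy
estimates pass to the limit in every finite sum. *)
Lemma ell2_complete (I : choiceType) (u : nat -> I -> C) :
  (forall N, ell2 (u N)) ->
  (forall e : R, 0 < e -> exists N0 : nat, forall p q : nat,
     (N0 <= p)%N -> (N0 <= q)%N -> norm2 (u p - u q) < e) ->
  exists2 x, ell2 x & (fun N => norm2 (u N - x)) @ \oo --> (0 : R).
Proof.
move=> uoo uC.
have /choice[x ux] : forall i, exists l, forall e : R, 0 < e ->
    exists N, forall p, (N <= p)%N -> normc (u p i - l) < e.
  move=> i; apply: complex_Cauchy_cvg => e /uC [N NP]; exists N => p q Np Nq.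
  by apply: le_lt_trans (NP p q Np Nq); apply: (coord_le_norm2 i); exact: ell2B.
have dist e q : 0 < e -> (exists N, forall p, (N <= p)%N -> norm2 (u p - u q) < e) ->
    (sqnorm2 (u q - x)%R <= (e ^+ 2)%:E)%E.
  move=> e0 [N NP]; apply: esum_le_fsum => B; rewrite lee_fin.
  have uxi i : (fun p => normc (u q i - u p i)) @ \oo --> normc ((u q - x) i).
    apply/cvgrPdist_lt => r /(ux i)[M MP]; exists M => // p /= /MP.
    apply: le_lt_trans; rewrite ler_norml.
    have := le_normcD ((u q - x) i) (x i - u p i).
    have := le_normcD (u q i - u p i) (u p i - x i).
    rewrite !fctE !addrA !subrK -(normcN (u p i - x i)) opprB.
    lra.
  have uxB : (fun p => \sum_(i <- B) normc (u q i - u p i) ^+ 2) @ \oo -->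
      \sum_(i <- B) normc ((u q - x) i) ^+ 2.
    apply: cvg_big => [|i _]; first exact: add_continuous.
    by under eq_fun do rewrite expr2; rewrite expr2; apply: cvgM; exact: uxi.
  apply: (cvgr_to_le uxB); exists N => // p /= /NP pq.
  have pqoo : ell2 (u q - u p) by exact: ell2B.
  rewrite -lee_fin; apply: le_trans (fsum_le_esum B (f := fun i => normc ((u q - u p) i) ^+ 2) _) _.
    by move=> i; exact: sqr_ge0.
  rewrite -/(sqnorm2 (u q - u p)) sqnorm2E // lee_fin norm2_distC //.
  by rewrite ler_sqr ?nnegrE ?norm2_ge0 ?ltW.
have xoo : ell2 x.
  have [N NP] := uC 1 ltr01.
  have uxoo : ell2 (u N - x).
    apply: (le_lt_trans (dist 1 N ltr01 _)); last exact: ltry.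
    by exists N => p Np; exact: NP.
  by rewrite -[x](subKr (u N)); exact: ell2B.
exists x => //; apply/cvg0P => e e0; have e2 : 0 < e / 2 by rewrite divr_gt0.
have [N NP] := uC _ e2; exists N => q Nq; have uqx := ell2B (uoo q) xoo.
rewrite ger0_norm ?norm2_ge0 //; apply: (@le_lt_trans _ _ (e / 2)); last lra.
rewrite -ler_sqr ?nnegrE ?norm2_ge0 ?(ltW e2) // -lee_fin -sqnorm2E //.
by apply: dist => //; exists N => p Np; exact: NP.
Qed.

End SquareSummable.

(** * Sums over a free monoid *)

Section FiniteSums.
Context {R : realType}.
Local Notation C := R[i].
#[local] Opaque has_csum.

Lemma has_csum_finType (T : finType) (x : T -> C) : has_csum x (\sum_t x t).
Proof.
apply: eq_has_csum (has_csum_sum (r := index_enum T)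
  (x := fun j i => if i == j then x i else 0) (s := x) _) => [i||j] //.
  by rewrite -big_mkcond (big_pred1 i) // => j; rewrite eq_sym.
have /= := has_csum_single (x := fun i => if i == j then x i else 0) (i0 := j).
by rewrite eqxx; apply => i /negbTE ->.
Qed.

(** Fubini along concatenation: the fibre of a word has one point for each way of
cutting it in two. *)
Lemma has_csum_cat (T : choiceType) (A G : seq T -> C) s t :
  has_csum A s -> has_csum G t ->
  has_csum (fun w => \sum_(l < (size w).+1) A (take l w) * G (drop l w)) (s * t).
Proof.
move=> As Gt.
apply: (has_csum_fibers (p := fun vw : seq T * seq T => vw.1 ++ vw.2)
  (has_csum_prod As Gt)) => w /=.
pose p (l : 'I_(size w).+1) := (take l w, drop l w).
apply: (has_csum_inj (p := p)) => [l l' [/(congr1 size)]|[u v] /= uvp|].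
- by rewrite !size_takel -1?ltnS // => /val_inj.
- case: eqP => // uvw; have lu : (size u < (size w).+1)%N.
    by rewrite ltnS -uvw size_cat leq_addr.
  by have := uvp (Ordinal lu); rewrite /p /= -uvw take_size_cat // drop_size_cat // eqxx.
have := has_csum_finType (x := fun l : 'I_(size w).+1 => A (take l w) * G (drop l w)).
by apply: eq_has_csum => // l; rewrite /= cat_take_drop eqxx.
Qed.

End FiniteSums.

Section Words.
Context {R : realType} {n : nat} (a : seq 'I_n -> R).
Local Notation C := R[i].
#[local] Opaque has_csum.
Implicit Types (w v : seq 'I_n) (z u : 'I_n -> C).

(** The sum of a(g_1) ... a(g_p) over the factorizations w = g_1 ... g_p, by
peeling off the first factor; empty factors contribute nothing when a vanishes on
the empty word. *)
Fixpoint compsum (p : nat) w : R :=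
  if p is p'.+1 then
    \sum_(l < (size w).+1) a (take l w) * compsum p' (drop l w)
  else (w == [::])%:R.

(** For m >= 1 this is b^(m), see [bcoefE]; the convention for m = 0 makes it the
indicator of the empty word, the coefficients of (1 - f)^0, so that inductions on m
can start there. *)
Definition bco (m : nat) w : R :=
  \sum_(p < (size w).+1) compsum p w * 'C(p + m - 1, p)%:R.

Hypothesis a_ge0 : forall w, 0 <= a w.
Hypothesis a_nil : a [::] = 0.

Lemma compsum_ge0 p w : 0 <= compsum p w.
Proof.
elim: p w => [|p IH] w /=; first exact: ler0n.
by apply: sumr_ge0 => l _; rewrite mulr_ge0.
Qed.

Lemma compsum_eq0 p w : (size w < p)%N -> compsum p w = 0.
Proof.
elim: p w => [|p IH] w //; rewrite ltnS => wp; rewrite /= big1 // => -[[|l] /= lw] _.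
  by rewrite take0 a_nil mul0r.
rewrite IH ?mulr0 // size_drop; apply: leq_trans wp.
by rewrite ltn_subrL /= (leq_trans _ (_ : l.+1 <= size w)%N).
Qed.

Lemma bco_widen m w N : (size w < N)%N ->
  bco m w = \sum_(p < N) compsum p w * 'C(p + m - 1, p)%:R.
Proof.
move=> wN; rewrite /bco (big_ord_widen _ (fun p => compsum p w * 'C(p + m - 1, p)%:R) wN).
rewrite big_mkcond /=; apply: eq_bigr => p _; case: ifPn => //.
by rewrite ltnS -ltnNge => /compsum_eq0 ->; rewrite mul0r.
Qed.

Lemma bco_ge0 m w : 0 <= bco m w.
Proof. by apply: sumr_ge0 => p _; rewrite mulr_ge0 ?compsum_ge0. Qed.

Lemma bco0 w : bco 0 w = (w == [::])%:R.
Proof.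
rewrite /bco big_ord_recl /= bin0 mulr1 big1 ?addr0 // => p _.
by rewrite /= addn0 subn1 /= bin_small ?mulr0.
Qed.

Lemma bcoS_nil m : bco m.+1 [::] = 1.
Proof. by rewrite /bco big_ord1 /= bin0 mulr1. Qed.

(** Pascal's rule gives the coefficientwise form of the identity
(1 - f)^-(m+1) = (1 - f)^-m + f (1 - f)^-(m+1). *)
Lemma bco_rec m w : bco m.+1 w =
  bco m w + \sum_(l < (size w).+1) a (take l w) * bco m.+1 (drop l w).
Proof.
have [N EN] : {N | N = (size w).+1} by exists (size w).+1.
have cE q : compsum q.+1 w = \sum_(l < N) a (take l w) * compsum q (drop l w) by rewrite EN.
rewrite -EN; set S := \sum_(l < _) _.
rewrite !(@bco_widen _ _ N.+1) ?EN // -EN !big_ord_recl /= !bin0 !mulr1 -addrA; congr (_ + _).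
have -> : S = \sum_(l < N) \sum_(p < N) a (take l w) * compsum p (drop l w) * 'C(p + m.+1 - 1, p)%:R.
  apply: eq_bigr; move=> l _; rewrite (@bco_widen _ _ N) ?mulr_sumr.
    by apply: eq_bigr => p _; rewrite mulrA.
  by rewrite size_drop (leq_ltn_trans (leq_subr _ _)) // EN.
rewrite exchange_big /= -big_split /=; apply: eq_bigr => p _.
rewrite -mulr_suml /bump !add1n -cE -mulrDr -natrD; congr (_ * _%:R).
by rewrite !addnS !addSn !subn1 /= addnC -binS.
Qed.

(** Keep, in [bco_rec], only the factorizations that start with the letter j.
This is what makes the weighted shifts bounded. *)
Lemma bco_cons m j w : a [:: j] * bco m.+1 w <= bco m.+1 (j :: w).
Proof.
rewrite [leRHS]bco_rec (bigD1 (Ordinal (isT : (1 < (size (j :: w)).+1)%N))) //= take0 drop0.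
by rewrite addrCA lerDl addr_ge0 ?bco_ge0 // sumr_ge0 // => l _; rewrite mulr_ge0 ?bco_ge0.
Qed.

Lemma big_tuple_cons (T : finType) p (F : p.+1.-tuple T -> R) :
  \sum_g F g = \sum_(x : T) \sum_(t : p.-tuple T) F (cons_tuple x t).
Proof.
rewrite pair_big /= (reindex (fun xt : T * p.-tuple T => cons_tuple xt.1 xt.2)) //=.
exists (fun g => (thead g, behead_tuple g)) => [[x t] _|g _] /=.
  by rewrite theadE; congr (_, _); apply: val_inj.
by apply: val_inj; rewrite /= [in RHS](tuple_eta g).
Qed.

(** The link with tuples of words of bounded length, for an arbitrary bound N so
that the induction on p can shorten w. *)
Lemma compsum_tuple p N w : (size w <= N)%N ->
  \sum_(g : p.-tuple (N.-bseq 'I_n) | flatten [seq bseqval x | x <- g] == w)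
     \prod_(x <- g) a (bseqval x) = compsum p w.
Proof.
elim: p w => [|p IH] w wN.
  rewrite big_mkcond (big_pred1 [tuple]) /=; last by move=> t; apply/esym/eqP; exact: tuple0.
  by rewrite big_nil eq_sym; case: eqP.
rewrite big_mkcond big_tuple_cons /=.
under eq_bigr do rewrite -big_mkcond /=.
rewrite (eq_bigr (fun x : N.-bseq 'I_n => if bseqval x == take (size x) w then
   a x * compsum p (drop (size x) w) else 0)); last first.
  move=> x _; case: eqP => [xw|xw].
    rewrite -IH; last by rewrite size_drop (leq_trans (leq_subr _ _)).
    rewrite mulr_sumr; apply: eq_big => [t|t _]; last by rewrite big_cons.
    by rewrite -{1}[w](cat_take_drop (size x)) -{1}xw eqseq_cat // eqxx.
  rewrite big1 // => t /eqP tw; case: xw; rewrite -tw take_size_cat //.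
rewrite -big_mkcond /=.
pose h (l : 'I_(size w).+1) : N.-bseq 'I_n := insub_bseq N (take l w).
have hE l : bseqval (h l) = take l w.
  by rewrite /h /insub_bseq insubdK // -topredE /= size_take_min (leq_trans (geq_minr _ _)).
rewrite (reindex_onto h (fun x => inord (size x))) /=; last first.
  move=> x /eqP xw; apply: val_inj; rewrite [LHS]hE inordK // ltnS.
  by rewrite xw size_take_min geq_minr.
apply: eq_big => [l|l _]; rewrite hE size_takel -1?ltnS // eqxx inord_val eqxx //.
Qed.

Lemma bcoefE m w : (0 < m)%N -> bcoef m a w = bco m w.
Proof.
case: m => // m _; case: w => [|j w']; first by rewrite bcoS_nil.
set w := j :: w'; rewrite /bcoef -/w.
rewrite big_add1 /= big_mkord /bco [RHS]big_ord_recl.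
rewrite (_ : compsum _ w = 0) // mul0r add0r.
apply: eq_bigr => p _; rewrite -mulr_suml -(@compsum_tuple _ (size w)) //.
have -> : 'C(bump 0 p + m.+1 - 1, m.+1 - 1) = 'C(bump 0 p + m.+1 - 1, bump 0 p).
  by rewrite addnS !subn1 /= -[LHS]bin_sub ?leq_addl // addnK.
congr (_ * _); rewrite big_mkcondr /=; apply: eq_bigr => g _.
case: ifPn => // /allPn[x xg]; rewrite -eqn0Ngt => /nilP x0.
by rewrite (big_rem x) //= x0 a_nil mul0r.
Qed.

Lemma bcoef_cons m j w : (0 < m)%N -> a [:: j] * bcoef m a w <= bcoef m a (j :: w).
Proof. by case: m => // m _; rewrite !bcoefE // bco_cons. Qed.

Lemma bcoef_gt0 m w : (0 < m)%N -> (forall j, 0 < a [:: j]) -> 0 < bcoef m a w.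
Proof.
move=> m0 a1; elim: w => [|j w IH]; first exact: ltr01.
by apply: lt_le_trans (bcoef_cons j w m0); rewrite mulr_gt0.
Qed.

(** * Generating functions over words *)

(** For a multiplicative chi >= 0, the sum S_N of [bco m.+1 * chi] over the words
of length < N satisfies S_(N+1) <= T + s S_N by [bco_rec], where T is the sum for m
and s < 1 the sum of [a * chi]; hence S_N <= T / (1 - s) for all N. *)
Lemma bco_esum_lt (chi : seq 'I_n -> R) (s : R) m :
  (forall w, 0 <= chi w) -> chi [::] = 1 ->
  (forall v w, chi (v ++ w) = chi v * chi w) ->
  (\esum_(w in [set: seq 'I_n]) (a w * chi w)%:E = s%:E)%E -> s < 1 ->
  (\esum_(w in [set: seq 'I_n]) (bco m w * chi w)%:E < +oo)%E.
Proof.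
move=> chi0 chi1 chiM as_ s1.
have A0 w : 0 <= a w * chi w by rewrite mulr_ge0.
have s0 : 0 <= s by rewrite -lee_fin -as_ esumT_ge0.
have B0 m' w : 0 <= bco m' w * chi w by rewrite mulr_ge0 ?bco_ge0.
elim: m => [|m IH].
  have /has_csum_abs_summable : has_csum (fun w => (bco 0 w * chi w)%:C : C) (bco 0 [::] * chi [::])%:C.
    by apply: has_csum_single => w /negbTE w0; rewrite bco0 w0 mul0r.
  by rewrite abs_summable_posE.
set T := fine (\esum_(w in [set: seq 'I_n]) (bco m w * chi w)%:E).
have TE : \esum_(w in [set: seq 'I_n]) (bco m w * chi w)%:E = T%:E by exact: esumT_fin.
have T0 : 0 <= T by rewrite -lee_fin -TE esumT_ge0.
pose G N w : R := if (size w < N)%N then bco m.+1 w * chi w else 0.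
have G0 N w : 0 <= G N w by rewrite /G; case: ifP.
(* the bound solves M = T + s M *)
pose M := T / (1 - s).
have ME : T + s * M = M by rewrite /M; field; rewrite subr_eq0 gt_eqF.
have M0 : 0 <= M by rewrite divr_ge0 // subr_ge0 ltW.
have GM N : (\esum_(w in [set: seq 'I_n]) (G N w)%:E <= M%:E)%E.
  elim: N => [|N IHN]; first by rewrite esum1.
  have Goo : (\esum_(w in [set: seq 'I_n]) (G N w)%:E < +oo)%E.
    exact: le_lt_trans IHN (ltry _).
  have Aoo : (\esum_(w in [set: seq 'I_n]) (a w * chi w)%:E < +oo)%E by rewrite as_ ltry.
  have := has_csum_cat (has_csum_esum A0 Aoo) (has_csum_esum (G0 N) Goo).
  move/(has_csumD (has_csum_esum (B0 m) IH)).
  set f := fun w => bco m w * chi w + \sum_(l < (size w).+1) (a (take l w) * chi (take l w)) * G N (drop l w).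
  rewrite (_ : (fun i => _) = fun w => (f w)%:C); last first.
    apply/funext => w; rewrite /f real_complexD; congr (_ + _); rewrite real_complex_sum.
    by apply: eq_bigr => l _; rewrite [RHS]real_complexM.
  rewrite -rmorphM -rmorphD as_ TE /= => /esum_has_csum fE.
  apply: (@le_trans _ _ (\esum_(w in [set: seq 'I_n]) (f w)%:E)); last first.
    rewrite fE => [|w]; last first.
      by rewrite /f addr_ge0 // sumr_ge0 // => l _; rewrite mulr_ge0.
    by rewrite lee_fin /= -ME lerD // ler_wpM2l // -lee_fin -esumT_fin.
  apply: le_esumT => w; rewrite {1}/G ltnS; case: ifPn => wN; last first.
    by rewrite /f addr_ge0 // sumr_ge0 // => l _; rewrite mulr_ge0.
  rewrite /f bco_rec mulrDl lerD // mulr_suml ler_sum // => -[[|l] lw] _.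
    by rewrite take0 a_nil !mul0r.
  rewrite /G size_drop /= (leq_trans _ wN); last first.
    by rewrite ltn_subrL /= (leq_trans _ (_ : l.+1 <= size w)%N).
  have := chiM (take l.+1 w) (drop l.+1 w); rewrite cat_take_drop => ->.
  by rewrite mulrACA.
apply: (@le_lt_trans _ _ M%:E); last exact: ltry.
apply: esum_le_fsum => B.
have [N NB] := fset_bounded size B.
apply: le_trans (GM N).
apply: le_trans (fsum_le_esum B (G0 _)); rewrite lee_fin !big_seq.
by apply: ler_sum => w wB; rewrite /G NB.
Qed.

(** Summing [bco_rec] against a multiplicative chi gives s' = s + f s' for the sums
s, s' of orders m and m+1. *)
Lemma bco_csum (chi : seq 'I_n -> C) (f : C) m :
  chi [::] = 1 -> (forall v w, chi (v ++ w) = chi v * chi w) ->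
  has_csum (fun w => (a w)%:C * chi w) f ->
  (forall m, abs_summable (fun w => (bco m w)%:C * chi w)) ->
  exists2 s, has_csum (fun w => (bco m w)%:C * chi w) s & s * (1 - f) ^+ m = 1.
Proof.
move=> chi1 chiM af boo; elim: m => [|m [s ms s1]].
  exists 1; last by rewrite expr0 mulr1.
  have := has_csum_single (x := fun w => (bco 0 w)%:C * chi w) (i0 := [::]).
  rewrite bco0 eqxx chi1 mulr1; apply => w /negbTE w0.
  by rewrite bco0 w0 mul0r.
have [t mt] := abs_summable_has_csum (boo m.+1); exists t => //.
have /(has_csumD ms) := has_csum_cat af mt.
move=> H; have {}H : has_csum (fun w => (bco m.+1 w)%:C * chi w) (s + f * t).
  apply: eq_has_csum H => // w; rewrite bco_rec real_complexD mulrDl; congr (_ + _).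
  rewrite real_complex_sum mulr_suml; apply: eq_bigr => l _.
  have := chiM (take l w) (drop l w); rewrite cat_take_drop => ->.
  by rewrite real_complexM mulrACA.
have ts := has_csum_unique mt H.
rewrite exprS mulrA mulrBr mulr1 (_ : t - t * f = s) //.
by rewrite {1}ts mulrC addrK.
Qed.

End Words.

Section Evaluation.
Context {R : realType} {n : nat}.
Local Notation C := R[i].
#[local] Opaque has_csum.
Implicit Types (a : seq 'I_n -> R) (w v : seq 'I_n) (z u : 'I_n -> C) (K : {ffun 'I_n -> nat}).

Definition cnt w : {ffun 'I_n -> nat} := [ffun j => count_mem j w].

Lemma cnt_cat v w j : cnt (v ++ w) j = (cnt v j + cnt w j)%N.
Proof. by rewrite !ffunE count_cat. Qed.

Lemma cnt_perm v w : cnt v = cnt w -> perm_eq v w.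
Proof.
move=> vw; by apply/allP => j _; move/ffunP: vw => /(_ j); rewrite !ffunE /= => ->.
Qed.

Lemma wval_nil z : wval z [::] = 1.
Proof. exact: big_nil. Qed.

Lemma wval_cat z v w : wval z (v ++ w) = wval z v * wval z w.
Proof. exact: big_cat. Qed.

Lemma wval_cnt z w : wval z w = \prod_j z j ^+ cnt w j.
Proof.
elim: w => [|j w IH].
  by rewrite wval_nil big1 // => j _; rewrite ffunE expr0.
rewrite /wval big_cons -/(wval z w) IH (bigD1 j) //= [RHS](bigD1 j) //= mulrA.
rewrite !ffunE /= eqxx exprS; congr (_ * _); apply: eq_bigr => l lj.
by rewrite !ffunE /= eq_sym (negbTE lj).
Qed.

(** Words define the same monomial exactly when their letter counts agree: evaluate
at the point with coordinate 2 at one letter and 1 elsewhere. *)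
Lemma LambdaE K w : Lambda (R := R) K w = (cnt w = K).
Proof.
apply/propext; split=> [wK|<- z]; last exact: wval_cnt.
apply/ffunP => j; have := wK (fun l => if l == j then 2 else 1).
rewrite wval_cnt (bigD1 j) //= big1 ?mulr1 => [|l /negbTE ->]; last by rewrite expr1n.
rewrite [in RHS](bigD1 j) //= big1 ?mulr1 => [|l /negbTE ->]; last by rewrite expr1n.
by rewrite eqxx -!natrX => /eqP; rewrite eqr_nat eqn_exp2l // => /eqP.
Qed.

Lemma size_cnt w : size w = (\sum_j cnt w j)%N.
Proof. by rewrite -sum1_size (partition_big id xpredT) //=; apply: eq_bigr => j _; rewrite ffunE sum1_count. Qed.

Lemma finite_Lambda K : finite_set (Lambda (R := R) K).
Proof.
have fin : finite_set (range (fun t : (\sum_j K j)%N.-tuple 'I_n => tval t)).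
  exact/finite_image/finite_finset.
apply: sub_finite_set fin => w; rewrite /= LambdaE => wK.
have sw : size w == (\sum_j K j)%N by rewrite size_cnt wK.
by exists (Tuple sw).
Qed.

Lemma gam_csum m a K :
  has_csum (fun w => if cnt w == K then (bcoef m a w)%:C else 0 : C) (gam m a K)%:C.
Proof.
rewrite /gam fsbig_finite; last exact: finite_Lambda.
rewrite real_complex_sum.
have := has_csum_finite (x := fun w => if cnt w == K then (bcoef m a w)%:C else 0 : C) (B := fset_set (Lambda (R := R) K)).
rewrite (_ : \sum_(w <- _) (if _ then _ else _) =
    \sum_(w <- fset_set (Lambda (R := R) K)) (bcoef m a w)%:C).
  apply => w; rewrite in_fset_set ?notin_setE ?LambdaE; last exact: finite_Lambda.
  by case: eqP.
apply: eq_fbigr => w; rewrite in_fset_set; last exact: finite_Lambda.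
by rewrite inE LambdaE => -> _; rewrite eqxx.
Qed.

Lemma wvecE m a K w : wvec m a K w =
  if cnt w == K then (gam m a K)^-1%:C * (Num.sqrt (bcoef m a w))%:C else 0.
Proof.
rewrite /wvec fctE fsbig_finite; last exact: finite_Lambda.
rewrite fct_sumE; have finK := finite_Lambda K.
case: eqP => [wK|wK].
  rewrite (bigD1_seq w) ?fset_uniq ?in_fset_set ?inE ?LambdaE //=.
  rewrite fctE /delta eqxx big1 ?addr0 => [|v /negbTE vw].
    by rewrite -[X in _ = _ * X]mulr1.
  by rewrite fctE /delta eq_sym vw scaler0.
rewrite big_seq big1 ?scaler0 // => v; rewrite in_fset_set // inE LambdaE => vK.
rewrite fctE /delta; case: eqP => [wv|]; last by rewrite scaler0.
by rewrite wv vK in wK.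
Qed.

(** * The kernel in one group of variables *)

Lemma fsqvalE a z : a [::] = 0 -> fsqval a z =
  \esum_(w in [set: seq 'I_n]) (a w * normc (wval z w) ^+ 2)%:E.
Proof.
move=> a0; rewrite /fsqval esum_mkcond; apply: eq_esum => w _.
case: ifPn => //; rewrite notin_setE /= => /negP; rewrite -leqNgt leqn0 => /nilP ->.
by rewrite a0 mul0r.
Qed.

Section Domain.
Variables (a : seq 'I_n -> R) (m : nat).
Hypotheses (a_ge0 : forall w, 0 <= a w) (a_nil : a [::] = 0) (m_gt0 : (0 < m)%N).

Lemma fsqval_fin z : (fsqval a z < 1)%E ->
  (fsqval a z = (fine (fsqval a z))%:E)%E /\ 0 <= fine (fsqval a z) < 1.
Proof.
move=> z1; have f0 w : 0 <= a w * normc (wval z w) ^+ 2 by rewrite mulr_ge0 ?sqr_ge0.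
have zE : fsqval a z = (fine (fsqval a z))%:E.
  rewrite fsqvalE //; apply: esumT_fin => //; rewrite -fsqvalE //.
  by rewrite (lt_trans z1) // ltry.
split=> //; rewrite -lee_fin -lte_fin -zE z1 andbT fsqvalE //.
exact: esumT_ge0.
Qed.

Lemma bco_esum_z m' z : (fsqval a z < 1)%E ->
  (\esum_(w in [set: seq 'I_n]) (bco a m' w * normc (wval z w) ^+ 2)%:E < +oo)%E.
Proof.
move=> /fsqval_fin[zE /andP[_ z1]]; apply: (bco_esum_lt _ a_nil) z1 => // [w||v w|].
- exact: sqr_ge0.
- by rewrite wval_nil Normc.normc1 expr1n.
- by rewrite wval_cat Normc.normcM exprMn.
- by rewrite -fsqvalE.
Qed.

Lemma abs_summable_kernel (b : seq 'I_n -> R) z u : (forall w, 0 <= b w) ->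
  (\esum_(w in [set: seq 'I_n]) (b w * normc (wval z w) ^+ 2)%:E < +oo)%E ->
  (\esum_(w in [set: seq 'I_n]) (b w * normc (wval u w) ^+ 2)%:E < +oo)%E ->
  abs_summable (fun w => (b w)%:C * (wval z w * (wval u w)^*)).
Proof.
move=> b0 zoo uoo; have b0n x w : 0 <= b w * normc (wval x w) ^+ 2 by rewrite mulr_ge0 ?sqr_ge0.
apply: (abs_summable_le (f := fun w => b w * normc (wval z w) ^+ 2 + b w * normc (wval u w) ^+ 2)).
  move=> w; rewrite !Normc.normcM normc_conj normc_realE ger0_norm // -mulrDr.
  rewrite ler_wpM2l //.
  have := sqr_ge0 (normc (wval z w) - normc (wval u w)).
  have := sqr_ge0 (normc (wval z w)); have := sqr_ge0 (normc (wval u w)); lra.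
rewrite esumTD // (esumT_fin (b0n z) zoo) (esumT_fin (b0n u) uoo) -EFinD; exact: ltry.
Qed.

Lemma fterm_summable z u : (fsqval a z < 1)%E -> (fsqval a u < 1)%E ->
  abs_summable (fterm a z u).
Proof.
move=> z1 u1; have lt1oo r : (r < 1 -> r < +oo :> \bar R)%E.
  by move=> r1; apply: lt_trans r1 (ltry _).
have := @abs_summable_kernel a z u a_ge0.
rewrite -!fsqvalE // => /(_ (lt1oo _ z1) (lt1oo _ u1)).
by rewrite /abs_summable; under eq_esum do rewrite mulrA.
Qed.

(** The geometric mean bound |z_w u_w| <= |z_w|^2 + |u_w|^2 reduces absolute
convergence to the diagonal. That 1 - f(z,u) does not vanish is part of the identity
s (1 - f) = 1 of order one. *)
Lemma bcoef_csum z u : (fsqval a z < 1)%E -> (fsqval a u < 1)%E ->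
  1 - feval a z u != 0 /\
  has_csum (fun w => (bcoef m a w)%:C * (wval z w * (wval u w)^*))
    (((1 - feval a z u) ^+ m)^-1).
Proof.
move=> z1 u1; have [f af] := abs_summable_has_csum (fterm_summable z1 u1).
rewrite /feval (csumE af).
have {}af : has_csum (fun w => (a w)%:C * (wval z w * (wval u w)^*)) f.
  by apply: eq_has_csum af => // w; rewrite mulrA.
have sum m' := @bco_csum _ _ a a_nil (fun w => wval z w * (wval u w)^*) f m'.
have {}sum m' : exists2 s, has_csum (fun w => (bco a m' w)%:C * (wval z w * (wval u w)^*)) s
    & s * (1 - f) ^+ m' = 1.
  apply: sum => // [|v w|m''].
  - by rewrite !wval_nil rmorph1 mulr1.
  - by rewrite !wval_cat rmorphM mulrACA.
  - apply: abs_summable_kernel; [|exact: bco_esum_z..].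
    by move=> w; exact: bco_ge0.
have f1 : 1 - f != 0.
  have [s _ s1] := sum 1%N; apply/eqP => f0; move/eqP: s1.
  by rewrite expr1 f0 mulr0 eq_sym oner_eq0.
split; first exact: f1.
have [s ms s1] := sum m.
rewrite (_ : _^-1 = s); last first.
  by apply: (mulIf (expf_neq0 m f1)); rewrite mulVf ?expf_neq0 // s1.
by apply: eq_has_csum ms => // w; rewrite bcoefE.
Qed.

Lemma feval_diag z : (fsqval a z < 1)%E -> feval a z z = (fine (fsqval a z))%:C.
Proof.
move=> z1; have [zE _] := fsqval_fin z1.
have f0 w : 0 <= a w * normc (wval z w) ^+ 2 by rewrite mulr_ge0 ?sqr_ge0.
have foo : (\esum_(w in [set: seq 'I_n]) (a w * normc (wval z w) ^+ 2)%:E < +oo)%E.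
  by rewrite -fsqvalE // zE ltry.
apply: csumE; have := has_csum_esum f0 foo; rewrite -fsqvalE //.
by apply: eq_has_csum => // w; rewrite /fterm -mulrA mulc_conj real_complexM.
Qed.

End Domain.
End Evaluation.

(** * Multiwords *)

Section MultiWords.
Context {R : realType} {k : nat} {n : 'I_k -> nat}.
Local Notation C := R[i].
#[local] Opaque has_csum.
Implicit Types (b : mword n) (i : 'I_k).

Lemma mwordM_coord (v b : mword n) i : mwordM v b i = v i ++ b i.
Proof. by rewrite ffunE. Qed.

Lemma mword1_coord i : mword1 n i = [::].
Proof. by rewrite ffunE. Qed.

Lemma mupd_same b i (w : seq 'I_(n i)) : mupd b w i = w.
Proof. by rewrite ffunE dfwithin. Qed.

Lemma mupd_diff b i (w : seq 'I_(n i)) j : i != j -> mupd b w j = b j.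
Proof. by move=> ij; rewrite ffunE dfwithout. Qed.

Lemma mupd_id b i : mupd b (b i) = b.
Proof.
apply/ffunP => j; have [<-|ij] := eqVneq i j; first by rewrite mupd_same.
by rewrite mupd_diff.
Qed.

Lemma mupd_mupd b i (v w : seq 'I_(n i)) : mupd (mupd b v) w = mupd b w.
Proof.
apply/ffunP => j; have [<-|ij] := eqVneq i j; first by rewrite !mupd_same.
by rewrite !mupd_diff.
Qed.

(** An unordered sum over a product of index sets of a product of functions of
one coordinate.  The coordinates are released one at a time; the ones not yet
released are pinned to the empty word. *)
Lemma has_csum_mword (F : forall i, seq 'I_(n i) -> C) (s : 'I_k -> C) :
  (forall i, has_csum (F i) (s i)) ->
  has_csum (fun b : mword n => \prod_i F i (b i)) (\prod_i s i).
Proof.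
move=> Fs; pose X (r : seq 'I_k) b : C :=
  \prod_i (if i \in r then F i (b i) else (b i == [::])%:R).
suff X_sum r : uniq r -> has_csum (X r) (\prod_(i <- r) s i).
  have := X_sum (index_enum 'I_k) (index_enum_uniq _).
  by apply: eq_has_csum => // b; apply: eq_bigr => i _; rewrite mem_index_enum.
elim: r => [_|i0 r IH /= /andP[i0r /IH Xr]].
  rewrite big_nil; have := has_csum_single (x := X [::]) (i0 := mword1 n).
  have -> : X [::] (mword1 n) = 1.
    by rewrite /X big1 // => i _; rewrite ffunE eqxx.
  apply=> b b1; apply/eqP; rewrite prodf_seq_eq0 /=; apply/hasP.
  have /existsP[i bi] : [exists i, b i != [::]].
    apply: contraR b1; rewrite negb_exists => /forallP bi; apply/eqP/ffunP => i.
    by rewrite ffunE; apply/eqP; have := bi i; rewrite negbK.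
  by exists i; rewrite ?mem_index_enum //= pnatr_eq0 eqb0.
rewrite big_cons.
apply: (has_csum_fibers (p := fun wb : seq 'I_(n i0) * mword n => mupd wb.2 wb.1)
  (has_csum_prod (Fs i0) Xr)) => c.
have := has_csum_single (x := fun wb : seq 'I_(n i0) * mword n =>
   if mupd wb.2 wb.1 == c then F i0 wb.1 * X r wb.2 else 0) (i0 := (c i0, mupd c ([::] : seq 'I_(n i0)))).
rewrite /= mupd_mupd mupd_id eqxx => single; apply: eq_has_csum (single _) => //.
  rewrite /X (bigD1 i0) //= [in RHS](bigD1 i0) //= mem_head (negbTE i0r) mupd_same eqxx mul1r.
  congr (_ * _); apply: eq_bigr => i ii0.
  by rewrite in_cons (negbTE ii0) /= mupd_diff // eq_sym.
move=> {single} [w b] wb; case: eqP => //= bc.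
have [bi0|bi0] := eqVneq (b i0) [::]; last first.
  by rewrite /X (bigD1 i0) //= (negbTE i0r) (negbTE bi0) mul0r mulr0.
case/eqP: wb; rewrite -bc mupd_same mupd_mupd -bi0 mupd_id //.
Qed.

Definition mcnt b : mindex n := [ffun i => cnt (b i)].

Section Model.
Variables (m : 'I_k -> nat) (a : forall i : 'I_k, seq 'I_(n i) -> R).
Arguments a : clear implicits.
Hypothesis m_ge1 : forall i, (1 <= m i)%N.
Hypothesis a_reg : forall i, positive_regular (a i).
Implicit Types (z u : @point R k n) (K : mindex n) (c d : mindex n -> C).

Let a_ge0 i w : 0 <= a i w. Proof. by case: (a_reg i). Qed.
Let a_nil i : a i [::] = 0. Proof. by case: (a_reg i). Qed.
Let a_gt0 i j : 0 < a i [:: j]. Proof. by case: (a_reg i). Qed.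

Definition mbeta b : R := \prod_i bcoef (m i) (a i) (b i).

Definition mval z b : C := \prod_i wval (z i) (b i).

Lemma bcoef_pos i w : 0 < bcoef (m i) (a i) w.
Proof. by apply: bcoef_gt0; [exact: a_ge0 | exact: a_nil | exact: m_ge1 | exact: a_gt0]. Qed.

Lemma mbeta_gt0 b : 0 < mbeta b.
Proof. by apply: prodr_gt0 => i _; exact: bcoef_pos. Qed.

Lemma mbeta_ge0 b : 0 <= mbeta b.
Proof. exact/ltW/mbeta_gt0. Qed.

Lemma mval_monomial z b : mval z b = monomial z (mcnt b).
Proof.
by apply: eq_bigr => i _; rewrite wval_cnt; apply: eq_bigr => j _; rewrite [mcnt b i]ffunE.
Qed.

Lemma sqrtr_mbeta b : Num.sqrt (mbeta b) = \prod_i Num.sqrt (bcoef (m i) (a i) (b i)).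
Proof.
rewrite /mbeta; elim/big_rec2: _ => [|i x y _ IH]; first exact: sqrtr1.
by rewrite sqrtrM ?IH // ltW // bcoef_pos.
Qed.

(** The normalized coordinates of u_z are the conjugate monomials, which depend on
the letter counts only. *)
Lemma uvecE z b : uvec m a z b = (Num.sqrt (mbeta b))%:C * (monomial z (mcnt b))^*.
Proof.
by rewrite /uvec big_split /= -conjc_prod -real_complex_prod -sqrtr_mbeta -mval_monomial mulrC.
Qed.

Lemma cnt_surj i (K : {ffun 'I_(n i) -> nat}) : exists w, cnt w = K.
Proof.
exists (flatten [seq nseq (K j) j | j <- index_enum 'I_(n i)]); apply/ffunP => l.
rewrite ffunE count_flatten -map_comp sumnE big_map (bigD1 l) //= count_nseq /= eqxx mul1n.
by rewrite big1 ?addn0 // => j /negbTE jl; rewrite count_nseq /= jl mul0n.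
Qed.

Lemma gam_gt0 i (K : {ffun 'I_(n i) -> nat}) : 0 < gam (m i) (a i) K.
Proof.
have [w wK] := cnt_surj K.
have f0 v : 0 <= (if cnt v == K then bcoef (m i) (a i) v else 0).
  by case: ifP => // _; exact/ltW/bcoef_pos.
have : has_csum (fun v => (if cnt v == K then bcoef (m i) (a i) v else 0)%:C) (gam (m i) (a i) K)%:C.
  by apply: eq_has_csum (@gam_csum R _ (m i) (a i) K) => // v; case: ifP.
move=> /(esum_has_csum f0) /= gE; have := fsum_le_esum [fset w]%fset f0.
rewrite gE big_seq_fset1 wK eqxx lee_fin; apply: lt_le_trans; exact: bcoef_pos.
Qed.

Lemma weight_gt0 K : 0 < weight m a K.
Proof. by apply: prodr_gt0 => i _; rewrite invr_gt0 gam_gt0. Qed.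

(** Lambda_K is a product of fibres, one for each group of variables, so its total
mass is the product of the gamma coefficients. *)
Lemma weight_csum K :
  has_csum (fun b => if mcnt b == K then (mbeta b)%:C else 0 : C) ((weight m a K)^-1)%:C.
Proof.
have := has_csum_mword (fun i => @gam_csum R _ (m i) (a i) (K i)).
rewrite -real_complex_prod; apply: eq_has_csum => [b|]; last first.
  by rewrite /weight prodfV invrK.
have [<-|bK] := eqVneq (mcnt b) K.
  by rewrite /mbeta real_complex_prod; apply: eq_bigr => i _; rewrite ffunE eqxx.
have /existsP[i bi] : [exists i, cnt (b i) != K i].
  apply: contraR bK; rewrite negb_exists => /forallP bi; apply/eqP/ffunP => i.
  by rewrite ffunE; apply/eqP; have := bi i; rewrite negbK.
by rewrite (bigD1 i) //= (negbTE bi) mul0r.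
Qed.

(** Fubini along the letter counts: by [weight_csum] the fibre of K has total mass
the inverse of the weight of K. *)
Lemma mcnt_csum (g : mindex n -> C) s :
  has_csum (fun b => (mbeta b)%:C * g (mcnt b)) s ->
  has_csum (fun K => g K / (weight m a K)%:C) s.
Proof.
move=> gs; apply: (has_csum_fibers (p := mcnt) gs) => K.
apply: eq_has_csum (has_csumZ (c := g K) (weight_csum (K := K))) => [b|].
  by case: eqP => [<-|_]; rewrite ?mulr0 // mulrC.
by rewrite real_complexV.
Qed.

Lemma mcnt_esum (g : mindex n -> R) : (forall K, 0 <= g K) ->
  \esum_(b in [set: mword n]) (mbeta b * g (mcnt b))%:E =
  \esum_(K in [set: mindex n]) (g K / weight m a K)%:E.
Proof.
move=> g0; rewrite (esum_fibers mcnt) => [|b]; last by rewrite mulr_ge0 ?mbeta_ge0.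
apply: eq_esum => K _; rewrite esum_mkcond.
rewrite (eq_esum (b := fun b => (if mcnt b == K then mbeta b * g K else 0)%:E)); last first.
  move=> b _; case: eqP => [<-|bK]; first by rewrite mem_set.
  by rewrite memNset.
rewrite (esum_has_csum (s := (g K / weight m a K)%:C)) // => [b|].
  by case: ifP; rewrite // mulr_ge0 ?mbeta_ge0.
have := has_csumZ (c := (g K)%:C) (weight_csum (K := K)); apply: eq_has_csum => [b|].
  by case: ifP => _; rewrite ?mulr0 // -real_complexM mulrC.
by rewrite -real_complexM.
Qed.

(** * Vectors depending on the letter counts only *)

(** The formal sum of the c_K w^K: the coordinate of w^K at a multiword b with
letter counts K is sqrt (beta_b) times the weight of K. *)
Definition symvec c : mword n -> C :=
  fun b => (Num.sqrt (mbeta b) * weight m a (mcnt b))%:C * c (mcnt b).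

Lemma symvecL (l : C) c d : symvec (l *: c + d) = l *: symvec c + symvec d.
Proof.
apply/funext => b; rewrite /symvec !fctE mulrDr; congr (_ + _).
by rewrite mulrCA.
Qed.

Lemma wbasisE K : wbasis m a K = symvec (delta K).
Proof.
apply/funext => b; rewrite /wbasis /tensor /symvec /delta.
have [<-|bK] := eqVneq (mcnt b) K.
  rewrite mulr1 mulrC real_complexM sqrtr_mbeta /weight !real_complex_prod -big_split /=.
  apply: eq_bigr => i _.
  by rewrite wvecE ffunE eqxx mulrC.
have /existsP[i bi] : [exists i, cnt (b i) != K i].
  apply: contraR bK; rewrite negb_exists => /forallP bi; apply/eqP/ffunP => i.
  by rewrite ffunE; apply/eqP; have := bi i; rewrite negbK.
by rewrite mulr0 (bigD1 i) //= wvecE (negbTE bi) mul0r.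
Qed.

Lemma symvec_sqnorm c : sqnorm2 (symvec c) = wsqnorm m a c.
Proof.
rewrite /sqnorm2 /wsqnorm.
have w0 K := weight_gt0 K.
rewrite (eq_esum (b := fun b => (mbeta b * (normc (c (mcnt b)) * weight m a (mcnt b)) ^+ 2)%:E)).
  rewrite (mcnt_esum (g := fun K => (normc (c K) * weight m a K) ^+ 2)) => [|K]; last exact: sqr_ge0.
  by apply: eq_esum => K _; congr (_%:E); field; rewrite gt_eqF.
move=> b _; congr (_%:E); rewrite /symvec Normc.normcM normc_realE ger0_norm.
  by rewrite !exprMn sqr_sqrtr ?mbeta_ge0 //; ring.
by rewrite mulr_ge0 ?sqrtr_ge0 // ltW.
Qed.

Lemma symvec_ell2 c : ell2 (symvec c) = (wsqnorm m a c < +oo)%E.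
Proof. by rewrite /ell2 /= symvec_sqnorm. Qed.

Lemma symvec_norm2 c : norm2 (symvec c) = Num.sqrt (fine (wsqnorm m a c)).
Proof. by rewrite /norm2 symvec_sqnorm. Qed.

Lemma symvec_inner c d : ell2 (symvec c) -> ell2 (symvec d) ->
  has_csum (fun K => c K * (d K)^* * (weight m a K)%:C) (inner (symvec c) (symvec d)).
Proof.
move=> coo doo; have := inner_has_csum coo doo.
pose g K : C := c K * (d K)^* * (weight m a K)%:C ^+ 2.
move=> H; have /mcnt_csum : has_csum (fun b => (mbeta b)%:C * g (mcnt b)) (inner (symvec c) (symvec d)).
  apply: eq_has_csum H => // b; rewrite /symvec /g conjcM conjc_real !real_complexM.
  rewrite -[in RHS](sqr_sqrtr (mbeta_ge0 b)) expr2 real_complexM; ring.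
apply: eq_has_csum => // K; rewrite /g; field.
by rewrite real_complex_eq0 gt_eqF // weight_gt0.
Qed.

(** * The reproducing kernel *)

Lemma kernel_csum z u : polydomain a z -> polydomain a u ->
  has_csum (fun b => (mbeta b)%:C * (mval z b * (mval u b)^*))
    ((\prod_i (1 - feval (a i) (z i) (u i)) ^+ m i)^-1).
Proof.
move=> zD uD; have := has_csum_mword (fun i =>
  (bcoef_csum (@a_ge0 i) (@a_nil i) (m_ge1 i) (zD i) (uD i)).2).
apply: eq_has_csum => [b|]; last by rewrite prodfV.
by rewrite !big_split /= -conjc_prod -real_complex_prod.
Qed.

Lemma uvec_csum z u : polydomain a z -> polydomain a u ->
  has_csum (fun b => uvec m a u b * (uvec m a z b)^*)
    ((\prod_i (1 - feval (a i) (z i) (u i)) ^+ m i)^-1).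
Proof.
move=> zD uD; apply: eq_has_csum (kernel_csum zD uD) => // b.
rewrite !uvecE !mval_monomial conjcM conjc_real conjcK -[in LHS](sqr_sqrtr (mbeta_ge0 b)).
by rewrite expr2 real_complexM; ring.
Qed.

Lemma uvec_ell2_norm2 z : polydomain a z ->
  [/\ 0 < Delta m a z, ell2 (uvec m a z) & norm2 (uvec m a z) = (Num.sqrt (Delta m a z))^-1].
Proof.
move=> zD; have D0 : 0 < Delta m a z.
  apply: prodr_gt0 => i _; apply: exprn_gt0; rewrite subr_gt0.
  by have [_ /andP[]] := fsqval_fin (@a_ge0 i) (@a_nil i) (zD i).
have /has_csum_ell2[uoo ->] : has_csum (fun b => (normc (uvec m a z b) ^+ 2)%:C) ((Delta m a z)^-1)%:C.
  apply: eq_has_csum (uvec_csum zD zD) => [b|]; first by rewrite mulc_conj.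
  rewrite real_complexV /Delta real_complex_prod; congr (_^-1); apply: eq_bigr => i _.
  by rewrite feval_diag // real_complexX real_complexB.
by split=> //; rewrite /= sqrtrV // ltW.
Qed.

Lemma uvec_ell2 z : polydomain a z -> ell2 (uvec m a z).
Proof. by case/uvec_ell2_norm2. Qed.

Lemma symvec_uvec c z : ell2 (symvec c) -> polydomain a z ->
  has_csum (fun K => c K * monomial z K) (inner (symvec c) (uvec m a z)).
Proof.
move=> coo zD; have := inner_has_csum coo (uvec_ell2 zD).
pose g K : C := c K * monomial z K * (weight m a K)%:C.
move=> H; have /mcnt_csum : has_csum (fun b => (mbeta b)%:C * g (mcnt b)) (inner (symvec c) (uvec m a z)).
  apply: eq_has_csum H => // b; rewrite uvecE /symvec /g conjcM conjc_real conjcK !real_complexM.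
  rewrite -[in RHS](sqr_sqrtr (mbeta_ge0 b)) expr2 real_complexM; ring.
apply: eq_has_csum => // K; rewrite /g mulfK //.
by rewrite real_complex_eq0 gt_eqF // weight_gt0.
Qed.

End Model.
End MultiWords.

(** * The symmetric Fock space *)

Section SymmetricVectors.
Context {R : realType} {k : nat} {n : 'I_k -> nat}.
Local Notation C := R[i].
#[local] Opaque has_csum.
Variables (m : 'I_k -> nat) (a : forall i : 'I_k, seq 'I_(n i) -> R).
Arguments a : clear implicits.
Hypothesis m_ge1 : forall i, (1 <= m i)%N.
Hypothesis a_reg : forall i, positive_regular (a i).
Implicit Types (b : mword n) (z u : @point R k n) (K : mindex n) (c d : mindex n -> C).

Let a_ge0 i w : 0 <= a i w. Proof. by case: (a_reg i). Qed.
Let a_nil i : a i [::] = 0. Proof. by case: (a_reg i). Qed.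
Let a_gt0 i j : 0 < a i [:: j]. Proof. by case: (a_reg i). Qed.

Local Notation sv := (symvec m a).
Local Notation beta := (mbeta m a).
Let mbeta_gt0 b : 0 < beta b := mbeta_gt0 m_ge1 a_reg b.
Let weight_gt0 K : 0 < weight m a K := weight_gt0 m_ge1 a_reg K.

Lemma mcnt_surj K : exists b, mcnt b = K.
Proof.
exists [ffun i => projT1 (cid (cnt_surj (K i)))]; apply/ffunP => i; rewrite !ffunE.
by case: cid.
Qed.

(** Being symmetric is expressed by linear equations between two coordinates, without
mention of coefficients: in this form it passes to limits and can be checked one
exchange of letters at a time. *)
Lemma symvecP (x : mword n -> C) :
  (forall b b', mcnt b = mcnt b' ->
     x b * (Num.sqrt (beta b'))%:C = x b' * (Num.sqrt (beta b))%:C) <->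
  exists c, x = sv c.
Proof.
have s0 b : (Num.sqrt (beta b))%:C != 0 :> C.
  by rewrite real_complex_eq0 gt_eqF // sqrtr_gt0.
split=> [xb|[c ->] b b' bb'].
  have [r rK] : exists r : mindex n -> mword n, forall K, mcnt (r K) = K.
    by exists (fun K => projT1 (cid (mcnt_surj K))) => K; case: cid.
  exists (fun K => x (r K) / (Num.sqrt (beta (r K)) * weight m a K)%:C).
  apply/funext => b; 
  have := xb b (r (mcnt b)) (esym (rK _)).
  have w0 : (weight m a (mcnt b))%:C != 0 :> C by rewrite real_complex_eq0 gt_eqF.
  move/(canRL (mulfK (s0 _))) => ->; rewrite /symvec !real_complexM.
  by field; rewrite w0 s0.
by rewrite /symvec bb' !real_complexM; ring.
Qed.

(** The equations of [symvecP] are bounded linear functionals. *)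
Lemma clspan_symvec (S : set (mword n -> C)) x : S `<=` ell2 ->
  (forall y, S y -> exists c, y = sv c) -> clspan S x -> exists c, x = sv c.
Proof.
move=> Soo Ssym xS; apply/symvecP => b b' bb'; apply/eqP; rewrite -subr_eq0; apply/eqP.
pose A b := Num.sqrt (beta b).
apply: (clspan_eq0 (phi := fun x : mword n -> C => x b * (A b')%:C - x b' * (A b)%:C)
  (M := A b' + A b) Soo _ _ _ xS) => [l y y' _ _|y yoo|y /Ssym yc].
- by rewrite !fctE /=; rewrite /GRing.scale /=; ring.
- rewrite (le_trans (le_normcD _ _)) // normcN !Normc.normcM !normc_realE !ger0_norm ?sqrtr_ge0 //.
  by rewrite mulrDl lerD // mulrC ler_wpM2l ?sqrtr_ge0 // coord_le_norm2.
- by apply/eqP; rewrite subr_eq0; apply/eqP; have /symvecP := yc; apply.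
Qed.

Lemma symvec_delta_ell2 K : ell2 (sv (delta K)).
Proof.
rewrite symvec_ell2 //; set f := fun K' => normc (delta K K' : C) ^+ 2 * weight m a K'.
have f0 K' : 0 <= f K' by rewrite mulr_ge0 ?sqr_ge0 ?ltW.
have : has_csum (fun K' => (f K')%:C) (f K)%:C.
  apply: has_csum_single => K' /negbTE K'K.
  by rewrite /f /delta K'K Normc.normc0 expr0n mul0r.
by move=> /(esum_has_csum f0); rewrite /wsqnorm => ->; exact: ltry.
Qed.

Lemma wbasis_ell2 : range (wbasis m a) `<=` ell2.
Proof. by move=> _ [K _ <-]; rewrite wbasisE //; exact: symvec_delta_ell2. Qed.

Lemma partial_sum_wbasis c (A : {fset mindex n}) :
  partial_sum (fun K => c K *: wbasis m a K) A = sv (fun K => c K *+ (K \in A)).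
Proof.
rewrite partial_sumE.
apply/funext => b; rewrite fct_sumE.
rewrite (eq_bigr (fun K => (Num.sqrt (beta b) * weight m a (mcnt b))%:C * (c K * (mcnt b == K)%:R))); last first.
  by move=> K _; rewrite fctE wbasisE // /symvec /delta /GRing.scale /=; ring.
rewrite -mulr_sumr; congr (_ * _); have [bA|bA] := boolP (mcnt b \in A).
  rewrite (bigD1_seq (mcnt b)) ?fset_uniq //= eqxx mulr1 big1 ?addr0 // => K.
  by rewrite eq_sym => /negbTE ->; rewrite mulr0.
rewrite big_seq big1 // => K KA; case: eqP => [bK|]; last by rewrite mulr0.
by rewrite bK KA in bA.
Qed.

Lemma symvecB c d : sv (c - d) = sv c - sv d.
Proof.
have := symvecL m a (-1) d c; rewrite !scaleN1r => h.
by rewrite addrC h addrC.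
Qed.

(** Removing finitely many terms of the series for the norm leaves a small tail. *)
Lemma symvec_l2sum c : ell2 (sv c) ->
  has_l2sum (fun K => c K *: wbasis m a K) (sv c).
Proof.
move=> coo; have := coo; rewrite symvec_ell2 //.
set f := fun K => normc (c K) ^+ 2 * weight m a K.
have f0 K : 0 <= f K by rewrite mulr_ge0 ?sqr_ge0 ?ltW.
rewrite /wsqnorm => foo; have fs := has_csum_esum f0 foo.
apply/cvgrPdist_lt => e e0; have e2 : 0 < e ^+ 2 by rewrite exprn_gt0.
have [A AP] := (has_csumP _ _).1 fs _ e2.
exists A => // B AB /=; rewrite sub0r normrN ger0_norm ?norm2_ge0 //.
rewrite partial_sum_wbasis -symvecB symvec_norm2 //.
set c' := _ - _; pose g K := if K \in B then 0 else f K.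
have g0 K : 0 <= g K by rewrite /g; case: ifP.
have gE : wsqnorm m a c' = \esum_(K in [set: mindex n]) (g K)%:E.
  apply: eq_esum => K _; rewrite /g /c' !fctE; case: ifP => KB.
    by rewrite subrr Normc.normc0 expr0n mul0r.
  by rewrite subr0.
have gs : has_csum (fun K => (g K)%:C) ((fine (\esum_(K in [set: mindex n]) (f K)%:E))%:C - \sum_(K <- B) (f K)%:C).
  have fB : has_csum (fun K => (if K \in B then f K else 0)%:C) (\sum_(K <- B) (f K)%:C).
    have := has_csum_finite (x := fun K => (if K \in B then f K else 0)%:C : C) (B := B).
    rewrite (_ : \sum_(K <- B) _ = \sum_(K <- B) (f K)%:C); first by apply => K /negbTE ->.
    by apply: eq_fbigr => K ->.
  have := has_csumL (c := -1) fB fs; apply: eq_has_csum => [K|].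
    by rewrite /g; case: ifP => _; rewrite mulN1r ?oppr0 ?add0r // addrC subrr.
  by rewrite mulN1r addrC.
rewrite gE (esum_has_csum g0 gs) /=.
have := AP B AB; rewrite -real_complex_sum -real_complexB normc_realE distrC -real_complexB /=.
move=> h; rewrite -ltr_sqr ?nnegrE ?sqrtr_ge0 ?(ltW e0) //.
rewrite sqr_sqrtr; first exact: le_lt_trans (ler_norm _) h.
have := esumT_ge0 g0; rewrite (esum_has_csum g0 gs) lee_fin.
by rewrite -real_complex_sum -real_complexB.
Qed.

Lemma l2sum_symvec c x : ell2 x -> has_l2sum (fun K => c K *: wbasis m a K) x ->
  x = sv c.
Proof.
move=> xoo /cvgrPdist_lt xc; apply/funext => b; apply/eqP; rewrite -subr_eq0 -normc_eq0.
rewrite eq_le normc_ge0 andbT; apply/ler_addgt0Pr => e e0; rewrite add0r.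
have [A _ AP] := xc e e0; pose B := (mcnt b |` A)%fset.
have := AP B (fsubsetU1 _ _); rewrite /= sub0r normrN ger0_norm ?norm2_ge0 // => xB.
have psoo : ell2 (partial_sum (fun K => c K *: wbasis m a K) B).
  rewrite /partial_sum; apply: ell2_sum => K; apply/ell2Z/wbasis_ell2; by exists (val K).
apply: le_trans (ltW xB); apply: le_trans (coord_le_norm2 b (ell2B xoo psoo)).
by rewrite partial_sum_wbasis !fctE /symvec fset1U1.
Qed.

Lemma Fs2P x : Fs2 m a x <-> ell2 x /\ exists c, x = sv c.
Proof.
split=> [xF|[xoo [c xc]]].
  split; first by case: xF.
  apply: clspan_symvec xF; first exact: wbasis_ell2.
  by move=> _ [K _ <-]; exists (delta K); rewrite wbasisE.
split=> // e e0; have := symvec_l2sum; rewrite xc in xoo *.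
move=> /(_ _ xoo)/cvgrPdist_lt/(_ _ e0) [A _ /(_ A (fsubset_refl _))] /=.
rewrite sub0r normrN ger0_norm ?norm2_ge0 // => cA; exists (partial_sum (fun K => c K *: wbasis m a K) A) => //.
rewrite /partial_sum; elim/big_rec: _ => [|K y _ yS].
  by exists 0%N, (fun=> 0), (fun=> 0); split=> [[]//|]; rewrite big_ord0.
by apply: spanL => //; apply: span_base; exists (val K).
Qed.

(** * The weighted shifts *)

Definition shift_coef (v b : mword n) : R := Num.sqrt (beta b / beta (mwordM v b)).

(** T is the bounded operator that maps e_b to [shift_coef v b] times e_(vb),
described on coordinates so that it applies to arbitrary families x. *)
Definition is_shift (T : (mword n -> C) -> (mword n -> C)) v :=
  forall x, [/\ forall b, T x (mwordM v b) = (shift_coef v b)%:C * x b,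
     forall b', (forall b, mwordM v b != b') -> T x b' = 0
   & ell2 x -> ell2 (T x)].

Lemma is_shift_id : is_shift id (mword1 n).
Proof.
move=> x; split=> // [b|b' bb'].
  by rewrite /shift_coef mword1M divff ?gt_eqF // sqrtr1 mul1r.
by have := bb' b'; rewrite mword1M eqxx.
Qed.

Lemma is_shift_comp T1 T2 v1 v2 : is_shift T1 v1 -> is_shift T2 v2 ->
  is_shift (T1 \o T2) (mwordM v1 v2).
Proof.
move=> S1 S2 x; have [E2 Z2 L2] := S2 x; have [E1 Z1 L1] := S1 (T2 x); split.
- move=> b; rewrite -mwordMA /= E1 E2 mulrA -real_complexM; congr (_%:C * _).
  rewrite /shift_coef -mwordMA -sqrtrM ?divr_ge0 ?ltW //; congr Num.sqrt.
  by field; rewrite !gt_eqF.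
- move=> b' bb'; have [[b'' b'E]|nob] := pselect (exists b'', mwordM v1 b'' = b').
    rewrite /= -b'E E1 Z2 ?mulr0 // => b; apply/eqP => b2.
    by have := bb' b; rewrite -mwordMA b2 b'E eqxx.
  by apply: Z1 => b; apply/eqP => bb; apply: nob; exists b.
- by move=> /L2/L1.
Qed.

Lemma mwordM_inj v : injective (mwordM v : mword n -> mword n).
Proof.
move=> b b' /ffunP bb'; apply/ffunP => i; have := bb' i; rewrite !ffunE.
by move/eqP; rewrite eqseq_cat // eqxx => /eqP.
Qed.

(** Boundedness: the ratio beta_b / beta_(jb) is at most 1 / a_j by [bcoef_cons]. *)
Lemma is_shift_Wshift i (j : 'I_(n i)) : is_shift (Wshift m a j) (mupd (mword1 n) [:: j]).
Proof.
pose v := mupd (mword1 n) [:: j].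
have vE b : mwordM v b = mupd b (j :: b i).
  apply/ffunP => l; rewrite ffunE; have [<-|il] := eqVneq i l.
    by rewrite !mupd_same.
  by rewrite !mupd_diff // ffunE.
have betaE b : beta b / beta (mwordM v b) = bcoef (m i) (a i) (b i) / bcoef (m i) (a i) (j :: b i).
  have pos i' w := bcoef_pos m_ge1 a_reg (i := i') w.
  rewrite /mbeta (bigD1 i) //= [X in _ / X](bigD1 i) //= vE mupd_same.
  set P := \prod_(l < k | _) _; set Q := \prod_(l < k | _) _.
  have -> : Q = P by apply: eq_bigr => l li; rewrite mupd_diff // eq_sym.
  have P0 : 0 < P by apply: prodr_gt0 => l _; exact: pos.
  by rewrite -mulf_div divff ?mulr1 // gt_eqF.
move=> x; have E b : Wshift m a j x (mwordM v b) = (shift_coef v b)%:C * x b.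
  by rewrite /Wshift /ampliation vE mupd_same /= eqxx mupd_mupd mupd_id /shift_coef betaE.
have Z b' : (forall b, mwordM v b != b') -> Wshift m a j x b' = 0.
  move=> bb'; rewrite /Wshift /ampliation /wshift; case E' : (b' i) => [//|j' w].
  case: eqP => // jj'; have /eqP[] := bb' (mupd b' w).
  by rewrite vE mupd_same mupd_mupd -jj' -E' mupd_id.
split=> // xoo.
have Too : abs_summable (fun b => (normc (Wshift m a j x (mwordM v b)) ^+ 2)%:C : C).
  apply: (abs_summable_le (f := fun b => (a i [:: j])^-1 * normc (x b) ^+ 2)) => [b|].
    rewrite normc_realE ger0_norm ?sqr_ge0 // E Normc.normcM normc_realE exprMn.
    rewrite ler_wpM2r ?sqr_ge0 // ger0_norm ?sqrtr_ge0 // sqr_sqrtr.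
      rewrite betaE ler_pdivrMr ?(bcoef_pos m_ge1 a_reg) // ler_pdivlMl //.
      exact: bcoef_cons.
    by rewrite divr_ge0 // ltW.
  rewrite esumTZ ?invr_ge0 ?ltW // => [|b]; last exact: sqr_ge0.
  by rewrite -/(sqnorm2 x) sqnorm2E // -EFinM ltry.
have [s Ts] := abs_summable_has_csum Too.
have {}Ts : has_csum (fun b => (normc (Wshift m a j x b) ^+ 2)%:C) s.
  apply: (has_csum_inj (@mwordM_inj v)) => [b' /Z ->|]; last exact: Ts.
  by rewrite Normc.normc0 expr0n.
by have [] := has_csum_ell2 Ts.
Qed.

Lemma is_shift_Wmono v : is_shift (Wmono m a v) v.
Proof.
have wordP i (w : seq 'I_(n i)) : is_shift (fun y => foldr (Wshift m a (i := i)) y w) (mupd (mword1 n) w).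
  elim: w => [|j w IH].
    have -> : mupd (mword1 n) ([::] : seq 'I_(n i)) = mword1 n.
      apply/ffunP => l; have [<-|il] := eqVneq i l; first by rewrite mupd_same ffunE.
      by rewrite mupd_diff.
    exact: is_shift_id.
  have -> : mupd (mword1 n) (j :: w) = mwordM (mupd (mword1 n) [:: j]) (mupd (mword1 n) w).
    apply/ffunP => l; rewrite [RHS]ffunE; have [<-|il] := eqVneq i l; first by rewrite !mupd_same.
    by rewrite !mupd_diff // ffunE.
  exact: is_shift_comp (is_shift_Wshift j) IH.
pose vr (r : seq 'I_k) : mword n := [ffun i => if i \in r then v i else [::]].
suff vrP r : uniq r -> is_shift (fun x => foldr (fun (i : 'I_k) y => foldr (Wshift m a (i := i)) y (v i)) x r) (vr r).
  have := vrP _ (enum_uniq 'I_k); rewrite (_ : vr _ = v) //.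
  by apply/ffunP => i; rewrite ffunE mem_enum.
elim: r => [_|i r IH /= /andP[ir /IH {}IH]].
  have -> : vr [::] = mword1 n by apply/ffunP => i; rewrite !ffunE.
  exact: is_shift_id.
have -> : vr (i :: r) = mwordM (mupd (mword1 n) (v i)) (vr r).
  apply/ffunP => l; rewrite [RHS]ffunE [LHS]ffunE [vr r l]ffunE in_cons.
  have [->|li] := eqVneq l i; first by rewrite (negbTE ir) mupd_same cats0.
  by rewrite mupd_diff 1?eq_sym // ffunE.
exact: is_shift_comp (wordP i (v i)) IH.
Qed.

Lemma mcnt_mwordM v b b' v' : mcnt v = mcnt v' -> mcnt b = mcnt b' ->
  mcnt (mwordM v b) = mcnt (mwordM v' b').
Proof.
move=> /ffunP vv' /ffunP bb'; apply/ffunP => i; rewrite !ffunE.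
have := vv' i; have := bb' i; rewrite !ffunE => bi vi.
by apply/ffunP => j; rewrite !cnt_cat bi vi.
Qed.

Lemma inner_Wmono v c y : ell2 y -> ell2 (sv c) ->
  has_csum (fun b => y b * ((Num.sqrt (beta b))%:C *
      ((weight m a (mcnt (mwordM v b)))%:C * c (mcnt (mwordM v b)))^*))
    (inner (Wmono m a v y) (sv c)).
Proof.
move=> yoo coo; have [E Z /(_ yoo) Woo] := is_shift_Wmono v y.
have /(has_csum_inj_inv (@mwordM_inj v)) H := inner_has_csum Woo coo.
apply: eq_has_csum (H _) => // [b|b' /Z -> //]; last by rewrite mul0r.
have sE : shift_coef v b * Num.sqrt (beta (mwordM v b)) = Num.sqrt (beta b).
  by rewrite /shift_coef -sqrtrM ?divr_ge0 ?ltW // divfK // gt_eqF.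
by rewrite /= E /symvec -sE !real_complexM !conjcM !conjc_real; ring.
Qed.

(** The adjoint of a monomial in the shifts acts on a symmetric vector through
the letter counts of the monomial only. *)
Lemma inner_Wmono_cnt v v' c y : mcnt v = mcnt v' -> ell2 y -> ell2 (sv c) ->
  inner (Wmono m a v y) (sv c) = inner (Wmono m a v' y) (sv c).
Proof.
move=> vv' yoo coo; apply: has_csum_unique (inner_Wmono (v := v) yoo coo) _.
apply: eq_has_csum (inner_Wmono (v := v') yoo coo) => // b.
by rewrite (mcnt_mwordM vv' (erefl (mcnt b))).
Qed.

Lemma Wmono_delta v b :
  Wmono m a v (delta b) = (shift_coef v b)%:C *: delta (mwordM v b).
Proof.
have [E Z _] := is_shift_Wmono v (delta b); apply/funext => b'.
have [[b'' <-]|nob] := pselect (exists b'', mwordM v b'' = b').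
  rewrite E fctE /delta (inj_eq (@mwordM_inj v)) /GRing.scale /=.
  by case: eqP => [->|] //; rewrite !mulr0.
have vb' b'' : mwordM v b'' != b' by apply/eqP => vb; apply: nob; exists b''.
by rewrite Z // fctE /delta eq_sym (negbTE (vb' b)) scaler0.
Qed.

(** * Polynomials in the shifts *)

Lemma polyWw (g : ncpoly n) (D : {fset mword n}) y : (msupp g `<=` D)%fset ->
  polyW m a g y = \sum_(b <- D) mcoeff b g *: Wmono m a b y.
Proof.
move=> gD; rewrite /polyW; apply: (big_fset_incl _ gD) => b _ /mcoeff_outdom ->.
by rewrite scale0r.
Qed.

Lemma polyWD (g h : ncpoly n) y : polyW m a (g + h) y = polyW m a g y + polyW m a h y.
Proof.
rewrite (polyWw _ (msuppD_le g h)) (polyWw _ (fsubsetUl (msupp g) (msupp h))).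
rewrite (polyWw _ (fsubsetUr (msupp g) (msupp h))) -big_split /=.
by apply: eq_bigr => b _; rewrite mcoeffD scalerDl.
Qed.

Lemma polyW0 y : polyW m a (0 : ncpoly n) y = 0.
Proof. by rewrite /polyW msupp0 big_seq_fset0. Qed.

Lemma polyW_sum (J : Type) (r : seq J) (g : J -> ncpoly n) y :
  polyW m a (\sum_(j <- r) g j) y = \sum_(j <- r) polyW m a (g j) y.
Proof.
elim: r => [|j r IH]; first by rewrite !big_nil polyW0.
by rewrite !big_cons polyWD IH.
Qed.

Lemma polyW_U v (l : C) y : polyW m a (mkmalgU v l : ncpoly n) y = l *: Wmono m a v y.
Proof. by rewrite (polyWw _ msuppU_le) big_seq_fset1 mcoeffUU. Qed.

Lemma polyW_ell2 (g : ncpoly n) y : ell2 y -> ell2 (polyW m a g y).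
Proof.
by move=> yoo; apply: ell2_sum => b; apply: ell2Z; have [_ _] := is_shift_Wmono b y; apply.
Qed.

Definition comm_words v i (j1 j2 : 'I_(n i)) : mword n :=
  mwordM v (mwordM (mupd (mword1 n) [:: j1]) (mupd (mword1 n) [:: j2])).

(** Up to linear combinations, the generators of the commutator ideal are the
differences of two words that differ by the exchange of two adjacent letters. *)
Lemma polyW_commutator v (l : C) i (j1 j2 : 'I_(n i)) y :
  polyW m a (mkmalgU v l * (Zvar (R := R) j1 * Zvar (R := R) j2 - Zvar (R := R) j2 * Zvar (R := R) j1) : ncpoly n) y =
  l *: Wmono m a (comm_words v j1 j2) y - l *: Wmono m a (comm_words v j2 j1) y.
Proof.
have UU (v1 v2 : mword n) (l1 l2 : C) :
    (mkmalgU v1 l1 * mkmalgU v2 l2 : ncpoly n) = mkmalgU (mwordM v1 v2) (l1 * l2).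
  by rewrite [LHS]malgM_def fgmulUU.
rewrite /Zvar mulrBr !UU !mulr1 polyWD -monalgUN !polyW_U scaleNr //.
Qed.

Lemma polyW_Qc_orthogonal (g : ncpoly n) c y : Qc g -> ell2 y -> ell2 (sv c) ->
  inner (polyW m a g y) (sv c) = 0.
Proof.
move=> [N [p [s [sP ->]]]] yoo coo.
rewrite polyW_sum inner_sum //; last by move=> l; exact: polyW_ell2.
apply: big1 => l _; have [i [j1 [j2 ->]]] := sP l.
rewrite (monalgE (p l)) mulr_suml polyW_sum inner_sum //; last by move=> b; exact: polyW_ell2.
apply: big1 => b _; rewrite polyW_commutator -scalerBr -scaleN1r.
have Woo v : ell2 (Wmono m a v y) by have [_ _] := is_shift_Wmono v y; apply.
rewrite innerZ //; last by rewrite addrC; exact: ell2L.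
rewrite addrC innerL // (@inner_Wmono_cnt _ (comm_words b j1 j2)) //; first by rewrite mulN1r addNr mulr0.
apply/ffunP => i'; rewrite [LHS]ffunE [RHS]ffunE; apply/ffunP => j.
by rewrite /comm_words !mwordM_coord !cnt_cat [X in (_ + X)%N]addnC.
Qed.

(** * Vectors orthogonal to the commutator ideal *)

(** Exchanges of adjacent letters generate all rearrangements of a word. *)
Lemma perm_invariant (T : eqType) (A : Type) (G : seq T -> A) :
  (forall s x y t, G (s ++ x :: y :: t) = G (s ++ y :: x :: t)) ->
  forall s t, perm_eq s t -> G s = G t.
Proof.
move=> Gswap; have Gmove r s x t : G (r ++ x :: s ++ t) = G (r ++ s ++ x :: t).
  elim: s r => [//|y s IH] r /=.
  by rewrite Gswap -cat_rcons IH cat_rcons.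
suff Gperm r s t : perm_eq s t -> G (r ++ s) = G (r ++ t) by exact: (Gperm [::]).
elim: s r t => [|x s IH] r t st.
  by have /perm_nilP -> // : perm_eq t [::]; rewrite perm_sym.
have xt : x \in t by rewrite -(perm_mem st) mem_head.
case/splitPr: xt st => t1 t2; rewrite perm_sym (perm_catCA t1 [:: x] t2) /= perm_cons perm_sym => st.
by rewrite -cat_rcons (IH (rcons r x) (t1 ++ t2)) // cat_rcons Gmove.
Qed.

(** Rearrange the components of the multiword one after the other. *)
Lemma mword_invariant (A : Type) (G : mword n -> A) :
  (forall b i s (x y : 'I_(n i)) t, G (mupd b (s ++ x :: y :: t)) = G (mupd b (s ++ y :: x :: t))) ->
  forall b b', mcnt b = mcnt b' -> G b = G b'.
Proof.
move=> Gswap b b' bb'; pose br (r : seq 'I_k) : mword n := [ffun i => if i \in r then b' i else b i].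
suff GE r : G (br r) = G b.
  have <- : br (enum 'I_k) = b' by apply/ffunP => i; rewrite ffunE mem_enum.
  by rewrite GE.
elim: r => [|i r IH].
  by congr G; apply/ffunP => i; rewrite ffunE.
rewrite -IH; have -> : br (i :: r) = mupd (br r) (b' i).
  apply/ffunP => l; rewrite [LHS]ffunE in_cons; have [->|li] := eqVneq l i; first by rewrite mupd_same.
  by rewrite mupd_diff 1?eq_sym // ffunE.
rewrite -[in RHS](mupd_id (br r) i).
apply: (@perm_invariant _ _ (fun w : seq 'I_(n i) => G (mupd (br r) w))) => [s x y t|]; first exact: Gswap.
apply: cnt_perm; rewrite [br r i]ffunE; case: ifP => // _.
by move/ffunP: bb' => /(_ i); rewrite !ffunE.
Qed.

Let MQc_gen : set (mword n -> C) := [set y | exists (g : ncpoly n) (x : mword n -> C),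
    [/\ Qc g, ell2 x & y = polyW m a g x]].

Lemma MQc_gen_ell2 : MQc_gen `<=` ell2.
Proof. by move=> _ [g [x [_ xoo ->]]]; exact: polyW_ell2. Qed.

(** If x is orthogonal to the ideal, testing against the images of basis vectors
under commutators shows that x_b / sqrt (beta_b) is unchanged when two adjacent
letters of b are exchanged. The converse is [inner_Wmono_cnt]. *)
Lemma NQcP x : NQc m a x <-> ell2 x /\ exists c, x = sv c.
Proof.
split=> [[xoo xM]|[xoo [c xc]]]; last first.
  split=> // y [yoo yM]; rewrite (inner_conj yoo) // (_ : inner y x = 0) ?conjc0 //.
  apply: (clspan_eq0 (phi := fun y => inner y x) (M := norm2 x) MQc_gen_ell2 _ _ _ (conj yoo yM)).
  - by move=> l u v uoo voo; rewrite innerL.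
  - by move=> u uoo; rewrite mulrC Cauchy_Schwarz.
  - by move=> _ [g [u [gQ uoo ->]]]; rewrite xc in xoo *; exact: polyW_Qc_orthogonal.
split=> //; apply/symvecP.
pose G b := x b / (Num.sqrt (beta b))%:C.
have s0 b : (Num.sqrt (beta b))%:C != 0 :> C.
  by rewrite real_complex_eq0 gt_eqF // sqrtr_gt0.
suff Gcnt : forall b b', mcnt b = mcnt b' -> G b = G b'.
  move=> b b' /Gcnt; rewrite /G => GG.
  by apply: (mulIf (s0 b)); rewrite -[x b](divfK (s0 b)) GG; field; rewrite s0.
apply: mword_invariant => b i s j1 j2 t.
pose v := mupd b s; pose d := mupd (mword1 n) t.
have cE l1 l2 : mwordM (comm_words v l1 l2) d = mupd b (s ++ l1 :: l2 :: t).
  apply/ffunP => l; rewrite /comm_words !mwordM_coord; have [<-|il] := eqVneq i l.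
    by rewrite /v /d !mupd_same -!catA.
  by rewrite /v /d !mupd_diff // !mword1_coord !cats0.
pose g : ncpoly n := mkmalgU v 1 * (Zvar (R := R) j1 * Zvar (R := R) j2 - Zvar (R := R) j2 * Zvar (R := R) j1).
have : MQc m a (polyW m a g (delta d)).
  apply: clspan_base; first exact: MQc_gen_ell2.
  exists g, (delta d); split=> //; last exact: ell2_delta.
  exists 1%N, (fun=> mkmalgU v 1), (fun=> Zvar (R := R) j1 * Zvar (R := R) j2 - Zvar (R := R) j2 * Zvar (R := R) j1).
  by split=> [_|]; [exists i, j1, j2 | rewrite big_ord1].
move=> /xM; rewrite /g polyW_commutator !Wmono_delta !scale1r.
have inner_delta b' (r : R) : inner x (r%:C *: delta b') = r%:C * x b'.
  rewrite (inner_conj (ell2Z _ (ell2_delta _))) // innerZ //; last exact: ell2_delta.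
  rewrite conjcM conjc_real -inner_conj //; last exact: ell2_delta.
  congr (_ * _); apply: innerE.
  have := has_csum_single (x := fun b => x b * (delta b' b : C)^*) (i0 := b').
  have -> : delta b' b' = 1 :> C by rewrite /delta eqxx.
  rewrite conjc1 mulr1; apply => b'' /negbTE bb.
  by rewrite /delta bb conjc0 mulr0.
have sdoo (r : R) b' : ell2 (r%:C *: delta b' : mword n -> C) by exact/ell2Z/ell2_delta.
have sE l1 l2 : (shift_coef (comm_words v l1 l2) d)%:C * x (mwordM (comm_words v l1 l2) d) =
    (Num.sqrt (beta d))%:C * G (mwordM (comm_words v l1 l2) d).
  rewrite /shift_coef sqrtrM ?ltW // sqrtrV ?ltW // real_complexM real_complexV /G.
  by rewrite -!mulrA [_^-1 * _]mulrC.
rewrite -scaleN1r innerDr //; last exact: ell2Z.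
rewrite scalerA mulN1r -real_complexN !inner_delta real_complexN mulNr.
move/eqP; rewrite subr_eq0 !sE => /eqP /(mulfI (s0 d)).
by rewrite !cE.
Qed.

End SymmetricVectors.

(** * Growth of the coefficients and small polydiscs *)

Section Growth.
Context {R : realType} {n : nat}.
Local Notation C := R[i].
#[local] Opaque has_csum.
Implicit Types (a : seq 'I_n -> R) (w : seq 'I_n) (z : 'I_n -> C).

(** A bound on the limsup controls all long words; the finitely many short ones are
absorbed by enlarging the base of the exponential. *)
Lemma positive_regular_growth a : positive_regular a ->
  exists2 M, 1 <= M & forall w, a w <= M ^+ size w.
Proof.
move=> [a_ge0 a_nil _]; rewrite /limn_esup limf_esupE => /ereal_inf_lt [s [V [N _ NV] <-]].
set u := fun p : nat => _ => uoo.
have uV p : (N <= p)%N -> (u p <= ereal_sup [set u x | x in V])%E.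
  by move=> Np; apply: ereal_sup_ubound; exists p => //; exact: NV.
have u0 p : (0 <= u p)%E by rewrite lee_fin powR_ge0.
have s0 := le_trans (u0 N) (uV N (leqnn N)).
set B := fine (ereal_sup [set u x | x in V]).
have sE : ereal_sup [set u x | x in V] = B%:E by rewrite /B fineK // ge0_fin_numE.
have B0 : 0 <= B by rewrite -lee_fin -sE.
have aB w : (N <= size w)%N -> (0 < size w)%N -> a w <= B ^+ size w.
  move=> Nw w0; have := uV _ Nw; rewrite sE lee_fin.
  set x := \sum_(_ | _) _; have x0 : 0 <= x by apply: sumr_ge0 => v _; exact: sqr_ge0.
  move=> xB; have xE : x = (x `^ (2 * size w)%:R^-1) ^+ (2 * size w).
    rewrite -powR_mulrn ?powR_ge0 // -powRrM mulVf ?powRr1 // pnatr_eq0.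
    by rewrite muln_eq0 negb_or /= -lt0n.
  rewrite -ler_sqr ?nnegrE ?exprn_ge0 // -exprM mulnC.
  apply: (@le_trans _ _ x); last by rewrite xE lerXn2r ?nnegrE ?powR_ge0.
  rewrite /x (bigD1 (in_tuple w)) //= ger0_norm // lerDl.
  by apply: sumr_ge0 => v _; exact: sqr_ge0.
pose S := \sum_(p < N) \sum_(w : p.-tuple 'I_n) a w.
have S0 : 0 <= S by apply: sumr_ge0 => p _; apply: sumr_ge0.
exists (1 + B + S) => [|w]; first by rewrite -addrA lerDl addr_ge0.
have M1 : 1 <= 1 + B + S by rewrite -addrA lerDl addr_ge0.
case: w => [|j w']; first by rewrite a_nil expr0.
set w := j :: w'; have [Nw|wN] := leqP N (size w).
  apply: le_trans (aB w Nw isT) _; rewrite lerXn2r ?nnegrE //.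
    by rewrite (le_trans _ M1).
  by rewrite addrAC lerDr addr_ge0.
apply: (@le_trans _ _ (1 + B + S)); last by rewrite ler_eXnr.
apply: (@le_trans _ _ S); last by rewrite lerDr addr_ge0.
rewrite /S (bigD1 (Ordinal wN)) //= (bigD1 (in_tuple w)) //= -addrA lerDl.
by rewrite addr_ge0 ?sumr_ge0 // => p _; apply: sumr_ge0.
Qed.

(** The number of words of length p is n^p. This is [bco_csum] with m = 1 for
f = Z_1 + ... + Z_n, where every word has exactly one factorization. *)
Lemma words_csum (t : R) : 0 <= t -> n%:R * t < 1 ->
  has_csum (fun w => (t ^+ size w)%:C : C) ((1 - n%:R * t)^-1)%:C.
Proof.
move=> t0 nt1; pose a1 w : R := (size w == 1)%:R.
have a1_ge0 w : 0 <= a1 w by exact: ler0n.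
have bco1 w : bco a1 1 w = 1.
  elim: w => [|j w IH]; first exact: bcoS_nil.
  rewrite bco_rec // bco0 /= add0r (bigD1 (Ordinal (isT : (1 < (size (j :: w)).+1)%N))) //=.
  rewrite take0 drop0 IH mulr1 big1 ?addr0 // => l l1.
  rewrite /a1 size_takel -1?ltnS //; case: eqP => [lE|]; last by rewrite mul0r.
  by case/eqP: l1; apply: val_inj.
have tM v w : t ^+ size (v ++ w) = t ^+ size v * t ^+ size w by rewrite size_cat exprD.
have a1t : has_csum (fun w => (a1 w)%:C * (t ^+ size w)%:C : C) (n%:R * t)%:C.
  apply: (has_csum_inj (p := fun j : 'I_n => [:: j])) => [i j []//|w wj|].
    rewrite /a1; case: w wj => [|j [|j' w]] wj; rewrite ?mul0r //.
    by have := wj j; rewrite eqxx.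
  apply: eq_has_csum (has_csum_finType (x := fun j : 'I_n => t%:C)) => [j|].
    by rewrite /= expr1 /a1 mul1r.
  by rewrite sumr_const card_ord mulr_natl real_complexMn.
have a1te : \esum_(w in [set: seq 'I_n]) (a1 w * t ^+ size w)%:E = (n%:R * t)%:E.
  rewrite (esum_has_csum (s := (n%:R * t)%:C)) // => [w|].
    by rewrite mulr_ge0 ?exprn_ge0.
  by apply: eq_has_csum a1t => // w; rewrite real_complexM.
have boo m : abs_summable (fun w => (bco a1 m w)%:C * (t ^+ size w)%:C : C).
  have := @bco_esum_lt _ _ a1 a1_ge0 erefl (fun w => t ^+ size w) (n%:R * t) m
    (fun w => exprn_ge0 _ t0) erefl tM a1te nt1.
  rewrite -(@abs_summable_posE R) => [|w]; last by rewrite mulr_ge0 ?exprn_ge0 ?bco_ge0.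
  by congr abs_summable; apply/funext => w; rewrite real_complexM.
have [||s ts s1] := @bco_csum _ _ a1 erefl (fun w => (t ^+ size w)%:C) (n%:R * t)%:C 1 _ _ a1t boo.
- by [].
- by move=> v w; rewrite tM real_complexM.
have nt0 : 1 - (n%:R * t) != 0 by rewrite subr_eq0 gt_eqF.
have sE : s = ((1 - n%:R * t)^-1)%:C.
  have c0 : (1 - n%:R * t)%:C != 0 :> C by rewrite real_complex_eq0.
  by apply: (mulIf c0); rewrite -real_complexM mulVf //; move: s1; rewrite expr1 real_complexB.
by apply: eq_has_csum ts => // w; rewrite bco1 mul1r.
Qed.

Lemma normc_wval z (r : R) w : (forall j, normc (z j) = r) ->
  normc (wval z w) = r ^+ size w.
Proof.
move=> zr; rewrite /wval normc_prod; elim: w => [|j w IH]; first by rewrite big_nil.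
by rewrite big_cons IH zr exprS.
Qed.

(** If M r^2 <= 1 / (4 n), comparison with words bounds f(|z|^2) by
1 / (1 - 1/4) - 1 = 1/3. *)
Lemma fsqval_lt1 a (M r : R) z : positive_regular a -> 1 <= M ->
  (forall w, a w <= M ^+ size w) -> n%:R * (M * r ^+ 2) <= 4^-1 ->
  (forall j, normc (z j) = r) -> (fsqval a z < 1)%E.
Proof.
move=> [a_ge0 a_nil _ _] M1 aM; set t := M * r ^+ 2 => nt zr.
have t0 : 0 <= t by rewrite mulr_ge0 ?sqr_ge0 // (le_trans ler01).
have nt1 : n%:R * t < 1 by apply: le_lt_trans nt _; lra.
have nt0 : 0 <= n%:R * t by rewrite mulr_ge0.
pose g w : R := t ^+ size w - (w == [::])%:R.
have g0 w : 0 <= g w.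
  by rewrite /g; case: w => [|j w]; rewrite ?subrr // subr0 exprn_ge0.
have gs : has_csum (fun w => (g w)%:C : C) ((1 - n%:R * t)^-1 - 1)%:C.
  have := has_csum_single (x := fun w => (w == [::])%:R%:C : C) (i0 := [::]).
  rewrite eqxx => /(_ _)/(has_csumL (c := -1)) H.
  apply: eq_has_csum (H _ _ _ (words_csum t0 nt1)) => [w||w /negbTE -> //].
    by rewrite /g real_complexB mulN1r addrC.
  by rewrite real_complexB mulN1r addrC.
rewrite fsqvalE //; apply: (@le_lt_trans _ _ (\esum_(w in [set: seq 'I_n]) (g w)%:E)).
  apply: le_esumT => w; rewrite (normc_wval _ zr) /g.
  case: w => [|j w]; first by rewrite a_nil mul0r subrr.
  by rewrite subr0 /t exprMn [in leLHS]exprAC ler_wpM2r // exprn_ge0 ?sqr_ge0.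
rewrite (esum_has_csum g0 gs) lte_fin /=.
have bound (q : R) : q <= 4^-1 -> (1 - q)^-1 - 1 < 1.
  move=> q4; have q1 : 0 < 1 - q by lra.
  by rewrite ltrBlDr -(ltr_pM2r q1) mulVf ?gt_eqF //; lra.
exact: bound.
Qed.

End Growth.

(** * Averaging over roots of unity *)

Section RootsOfUnity.
Context {R : realType}.
Local Notation C := R[i].

Lemma prim_root_exists N : (0 < N)%N -> exists w : C, N.-primitive_root w.
Proof.
pose p : {poly C} := 'X^N - 1; have [r Dp] := closed_field_poly_normal p.
move=> N0; rewrite (monicP _) ?monicXnsubC // scale1r in Dp.
have rn1 : all N.-unity_root r by apply/allP=> z; rewrite -root_prod_XsubC -Dp.
have sz_r : (N < (size r).+1)%N.
  by rewrite -(size_prod_XsubC r id) -Dp size_XnsubC.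
have [|z] := hasP (has_prim_root N0 rn1 _ sz_r); last by exists z.
by rewrite -separable_prod_XsubC -Dp separable_Xn_sub_1 // pnatr_eq0 -lt0n.
Qed.

Lemma normc_prim_root N (w : C) : N.-primitive_root w -> normc w = 1.
Proof.
move=> wN; have N0 := prim_order_gt0 wN; apply/eqP.
rewrite -(pexpr_eq1 N0) ?normc_ge0 //; apply/eqP.
have := congr1 (@Normc.normc R) (prim_expr_order wN); rewrite Normc.normc1 => <-.
elim: (N) => [|M IH]; first by rewrite !expr0 Normc.normc1.
by rewrite !exprS Normc.normcM IH.
Qed.

Lemma root_orthogonality N (w : C) (x y : nat) : N.-primitive_root w ->
  \sum_(s < N) N%:R^-1 * (w ^+ (s * x) / w ^+ (s * y)) = (x == y %[mod N])%:R.
Proof.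
move=> wN; have N0 := prim_order_gt0 wN.
have w0 : w != 0 by rewrite -normc_eq0 (normc_prim_root wN) oner_eq0.
have NC : N%:R != 0 :> C by rewrite pnatr_eq0 -lt0n.
pose q := w ^+ x / w ^+ y.
rewrite -mulr_sumr (eq_bigr (fun s : 'I_N => q ^+ s)) => [|s _]; last first.
  by rewrite /q exprMn exprVn -!exprM mulnC [(s * y)%N]mulnC.
have qE : (q == 1) = (x == y %[mod N]).
  rewrite -(eq_prim_root_expr wN) /q; apply/eqP/eqP => [|->]; last by rewrite divff ?expf_neq0.
  by move/(canRL (divfK _)) => ->; rewrite ?mul1r ?expf_neq0.
rewrite -qE; case: eqP => [->|/eqP q1].
  by rewrite (eq_bigr (fun=> 1)) => [|s _]; rewrite ?expr1n // sumr_const card_ord mulVf.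
have : (q - 1) * \sum_(s < N) q ^+ s = 0.
  rewrite -subrX1 /q exprMn exprVn -!exprM ![(_ * N)%N]mulnC !exprM (prim_expr_order wN) !expr1n.
  by rewrite invr1 mulr1 subrr.
by move/eqP; rewrite mulf_eq0 subr_eq0 (negbTE q1) /= => /eqP ->; rewrite mulr0.
Qed.

End RootsOfUnity.

(** The finite set is one that carries the sum of f up to e; it depends on f only, so
that it can be chosen before the order of the roots of unity. *)
Lemma esum_tail (R : realType) (I : choiceType) (f : I -> R) (e : R) :
  (forall i, 0 <= f i) -> (\esum_(i in [set: I]) (f i)%:E < +oo)%E -> 0 < e ->
  exists A : {fset I}, forall g : I -> R, (forall i, 0 <= g i <= f i) ->
    (forall i, i \in A -> g i = 0) -> (\esum_(i in [set: I]) (g i)%:E <= e%:E)%E.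
Proof.
move=> f0 foo e0; have [A AP] := (has_csumP _ _).1 (has_csum_esum f0 foo) e e0.
exists A => g gf gA; apply: esum_le_fsum => B; rewrite lee_fin.
apply: (@le_trans _ _ (\sum_(i <- (A `|` B)%fset) f i - \sum_(i <- A) f i)).
  rewrite lerBrDr [leRHS](big_fsetID _ (mem A)) /= [leRHS]addrC; apply: lerD; last first.
    by apply: fsum_subset => //; apply/fsubsetP => i iA; rewrite !inE iA.
  rewrite (big_fsetID _ (mem A) B) /= big1_seq ?add0r => [|i]; last first.
    by rewrite !inE => /andP[_ /andP[_ /gA]].
  apply: (@le_trans _ _ (\sum_(i <- [fset i in B | i \notin A]%fset) f i)).
    by apply: ler_sum => i _; case/andP: (gf i).
  apply: fsum_subset => //; apply/fsubsetP => i; rewrite !inE => /andP[-> ->].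
  by rewrite orbT.
have sAB := fsum_le_fine (A `|` B)%fset f0 foo.
have := AP A (fsubset_refl _); rewrite -real_complex_sum -real_complexB normc_realE.
rewrite distrC; move: sAB; set s := fine _; set u := \sum_(i <- A) _ => sAB us.
by have := ler_norm (s - u); lra.
Qed.

Section Analytic.
Context {R : realType} {k : nat} {n : 'I_k -> nat}.
Local Notation C := R[i].
#[local] Opaque has_csum.
Implicit Types (b : mword n) (z u : @point R k n) (K : mindex n) (c d : mindex n -> C).

Definition rpow (r : R) K : R := \prod_i \prod_j r ^+ K i j.

Definition congr_mod N K K' : bool := [forall i, forall j, K' i j == K i j %[mod N]].

Definition deg K : nat := (\sum_i \sum_j K i j)%N.

Lemma rpow_ge0 r K : 0 <= r -> 0 <= rpow r K.
Proof. by move=> r0; apply: prodr_ge0 => i _; apply: prodr_ge0 => j _; exact: exprn_ge0. Qed.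

Lemma rpow_gt0 r K : 0 < r -> 0 < rpow r K.
Proof. by move=> r0; apply: prodr_gt0 => i _; apply: prodr_gt0 => j _; exact: exprn_gt0. Qed.

Lemma leq_deg K i j : (K i j <= deg K)%N.
Proof. by rewrite /deg (bigD1 i) //= (bigD1 j) //= -addnA leq_addr. Qed.

Lemma congr_mod_small N K K' : (deg K < N)%N -> (deg K' < N)%N -> congr_mod N K K' -> K' = K.
Proof.
move=> KN K'N /forallP KK'; apply/ffunP => i; apply/ffunP => j.
have /forallP/(_ j)/eqP := KK' i.
by rewrite !modn_small // (leq_ltn_trans (leq_deg _ _)).
Qed.

Lemma congr_mod_refl N K : congr_mod N K K.
Proof. by apply/forallP => i; apply/forallP => j. Qed.

Lemma normc_monomial r z K : (forall i j, normc (z i j) = r) -> normc (monomial z K) = rpow r K.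
Proof.
move=> zr; rewrite /monomial normc_prod; apply: eq_bigr => i _.
rewrite normc_prod; apply: eq_bigr => j _; rewrite -(zr i j).
elim: (K i j) => [|N IH]; first by rewrite !expr0 Normc.normc1.
by rewrite !exprS Normc.normcM IH.
Qed.

(** The points are r w^t, with w a primitive N-th root of unity and t a family of
residues modulo N, one for each variable; the weights are the values of the character
of K. The sum over t is a product over the variables, and in each of them the
characters are orthogonal. *)
Lemma torus_average N (r : R) K : (0 < N)%N -> 0 <= r ->
  exists (J : finType) (z : J -> @point R k n) (e : J -> C),
    (forall t i j, normc (z t i j) = r) /\
    forall K', \sum_t e t * monomial (z t) K' = (rpow r K')%:C * (congr_mod N K K')%:R.
Proof.
move=> N0 r0; have [w wN] := @prim_root_exists R N N0.
pose T := {i : 'I_k & 'I_(n i)}.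
pose z (t : {ffun T -> 'I_N}) : @point R k n := fun i j => r%:C * w ^+ t (Tagged _ j).
pose e (t : {ffun T -> 'I_N}) : C := \prod_(p : T) (N%:R^-1 / w ^+ (t p * K (tag p) (tagged p))).
exists {ffun T -> 'I_N}, z, e; split=> [t i j|K'].
  rewrite Normc.normcM normc_realE ger0_norm // [X in _ * X](_ : _ = 1) ?mulr1 //.
  elim: (nat_of_ord _) => [|M IH]; first by rewrite expr0 Normc.normc1.
  by rewrite exprS Normc.normcM IH (normc_prim_root wN) mulr1.
pose F (p : T) (s : 'I_N) : C := (r ^+ K' (tag p) (tagged p))%:C *
  (N%:R^-1 * (w ^+ (s * K' (tag p) (tagged p)) / w ^+ (s * K (tag p) (tagged p)))).
rewrite (eq_bigr (fun t : {ffun T -> 'I_N} => \prod_p F p (t p))); last first.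
  move=> t _; rewrite /monomial (sig_big_dep xpredT (fun _ => xpredT)) /= -big_split /=.
  apply: eq_bigr => -[i j] _; rewrite /F /z /=.
  by rewrite exprMn -exprM real_complexX; ring.
rewrite -bigA_distr_bigA /=.
under eq_bigr do rewrite -mulr_sumr (root_orthogonality _ _ wN).
rewrite big_split /=; congr (_ * _).
  by rewrite -real_complex_prod /rpow (sig_big_dep xpredT (fun _ => xpredT)).
have [KK'|KK'] := boolP (congr_mod N K K').
  rewrite big1 // => p _; move/forallP/(_ (tag p))/forallP/(_ (tagged p)): KK'.
  by move=> ->.
have /existsP[p pK] : [exists p : T, ~~ (K' (tag p) (tagged p) == K (tag p) (tagged p) %[mod N])].
  apply: contraR KK'; rewrite negb_exists => /forallP Kp; apply/forallP => i; apply/forallP => j.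
  by have := Kp (existT (fun i => 'I_(n i)) i j); rewrite negbK.
by rewrite (bigD1 p) //= (negbTE pK) mul0r.
Qed.

Section Model.
Variables (m : 'I_k -> nat) (a : forall i : 'I_k, seq 'I_(n i) -> R).
Arguments a : clear implicits.
Hypothesis m_ge1 : forall i, (1 <= m i)%N.
Hypothesis a_reg : forall i, positive_regular (a i).

Local Notation sv := (symvec m a).
Local Notation beta := (mbeta m a).
Let mbeta_gt0 b : 0 < beta b := mbeta_gt0 m_ge1 a_reg b.
Let weight_gt0 K : 0 < weight m a K := weight_gt0 m_ge1 a_reg K.

(** One radius serves all groups of variables if it is small against the sum of the
n_i M_i, where M_i bounds the growth of the coefficients of f_i. *)
Lemma small_torus : exists2 r : R, 0 < r &
  forall z, (forall i j, normc (z i j) = r) -> polydomain a z.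
Proof.
have /choice[M MP] : forall i, exists M, 1 <= M /\ forall w, a i w <= M ^+ size w.
  by move=> i; have [M M1 aM] := positive_regular_growth (a_reg i); exists M.
pose S := 1 + \sum_i (n i)%:R * M i.
have nM0 i : 0 <= (n i)%:R * M i by rewrite mulr_ge0 // (le_trans ler01) //; case: (MP i).
have S1 : 1 <= S by rewrite lerDl sumr_ge0.
have S0 : 0 < S by apply: lt_le_trans S1.
exists (4 * S)^-1 => [|z zr i]; first by rewrite invr_gt0 mulr_gt0.
have [M1 aM] := MP i; apply: (fsqval_lt1 (a_reg i) M1 aM _ (zr i)).
rewrite mulrA; apply: (@le_trans _ _ (S * (4 * S)^-1 ^+ 2)).
  rewrite ler_wpM2r ?sqr_ge0 // /S (bigD1 i) //= addrCA lerDl addr_ge0 // sumr_ge0 //.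
rewrite (_ : S * _ = 4^-1 * (4 * S)^-1); last by field; rewrite gt_eqF.
by rewrite ler_piMr ?invr_ge0 // invf_le1 ?mulr_gt0 //; lra.
Qed.

(** The average of the u_z over the discretized torus of radius r, against the
character of K, has coordinates sqrt (beta_b) r^|b| at the multiwords b whose letter
counts are congruent to K modulo N. Those with letter counts K give a multiple of
w^K; for large N the others avoid any given finite set of multiwords, and so form a
small tail of the norm of u_r. *)
Lemma wbasis_clspan_Gamma K : clspan [set Gamma m a z | z in polydomain a] (wbasis m a K).
Proof.
set S := [set Gamma m a z | z in polydomain a].
have Soo : S `<=` ell2 by move=> _ [z zD <-]; apply: ell2Z; exact: uvec_ell2.
have [r r0 rD] := small_torus; have r0' := ltW r0.
have rD1 : polydomain a (fun i (_ : 'I_(n i)) => r%:C).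
  by apply: rD => i j; rewrite normc_realE ger0_norm.
pose f b : R := beta b * rpow r (mcnt b) ^+ 2.
have f0 b : 0 <= f b by rewrite mulr_ge0 ?sqr_ge0 ?ltW.
have foo : (\esum_(b in [set: mword n]) (f b)%:E < +oo)%E.
  have := uvec_ell2 m_ge1 a_reg rD1; rewrite /ell2 /= /sqnorm2.
  rewrite (eq_esum (b := fun b => (f b)%:E)) // => b _; congr (_%:E).
  rewrite uvecE // Normc.normcM normc_conj normc_realE ger0_norm ?sqrtr_ge0 //.
  rewrite exprMn sqr_sqrtr ?ltW // (normc_monomial (r := r)) // => i j.
  by rewrite normc_realE ger0_norm.
suff xS : clspan S ((rpow r K / weight m a K)%:C *: wbasis m a K).
  have c0 : (rpow r K / weight m a K)%:C != 0 :> C.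
    by rewrite real_complex_eq0 gt_eqF // divr_gt0 // rpow_gt0.
  rewrite -[wbasis m a K]scale1r -(mulVf c0) -scalerA -[_ *: _]addr0.
  by apply: clspanL => //; exact: clspan0.
apply: clspan_closed => // [|eps eps0].
  by apply: ell2Z; apply: (wbasis_ell2 m_ge1 a_reg); exists K.
have eps2 : 0 < (eps / 2) ^+ 2 by rewrite exprn_gt0 // divr_gt0.
have [A AP] := esum_tail f0 foo eps2.
have [N [N0 KN AN]] : exists N, [/\ (0 < N)%N, (deg K < N)%N & forall b, b \in A -> (deg (mcnt b) < N)%N].
  have [M AM] := fset_bounded (fun b => deg (mcnt b)) A.
  exists (deg K + M).+1; split=> // [|b /AM bM]; first by rewrite ltnS leq_addr.
  by rewrite ltnS (leq_trans (ltnW bM)) // leq_addl.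
have [J [z [e [zr ze]]]] := torus_average K N0 r0'.
exists (\sum_t (e t)^* *: uvec m a (z t)).
  apply: clspan_sum => // t; have zD := rD _ (zr t).
  have [D0 _ _] := uvec_ell2_norm2 m_ge1 a_reg zD.
  have s0 : (Num.sqrt (Delta m a (z t)))%:C != 0 :> C.
    by rewrite real_complex_eq0 gt_eqF // sqrtr_gt0.
  have GS : clspan S (Gamma m a (z t)) by apply: clspan_base => //; exists (z t).
  have -> : (e t)^* *: uvec m a (z t) = ((e t)^* / (Num.sqrt (Delta m a (z t)))%:C) *: Gamma m a (z t) + 0.
    by rewrite addr0 /Gamma scalerA divfK.
  by apply: clspanL => //; exact: clspan0.
pose g b : R := if (mcnt b != K) && congr_mod N K (mcnt b) then f b else 0.
have gE : sqnorm2 ((rpow r K / weight m a K)%:C *: wbasis m a K - \sum_t (e t)^* *: uvec m a (z t))%R =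
    \esum_(b in [set: mword n]) (g b)%:E.
  apply: eq_esum => b _; congr (_%:E); rewrite !fctE fct_sumE.
  rewrite (eq_bigr (fun t => (Num.sqrt (beta b))%:C * (e t * monomial (z t) (mcnt b))^*)); last first.
    by move=> t _; rewrite fctE uvecE // conjcM /GRing.scale /=; ring.
  rewrite -mulr_sumr -conjc_sum ze conjcM conjc_real conjc_nat.
  rewrite wbasisE // /symvec /delta /g /GRing.scale /=.
  have w0 : (weight m a (mcnt b))%:C != 0 :> C by rewrite real_complex_eq0 gt_eqF.
  case: eqP => [bK|bK] /=.
    rewrite bK congr_mod_refl !mulr1 -real_complexM -real_complexM -real_complexB normc_realE.
    rewrite (_ : _ - _ = 0) ?normr0 ?expr0n //.
    by rewrite -bK; field; rewrite gt_eqF.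
  rewrite !mulr0 sub0r normcN !Normc.normcM !normc_realE !ger0_norm ?sqrtr_ge0 ?rpow_ge0 //.
  case: ifP => _; last by rewrite Normc.normc0 !mulr0 expr0n.
  by rewrite Normc.normc1 mulr1 exprMn sqr_sqrtr // ltW.
have gf b : 0 <= g b <= f b by rewrite /g; case: ifP; rewrite ?lexx ?f0.
have gA b : b \in A -> g b = 0.
  move=> /AN bN; rewrite /g; case: eqP => //= bK; case: ifP => // /(congr_mod_small KN bN) //.
have nle := AP g gf gA; rewrite -gE in nle.
rewrite /norm2; apply: (@le_lt_trans _ _ (eps / 2)); last by rewrite ltr_pdivrMr // ltr_pMr // ltr1n.
rewrite -(ler_sqr) ?nnegrE ?sqrtr_ge0 ?divr_ge0 ?(ltW eps0) //.
have q0 : (0 <= sqnorm2 ((rpow r K / weight m a K)%:C *: wbasis m a K - \sum_t (e t)^* *: uvec m a (z t))%R)%E.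
  by apply: esumT_ge0 => b; exact: sqr_ge0.
rewrite sqr_sqrtr ?fine_ge0 // -lee_fin fineK //.
by rewrite ge0_fin_numE // (le_lt_trans nle) // ltry.
Qed.

Lemma clspan_Gamma_Fs2 : clspan [set Gamma m a z | z in polydomain a] = Fs2 m a.
Proof.
have Soo : [set Gamma m a z | z in polydomain a] `<=` ell2.
  by move=> _ [z zD <-]; apply: ell2Z; exact: uvec_ell2.
apply/seteqP; split=> x.
  move=> xS; apply/(Fs2P m_ge1 a_reg); split; first by case: xS.
  apply: (clspan_symvec m_ge1 a_reg) xS => // _ [z zD <-].
  exists (fun K => (Num.sqrt (Delta m a z))%:C * ((monomial z K)^* / (weight m a K)%:C)).
  apply/funext => b; rewrite /Gamma fctE uvecE // /symvec real_complexM /GRing.scale /=.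
  by field; rewrite real_complex_eq0 gt_eqF.
apply: clspan_min => //; first exact: (wbasis_ell2 m_ge1 a_reg).
by move=> _ [K _ <-]; exact: wbasis_clspan_Gamma.
Qed.

(** * Uniqueness of the coefficients *)

(** The same averages, applied to the values of the series, isolate |d_K| r^|K| up
to a small tail of the absolutely convergent series at the radius r. *)
Lemma power_series_eq0 d :
  (forall z, polydomain a z -> has_csum (fun K => d K * monomial z K) 0) -> d = 0.
Proof.
move=> d0; have [r r0 rD] := small_torus; have r0' := ltW r0.
have rD1 : polydomain a (fun i (_ : 'I_(n i)) => r%:C).
  by apply: rD => i j; rewrite normc_realE ger0_norm.
pose f K : R := normc (d K) * rpow r K.
have f0 K : 0 <= f K by rewrite mulr_ge0 ?normc_ge0 ?rpow_ge0.
have foo : (\esum_(K in [set: mindex n]) (f K)%:E < +oo)%E.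
  apply: le_lt_trans (has_csum_abs_summable (d0 _ rD1)); apply: le_esumT => K.
  rewrite Normc.normcM (normc_monomial (r := r)) // => i j.
  by rewrite normc_realE ger0_norm.
apply/funext => K; apply/eqP; rewrite -normc_eq0 eq_le normc_ge0 andbT.
rewrite -(ler_pM2r (rpow_gt0 K r0)) mul0r; apply/ler_addgt0Pr => eps eps0; rewrite add0r.
have [A AP] := esum_tail f0 foo eps0.
have [N [N0 KN AN]] : exists N, [/\ (0 < N)%N, (deg K < N)%N & forall K', K' \in A -> (deg K' < N)%N].
  have [M AM] := fset_bounded deg A.
  exists (deg K + M).+1; split=> // [|K' /AM bM]; first by rewrite ltnS leq_addr.
  by rewrite ltnS (leq_trans (ltnW bM)) // leq_addl.
have [J [z [e [zr ze]]]] := torus_average K N0 r0'.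
have avg0 : has_csum (fun K' => d K' * ((rpow r K')%:C * (congr_mod N K K')%:R)) 0.
  have := has_csum_sum (r := index_enum J) (fun t => has_csumZ (c := e t) (d0 _ (rD _ (zr t)))).
  apply: eq_has_csum => [K'|]; last by rewrite big1 // => t _; rewrite mulr0.
  by rewrite -ze mulr_sumr; apply: eq_bigr => t _; rewrite mulrCA.
have := has_csum_single (x := fun K' => if K' == K then d K' * (rpow r K')%:C else 0) (i0 := K).
rewrite eqxx => /(_ _)/(has_csumL (c := -1)) H.
have {H} : has_csum (fun K' => if (K' != K) && congr_mod N K K' then d K' * (rpow r K')%:C else 0)
    (- (d K * (rpow r K)%:C)).
  apply: eq_has_csum (H _ _ _ avg0) => [K'||K' /negbTE -> //]; last by rewrite mulN1r addr0.
  case: eqP => [->|_] /=; first by rewrite congr_mod_refl mulr1 mulN1r addNr.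
  by rewrite mulr0 add0r; case: ifP; rewrite ?mulr1 ?mulr0.
pose g K' : R := if (K' != K) && congr_mod N K K' then f K' else 0.
move=> /(csum_le (f := g) (M := eps)).
rewrite normcN Normc.normcM normc_realE ger0_norm ?rpow_ge0 //; apply.
  move=> K'; rewrite /g; case: ifP => _; last by rewrite Normc.normc0.
  by rewrite Normc.normcM normc_realE ger0_norm ?rpow_ge0.
apply: AP => K'; first by rewrite /g; case: ifP; rewrite ?lexx ?f0.
by move=> /AN K'N; rewrite /g; case: eqP => //= K'K; case: ifP => // /(congr_mod_small KN K'N).
Qed.

End Model.
End Analytic.

(** * The space of power series *)

Section FunctionSpace.
Context {R : realType} {k : nat} {n : 'I_k -> nat}.
Local Notation C := R[i].
#[local] Opaque has_csum.
Variables (m : 'I_k -> nat) (a : forall i : 'I_k, seq 'I_(n i) -> R).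
Arguments a : clear implicits.
Hypothesis m_ge1 : forall i, (1 <= m i)%N.
Hypothesis a_reg : forall i, positive_regular (a i).
Implicit Types (x y : mword n -> C) (c d : mindex n -> C) (phi : polydomain a -> C).

Local Notation sv := (symvec m a).

Lemma power_series_unique phi c d : power_series phi c -> power_series phi d -> c = d.
Proof.
move=> pc pd; apply/eqP; rewrite -subr_eq0; apply/eqP.
apply: (power_series_eq0 (a := a) a_reg) => z zD.
pose z' : polydomain a := SigSub (mem_set zD).
have := has_csumL (c := -1) (pd z') (pc z'); apply: eq_has_csum => [K|].
  by rewrite /= !fctE mulrBl mulN1r addrC.
by rewrite mulN1r addNr.
Qed.

Lemma H2coefE phi c : power_series phi c -> H2coef phi = c.
Proof.
move=> pc; rewrite /H2coef; case: xgetP => [d _ pd|/(_ c) //].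
exact: power_series_unique pd pc.
Qed.

Lemma frep_power_series c : ell2 (sv c) -> power_series (frep m a (sv c)) c.
Proof. by move=> coo z; apply: symvec_uvec => //; exact: set_valP. Qed.

Lemma frepL (l : C) x y : ell2 x -> ell2 y ->
  frep m a (l *: x + y) = l *: frep m a x + frep m a y.
Proof.
move=> xoo yoo; apply/funext => z; rewrite /frep innerL //.
by apply: uvec_ell2 => //; exact: set_valP.
Qed.

Lemma frep_H2 x : Fs2 m a x -> H2 m a (frep m a x).
Proof.
move=> /(Fs2P m_ge1 a_reg) [xoo [c xc]]; rewrite xc in xoo *; exists c.
  exact: frep_power_series.
by rewrite symvec_ell2 in xoo.
Qed.

Lemma H2_frep phi : H2 m a phi -> exists2 x, Fs2 m a x & phi = frep m a x.
Proof.
move=> [c pc coo]; have svoo : ell2 (sv c) by rewrite symvec_ell2.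
exists (sv c); first by apply/(Fs2P m_ge1 a_reg); split=> //; exists c.
by apply/funext => z; apply: has_csum_unique (pc z) _; exact: frep_power_series.
Qed.

Lemma frep_inj x y : Fs2 m a x -> Fs2 m a y -> frep m a x = frep m a y -> x = y.
Proof.
move=> /(Fs2P m_ge1 a_reg) [xoo [c xc]] /(Fs2P m_ge1 a_reg) [yoo [d yd]].
rewrite xc yd in xoo yoo * => xy; congr symvec.
apply: power_series_unique (frep_power_series xoo) _.
by rewrite xy; exact: frep_power_series.
Qed.

Lemma frep_inner x y : Fs2 m a x -> Fs2 m a y ->
  H2inner m a (frep m a x) (frep m a y) = inner x y.
Proof.
move=> /(Fs2P m_ge1 a_reg) [xoo [c xc]] /(Fs2P m_ge1 a_reg) [yoo [d yd]].
rewrite xc yd in xoo yoo *.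
rewrite /H2inner (H2coefE (frep_power_series xoo)) (H2coefE (frep_power_series yoo)).
by apply: csumE; exact: symvec_inner.
Qed.

Lemma frep_norm x : Fs2 m a x -> H2norm m a (frep m a x) = norm2 x.
Proof.
move=> /(Fs2P m_ge1 a_reg) [xoo [c xc]]; rewrite xc in xoo *.
by rewrite /H2norm (H2coefE (frep_power_series xoo)) symvec_norm2.
Qed.

Lemma Fs2_ell2 x : Fs2 m a x -> ell2 x.
Proof. by case. Qed.

Lemma Fs2L (l : C) x y : Fs2 m a x -> Fs2 m a y -> Fs2 m a (l *: x + y).
Proof. by apply: clspanL; exact: wbasis_ell2. Qed.

Lemma Fs2B x y : Fs2 m a x -> Fs2 m a y -> Fs2 m a (x - y).
Proof. by move=> xF yF; rewrite addrC -scaleN1r; exact: Fs2L. Qed.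

Lemma frepB x y : ell2 x -> ell2 y -> frep m a (x - y) = frep m a x - frep m a y.
Proof. by move=> xoo yoo; rewrite addrC -scaleN1r frepL // scaleN1r addrC. Qed.

Lemma Fs2_complete (u : nat -> mword n -> C) : (forall N, Fs2 m a (u N)) ->
  (forall e : R, 0 < e -> exists N0 : nat, forall p q : nat,
     (N0 <= p)%N -> (N0 <= q)%N -> norm2 (u p - u q) < e) ->
  exists2 x, Fs2 m a x & (fun N => norm2 (u N - x)) @ \oo --> (0 : R).
Proof.
move=> uF uC; have [x xoo ux] := ell2_complete (fun N => Fs2_ell2 (uF N)) uC.
exists x => //; apply: clspan_closed => //; first exact: wbasis_ell2.
move=> e e0; have [N NP] := (cvg0P _).1 ux e e0; exists (u N); first exact: uF.
have := NP N (leqnn N); rewrite ger0_norm ?norm2_ge0 // norm2_distC //.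
exact/Fs2_ell2/uF.
Qed.

(** The function space is a Hilbert space because it is the isometric image of a
closed subspace of a Hilbert space. *)
Lemma H2_hilbert : is_hilbert (H2 m a) (H2inner m a) (H2norm m a).
Proof.
split.
- have F0 : Fs2 m a 0 by exact: clspan0.
  have := frep_H2 F0; congr H2; apply/funext => z; exact: inner0l.
- move=> l _ _ /H2_frep[x xF ->] /H2_frep[y yF ->].
  rewrite -frepL; [|exact: Fs2_ell2..].
  exact/frep_H2/Fs2L.
- move=> l _ _ _ /H2_frep[x xF ->] /H2_frep[y yF ->] /H2_frep[z zF ->].
  rewrite -frepL; [|exact: Fs2_ell2..].
  rewrite !frep_inner //; last exact: Fs2L.
  by apply: innerL; exact: Fs2_ell2.
- move=> _ _ /H2_frep[x xF ->] /H2_frep[y yF ->].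
  by rewrite !frep_inner //; apply: inner_conj; exact: Fs2_ell2.
- move=> _ /H2_frep[x xF ->]; rewrite frep_inner // frep_norm //.
  by apply: inner_norm; exact: Fs2_ell2.
- by move=> phi _; exact: sqrtr_ge0.
- move=> _ /H2_frep[x xF ->]; rewrite frep_norm // => x0.
  rewrite (norm2_eq0 (Fs2_ell2 xF) x0); apply/funext => z; exact: inner0l.
- move=> v vH vC.
  have /choice[u uP] : forall N, exists x, Fs2 m a x /\ v N = frep m a x.
    by move=> N; have [x xF vx] := H2_frep (vH N); exists x.
  have uF N := (uP N).1; have uoo N := Fs2_ell2 (uF N).
  have dist N y : Fs2 m a y -> H2norm m a (v N - frep m a y) = norm2 (u N - y).
    move=> yF; rewrite (uP N).2 -frepB //; last exact: Fs2_ell2.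
    by rewrite frep_norm //; exact: Fs2B.
  have [e /vC[N NP]|x xF ux] := Fs2_complete uF.
    exists N => p q Np Nq; have := NP p q Np Nq.
    by rewrite (uP q).2 dist.
  exists (frep m a x); first exact: frep_H2.
  rewrite (_ : (fun N => _) = fun N => norm2 (u N - x)) //.
  by apply/funext => N; exact: dist.
Qed.

Lemma kappa_inner (z u : polydomain a) :
  kappa m a z u = inner (uvec m a (set_val u)) (uvec m a (set_val z)).
Proof. by symmetry; apply: innerE; apply: uvec_csum => //; exact: set_valP. Qed.

(** The quadratic form is the squared norm of the linear combination of the u_(p t)
with coefficients c_t. *)
Lemma kappa_positive_definite : positive_definite (kappa m a).
Proof.
move=> N p c; pose v t := uvec m a (set_val (p t)).
have voo t : ell2 (v t) by apply: uvec_ell2 => //; exact: set_valP.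
have cvoo t : ell2 (c t *: v t) by exact: ell2Z.
have yoo : ell2 (\sum_(t < N) c t *: v t) by exact: ell2_sum.
rewrite (_ : \sum_(s < N) _ = inner (\sum_(t < N) c t *: v t) (\sum_(t < N) c t *: v t)).
  by rewrite inner_norm // ler0c sqr_ge0.
rewrite inner_sumr //; apply: eq_bigr => s _; rewrite inner_sum //; apply: eq_bigr => t _.
rewrite innerZ // (inner_conj (cvoo s)) // innerZ // conjcM -inner_conj // kappa_inner.
by rewrite /v; ring.
Qed.

End FunctionSpace.

Theorem theorem3p5 (R : realType) (k : nat) (n m : 'I_k -> nat)
    (a : forall i : 'I_k, seq 'I_(n i) -> R)
    (k_ge1 : (1 <= k)%N)
    (n_ge1 : forall i, (1 <= n i)%N)
    (m_ge1 : forall i, (1 <= m i)%N)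
    (a_reg : forall i, positive_regular (a i)) :
  (* (i) *)
  (Fs2 m a = clspan [set Gamma m a z | z in polydomain a] /\
   clspan [set Gamma m a z | z in polydomain a] = NQc m a) /\
  (* (ii) *)
  ([/\ (* the coefficients, hence the norm, of an element of H2 are unique *)
       forall phi, H2 m a phi ->
         exists! c : mindex n -> R[i], power_series phi c,
       is_hilbert (H2 m a) (H2inner m a) (H2norm m a)
     & forall z, polydomain a z -> ell2 (uvec m a z)] /\
   (* unitary identification *)
   [/\ set_bij (Fs2 m a) (H2 m a) (frep m a),
       forall (c : R[i]) x y, Fs2 m a x -> Fs2 m a y ->
         frep m a (c *: x + y) = c *: frep m a x + frep m a y,
       forall x y, Fs2 m a x -> Fs2 m a y ->
         H2inner m a (frep m a x) (frep m a y) = inner x y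
     & forall x, Fs2 m a x -> H2norm m a (frep m a x) = norm2 x] /\
   (* functional representation *)
   [/\ forall x, Fs2 m a x ->
         exists c : mindex n -> R[i],
           has_l2sum (fun K => c K *: wbasis m a K) x,
       forall x (c : mindex n -> R[i]), Fs2 m a x ->
         has_l2sum (fun K => c K *: wbasis m a K) x ->
         forall z, polydomain a z ->
           has_csum (fun K => c K * monomial z K) (inner x (uvec m a z))
     & forall x, Fs2 m a x -> forall z, polydomain a z ->
         normc (inner x (uvec m a z)) <= norm2 x / Num.sqrt (Delta m a z)]) /\
  (* (iii) *)
  [/\ (* kappa is well defined *)
      forall (z u : polydomain a) (i : 'I_k),
        (\esum_(w in [set: seq 'I_(n i)])
           (normc (fterm (a i) (set_val z i) (set_val u i) w))%:E < +oo)%E /\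
        1 - feval (a i) (set_val z i) (set_val u i) != 0,
      positive_definite (kappa m a)
    & forall z u : polydomain a,
        kappa m a z u = inner (uvec m a (set_val u)) (uvec m a (set_val z))].
Proof.
split.
  have GE := clspan_Gamma_Fs2 m_ge1 a_reg; split; rewrite GE //.
  by apply/seteqP; split=> x; rewrite (Fs2P m_ge1 a_reg) (NQcP m_ge1 a_reg).
split; last first.
  split; [|exact: kappa_positive_definite|by move=> z u; exact: kappa_inner].
  move=> z u i; have [zD uD] := (set_valP z i, set_valP u i).
  have [a0 an _ _] := a_reg i; split; first exact: fterm_summable.
  by have [] := bcoef_csum a0 an (m_ge1 i) zD uD.
split; first split.
- move=> phi [c pc coo]; exists c; split=> // d; exact: power_series_unique pc.
- exact: H2_hilbert.
- by move=> z zD; exact: uvec_ell2.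
split; split.
- split=> [x xF|x y xF yF|phi /(H2_frep m_ge1 a_reg)[x xF ->]]; first exact: frep_H2.
    by rewrite !inE in xF yF; exact: frep_inj xF yF.
  by exists x.
- move=> c x y xF yF; exact: (frepL m_ge1 a_reg c (Fs2_ell2 xF) (Fs2_ell2 yF)).
- by move=> x y xF yF; exact: frep_inner.
- by move=> x xF; exact: frep_norm.
- move=> x /(Fs2P m_ge1 a_reg)[xoo [c xc]]; exists c; rewrite xc in xoo *.
  exact: symvec_l2sum.
- move=> x c xF xc z zD; have xoo := Fs2_ell2 xF.
  have xE := l2sum_symvec m_ge1 a_reg xoo xc; rewrite xE in xoo *.
  exact: symvec_uvec.
- move=> x xF z zD; have [_ uoo uN] := uvec_ell2_norm2 m_ge1 a_reg zD.
  by rewrite -uN; apply: Cauchy_Schwarz => //; exact: Fs2_ell2 xF.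
Qed.
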